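(* Let $\mathcal{L}$ be a finite relational language, $T$ a complete $\mathcal{L}$-theory, $\mathcal{U}$ a monster model of $T$ and $M\prec\mathcal{U}$ a small elementary submodel. Let $\mu\in\mathfrak{M}_x^{\mathrm{inv}}(\mathcal{U},M)$ satisfy the excellent measure extension axiom. Then there exists a countable $\mathcal{L}$-structure $N$ such that $\mathbb{P}_\mu(B_N)=1$.
   Context: Keisler measures: for a (possibly infinite) tuple of variables $x$ and $A\subseteq\mathcal U$, $S_x(A)$ is the Stone space of complete types in $x$ over $A$; a Keisler measure on $\mathcal L_x(A)$ is a finitely additive probability measure on the Boolean algebra of $\mathcal L(A)$-formulas in $x$ (modulo equivalence), identified with its unique extension to a regular Borel probability measure on $S_x(A)$; $[\varphi]$ denotes the clopen set of types containing $\varphi$. $\mathfrak M_x(\mathcal U)$ is the set of global Keisler measures. $\mu\in\mathfrak M_x(\mathcal U)$ is $M$-invariant if $\mu(\varphi(x,a))=\mu(\varphi(x,b))$ for every $\mathcal L$-formula $\varphi(x,y)$ and all $a\equiv_M b$; $\mathfrak M_x^{\mathrm{inv}}(\mathcal U,M)$ is the set of these. For such $\mu$, a small model $N'\supseteq M$ and an $\mathcal L(N')$-formula $\varphi(x,y)$, let $F^{\varphi}_{\mu,N'}:S_y(N')\to[0,1]$, $q\mapsto\mu(\varphi(x,b))$ for any $b\models q$. $\mu$ is Borel-definable over $M$ if every $F^\varphi_{\mu,M}$ ($\varphi$ an $\mathcal L$-formula) is Borel. For $\mu$ Borel-definable over $M$ and $\nu\in\mathfrak M_y(\mathcal U)$,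 the Morley product is $(\mu\otimes\nu)(\varphi(x,y))=\int_{S_y(N')}F^{\varphi}_{\mu,N'}\,d(\nu|_{N'})$ for any small $N'\supseteq M$ containing the parameters of $\varphi$. Put $\mu^{(1)}(x_1)=\mu(x_1)$ and $\mu^{(n+1)}(x_1,\dots,x_{n+1})=\mu(x_{n+1})\otimes\mu^{(n)}(x_1,\dots,x_n)$. $\mu$ is $M$-adequate if it is Borel-definable over $M$, every $\mu^{(n)}$ is Borel-definable over $M$, and iterated Morley products of copies of $\mu$ do not depend on the placement of parentheses; $M$-excellent if moreover $\mu_x\otimes\mu_y=\mu_y\otimes\mu_x$. With $\mathbf x=(x_i)_{i\ge1}$, $|x_i|=|x|$, $\mathbb P_\mu$ is the unique regular Borel probability measure on $S_{\mathbf x}(\mathcal U)$ with $\mathbb P_\mu([\varphi(x_1,\dots,x_n)])=\mu^{(n)}(\varphi(x_1,\dots,x_n))$ for all $\mathcal L(\mathcal U)$-formulas $\varphi$. Induced structure: for $p\in S_{\mathbf x}(\mathcal U)$, take a realization $(a_i)_{i\ge1}$ of $p$ in an elementary extension $\mathcal U'$ of $\mathcal U$; $p_{\mathcal L}$ is the isomorphism type of the substructure of $\mathcal U'$ induced on $\{a_i:i\ge1\}$ (independent of the realization). For an $\mathcal L$-structure $N$, $B_N=\{p\in S_{\mathbf x}(\mathcal U):p_{\mathcal L}\cong N\}$. Diagrams: for $\bar a=(a_1,\dots,a_n)$ from $\mathcal U$, $\mathrm{diag}_{\bar a}(x_1,\dots,x_n)$ is the conjunction of all atomic and negated atomic $\mathcal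 L$-formulas in $x_1,\dots,x_n$ satisfied by $\bar a$ (the quantifier-free diagram). Measure extension axioms: $\mu\in\mathfrak M^{\mathrm{inv}}_x(\mathcal U,M)$ satisfies the adequate measure extension axiom if $\mu$ is $M$-adequate and for all $a_1,\dots,a_{n+1}\in\mathcal U$, with $\bar a=(a_1,\dots,a_n)$: if $(\mu_{x_{n+1}}\otimes\mu^{(n)}_{x_1,\dots,x_n})(\mathrm{diag}_{\bar a,a_{n+1}}(x_1,\dots,x_{n+1}))>0$, then $\mu^{(n)}|_M\big([\mathrm{diag}_{\bar a}(x_1,\dots,x_n)]\cap (F^{\varphi}_{\mu,M})^{-1}(\{1\})\big)=0$, where $\varphi(x_{n+1};x_1,\dots,x_n)=\neg\mathrm{diag}_{\bar a,a_{n+1}}(x_1,\dots,x_{n+1})$, i.e. $F^\varphi_{\mu,M}(q)=\mu(\neg\mathrm{diag}_{\bar a,a_{n+1}}(c_1,\dots,c_n,x_{n+1}))$ for $(c_1,\dots,c_n)\models q\in S_{x_1,\dots,x_n}(M)$. It satisfies the excellent measure extension axiom if moreover $\mu$ is $M$-excellent. *)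

(* Defs.v *)
From HB Require Import structures.
From mathcomp Require Import all_boot all_order all_algebra.
From mathcomp Require Import all_classical all_reals all_analysis.

Set Implicit Arguments.
Unset Strict Implicit.
Unset Printing Implicit Defensive.

Local Open Scope classical_set_scope.
Local Open Scope card_scope.
Local Open Scope ring_scope.

Record language := Language {
  rel_sym : finType;
  arity : rel_sym -> nat }.

(* [formula L V]: formulas (with equality) whose free variables are elements
   of [V]; the variable bound by [fEx] is the element [None] of [option V].
   A formula in variables [V] with parameters in [U] is a
   [formula L (V + U)]. *)
Inductive formula (L : language) (V : Type) : Type :=
| fTrue
| fEq of V & V
| fRel (r : rel_sym L) of ('I_(arity r) -> V)
| fNot of formula L V
| fAnd of formula L V & formula L V
| fEx of formula L (option V).

Arguments fTrue {L V}.
Arguments fEq {L V}.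
Arguments fRel {L V}.
Arguments fNot {L V}.
Arguments fAnd {L V}.
Arguments fEx {L V}.

HB.instance Definition _ L V := gen_eqMixin (formula L V).
HB.instance Definition _ L V := gen_choiceMixin (formula L V).
HB.instance Definition _ L V := isPointed.Build (formula L V) fTrue.

Definition fOr L V (f g : formula L V) := fNot (fAnd (fNot f) (fNot g)).

Definition sentence (L : language) := formula L void.

Fixpoint frename L V W (s : V -> W) (f : formula L V) : formula L W :=
  match f with
  | fTrue => fTrue
  | fEq x y => fEq (s x) (s y)
  | fRel r v => fRel r (s \o v)
  | fNot g => fNot (frename s g)
  | fAnd g h => fAnd (frename s g) (frename s h)
  | fEx g => fEx (frename (omap s) g)
  end.

Fixpoint free_in L V (P : V -> Prop) (f : formula L V) : Prop :=
  match f with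
  | fTrue => True
  | fEq x y => P x /\ P y
  | fRel r v => forall k, P (v k)
  | fNot g => free_in P g
  | fAnd g h => free_in P g /\ free_in P h
  | fEx g => free_in (fun o => if o is Some x then P x else True) g
  end.

Record structure (L : language) := Structure {
  carrier :> Type;
  carrier_inhabited : inhabited carrier;
  interp : forall r : rel_sym L, ('I_(arity r) -> carrier) -> Prop }.

Fixpoint sat L (U : structure L) V (e : V -> U) (f : formula L V) : Prop :=
  match f with
  | fTrue => True
  | fEq x y => e x = e y
  | fRel r v => interp (e \o v)
  | fNot g => ~ sat e g
  | fAnd g h => sat e g /\ sat e h
  | fEx g => exists a : U, sat (fun o => if o is Some x then e x else a) g
  end.

Definition asg (V P X : Type) (v : V -> X) (j : P -> X) (s : V + P) : X :=
  match s with inl x => v x | inr a => j a end.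

Definition satp L (U : structure L) V (v : V -> U) (f : formula L (V + U)) :=
  sat (asg v id) f.

Definition models L (U : structure L) (T : set (sentence L)) :=
  forall f, T f -> sat (of_void U) f.

Definition entails L (T : set (sentence L)) (f : sentence L) :=
  forall U : structure L, models U T -> models U [set f].

Definition complete_theory L (T : set (sentence L)) :=
  (exists U : structure L, models U T) /\
  forall f, entails T f \/ entails T (fNot f).

Definition isomorphic L (N N' : structure L) :=
  exists2 h : N -> N', bijective h &
    forall r (v : 'I_(arity r) -> N), interp v <-> interp (h \o v).

Definition elementary_embedding L (N U : structure L) (j : N -> U) :=
  forall V (v : V -> N) (f : formula L V), sat v f <-> sat (j \o v) f.

Lemma nonempty_inhabited X (A : set X) : A !=set0 -> inhabited {x | A x}.
Proof. by move=> [x Ax]; exact: inhabits (exist _ x Ax). Qed.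

Definition substructure L (U : structure L) (A : set U) (A0 : A !=set0) :
    structure L :=
  @Structure L {x | A x} (nonempty_inhabited A0)
    (fun r v => interp (fun k => sval (v k))).

Definition elementary_substructure L (U : structure L) (M : set U) :=
  exists M0 : M !=set0,
    elementary_embedding (sval : substructure M0 -> U).

(* [f] is an L(A)-formula *)
Definition lang_over L (U : structure L) V (A : set U) (f : formula L (V + U)) :=
  free_in (fun s => if s is inr a then A a else True) f.

(* [stype U V A] is the set S_V(A) of complete types over [A] in the variables
   [V]; consistency with the elementary diagram of [A] is finite
   satisfiability in [U]. *)
Record stype L (U : structure L) (V : Type) (A : set U) := SType {
  stype_set :> formula L (V + U) -> Prop;
  stype_over : forall f, stype_set f -> lang_over A f;
  stype_fsat : forall s : seq (formula L (V + U)),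
    (forall f, f \in s -> stype_set f) ->
    exists v : V -> U, forall f, f \in s -> satp v f;
  stype_complete : forall f, lang_over A f -> stype_set f \/ stype_set (fNot f) }.

Section TypeOfTuple.
Context L (U : structure L) (V : Type) (A : set U) (v : V -> U).
Let p := [set f : formula L (V + U) | lang_over A f /\ satp v f].
Let p_over f : p f -> lang_over A f. Proof. by case. Qed.
Let p_fsat (s : seq (formula L (V + U))) : (forall f, f \in s -> p f) ->
  exists v : V -> U, forall f, f \in s -> satp v f.
Proof. by move=> sp; exists v => f /sp[]. Qed.
Let p_complete f : lang_over A f -> p f \/ p (fNot f).
Proof. by move=> Af; have [vf|vf] := pselect (satp v f); [left|right]. Qed.
Definition tp : stype V A := SType p_over p_fsat p_complete.
End TypeOfTuple.

Definition realizes L (U : structure L) V (A : set U) (b : V -> U)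
    (q : stype V A) := forall f, q f -> satp b f.

Definition clopen_of L (U : structure L) V (A : set U) (f : formula L (V + U)) :
  set (stype V A) := [set p : stype V A | p f].
Arguments clopen_of {L U V} A f.

Lemma structure_ex L (U : structure L) : exists _ : U, True.
Proof. by have [x] := carrier_inhabited U; exists x. Qed.

HB.instance Definition _ L (U : structure L) V (A : set U) :=
  gen_eqMixin (stype V A).
HB.instance Definition _ L (U : structure L) V (A : set U) :=
  gen_choiceMixin (stype V A).
HB.instance Definition _ L (U : structure L) V (A : set U) :=
  isPointed.Build (stype V A) (tp A (fun _ => projT1 (cid (structure_ex U)))).
HB.instance Definition _ L (U : structure L) V (A : set U) :=
  @isSubBaseTopological.Build (stype V A) (formula L (V + U))
    (@lang_over L U V A) (clopen_of A).

Definition borel L (U : structure L) V (A : set U) :=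
  g_sigma_algebraType (@open (stype V A)).

(* Smallness is measured by a cardinal kappa, given as the type [K]. *)
Definition small (K X : Type) (A : set X) := ~~ ([set: K] #<= A).

Definition saturated L (K : Type) (U : structure L) :=
  forall A : set U, small K A ->
    forall p : stype unit A, exists b, realizes b p.

Definition strongly_homogeneous L (K : Type) (U : structure L) :=
  forall (A : set U) (h : U -> U), small K A ->
    (forall (f : formula L (void + U)), lang_over A f ->
       sat (asg (of_void U) id) f <-> sat (asg (of_void U) h) f) ->
    exists g : U -> U, [/\ bijective g, elementary_embedding g &
      forall a, A a -> g a = h a].

Record monster L (K : Type) (U : structure L) : Prop := Monster {
  monster_uncountable : ~ countable [set: K];
  monster_saturated : saturated K U;
  monster_homogeneous : strongly_homogeneous K U }.

Definition small_model L (K : Type) (U : structure L) (M : set U) :=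
  small K M /\ elementary_substructure M.

Section KeislerMeasures.
Context (R : realType) (L : language) (U : structure L).

(* A Keisler measure in the variables [V] is a function on formulas with
   parameters in [U]; for a measure over [A] only the values at L(A)-formulas
   matter, so that restricting a global measure to [A] leaves the function
   unchanged. *)
Definition kfun (V : Type) := formula L (V + U) -> R.

Record keisler V (A : set U) (mu : kfun V) : Prop := Keisler {
  keisler_ge0 : forall f, lang_over A f -> 0 <= mu f;
  keisler_true : mu fTrue = 1;
  keisler_equiv : forall f g, lang_over A f -> lang_over A g ->
    (forall v : V -> U, satp v f <-> satp v g) -> mu f = mu g;
  keisler_additive : forall f g, lang_over A f -> lang_over A g ->
    (forall v : V -> U, ~ (satp v f /\ satp v g)) ->
    mu (fOr f g) = mu f + mu g }.

Definition regular V (A : set U) (m : probability (borel V A) R) :=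
  forall E : set (borel V A), measurable E ->
    m E = ereal_sup [set m C | C in
            [set C : set (stype V A) | closed C /\ C `<=` E]] /\
    m E = ereal_inf [set m O | O in
            [set O : set (stype V A) | open O /\ E `<=` O]].

(* the unique regular Borel probability measure on S_V(A) extending mu|A *)
Definition borel_ext V (A : set U) (mu : kfun V) : probability (borel V A) R :=
  get [set m | regular m /\
               forall f, lang_over A f -> m (clopen_of A f) = (mu f)%:E].

(* phi(x, b) for phi(x, y) *)
Definition plug Vx Vy (b : Vy -> U) (f : formula L ((Vx + Vy) + U)) :
    formula L (Vx + U) :=
  frename (fun s => match s with
                    | inl (inl x) => inl x
                    | inl (inr y) => inr (b y)
                    | inr a => inr a
                    end) f.

Definition lift_params V (f : formula L V) : formula L (V + U) := frename inl f.

Definition vrename V W (s : V -> W) (f : formula L (V + U)) :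
    formula L (W + U) :=
  frename (fun x => match x with inl y => inl (s y) | inr a => inr a end) f.

Definition equiv_over (M : set U) k (a b : 'I_k -> U) :=
  forall f : formula L ('I_k + U), lang_over M f -> satp a f <-> satp b f.

Definition invariant_over V (M : set U) (mu : kfun V) :=
  forall k (f : formula L (V + 'I_k)) (a b : 'I_k -> U), equiv_over M a b ->
    mu (plug a (lift_params f)) = mu (plug b (lift_params f)).

(* F^phi_{mu,A} : q |-> mu(phi(x, b)), the common value for all b |= q in U *)
Definition fiber Vx Vy (mu : kfun Vx) (A : set U)
    (f : formula L ((Vx + Vy) + U)) (q : stype Vy A) : R :=
  xget 0 [set mu (plug b f) | b in [set b | realizes b q]].

Definition borel_definable V (M : set U) (mu : kfun V) :=
  invariant_over M mu /\
  forall k (f : formula L (V + 'I_k)),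
    measurable_fun [set: borel 'I_k M] (fiber mu (A := M) (lift_params f)).

(* The value of the Morley product at phi is the common value of the
   integrals over S_y(N'), for all small models N' containing M and the
   parameters of phi. *)
Definition morley (K : Type) (M : set U) Vx Vy (mu : kfun Vx) (nu : kfun Vy) :
    kfun (Vx + Vy) :=
  fun f => xget 0 [set r | forall N' : set U,
    small_model K N' -> M `<=` N' -> lang_over N' f ->
    r = \int[borel_ext N' nu]_q fiber mu f q].

Section Powers.
Context (K : Type) (M : set U) (mu : kfun unit).

(* x_{n+2} goes to the single variable of [mu]; x_1, ..., x_{n+1} remain *)
Definition split_last n (i : 'I_n.+2) : unit + 'I_n.+1 :=
  if unlift ord_max i is Some j then inr j else inl tt.

(* [mpow n] is mu^(n+1)(x_1, ..., x_{n+1}) *)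
Fixpoint mpow n : kfun 'I_n.+1 :=
  match n return kfun 'I_n.+1 with
  | 0 => fun f => mu (vrename (fun _ => tt) f)
  | n'.+1 => fun f => morley K M mu (@mpow n') (vrename (@split_last n') f)
  end.

(* A parenthesized product of copies of [mu] is a binary tree; its variables
   are numbered from left to right. *)
Inductive paren := Leaf | Node of paren & paren.

Fixpoint psize t := if t is Node t1 t2 then (psize t1 + psize t2)%N else 1%N.

Fixpoint paren_product (t : paren) : kfun 'I_(psize t) :=
  match t return kfun 'I_(psize t) with
  | Leaf => fun f => mu (vrename (fun _ => tt) f)
  | Node t1 t2 => fun f =>
      morley K M (@paren_product t1) (@paren_product t2)
        (vrename (@fintype.split (psize t1) (psize t2)) f)
  end.

Definition paren_independent :=
  forall (t1 t2 : paren) (e : psize t1 = psize t2)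
         (f : formula L ('I_(psize t1) + U)),
    @paren_product t1 f = @paren_product t2 (vrename (cast_ord e) f).

Definition adequate :=
  [/\ borel_definable M mu,
      forall n, borel_definable M (@mpow n) &
      paren_independent].

Definition swap (s : unit + unit) : unit + unit :=
  match s with inl x => inr x | inr y => inl y end.

Definition excellent :=
  adequate /\ forall f, morley K M mu mu f = morley K M mu mu (vrename swap f).

Definition literal n (a : 'I_n -> U) (f : formula L 'I_n) : formula L 'I_n :=
  if `[< sat a f >] then f else fNot f.

Definition diag n (a : 'I_n -> U) : formula L 'I_n :=
  fAnd
    (\big[fAnd/fTrue]_(i < n) \big[fAnd/fTrue]_(j < n) literal a (fEq i j))
    (\big[fAnd/fTrue]_(r : rel_sym L)
       \big[fAnd/fTrue]_(v : {ffun 'I_(arity r) -> 'I_n}) literal a (fRel r v)).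

(* the variables of diag(x_1, ..., x_{n+2}) presented as (x_{n+2}; x_1, ...) *)
Definition diag_last n (a : 'I_n.+2 -> U) :
    formula L ((unit + 'I_n.+1) + U) :=
  vrename (@split_last n) (lift_params (diag a)).

Definition adequate_extension :=
  adequate /\
  forall n (a : 'I_n.+2 -> U),
    0 < morley K M mu (@mpow n) (diag_last a) ->
    borel_ext M (@mpow n)
      (clopen_of M (lift_params (diag (a \o lift ord_max))) `&`
       [set q | fiber mu (fNot (diag_last a)) q = 1]) = 0%E.

Definition excellent_extension := adequate_extension /\ excellent.

Definition is_Pmu (P : probability (borel nat [set: U]) R) :=
  regular P /\
  forall n (f : formula L ('I_n.+1 + U)),
    P (clopen_of setT (vrename (@nat_of_ord n.+1) f)) = (@mpow n f)%:E.

Definition Pmu : probability (borel nat [set: U]) R := get is_Pmu.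

End Powers.
End KeislerMeasures.

Lemma range_nonempty X (a : nat -> X) : range a !=set0.
Proof. by exists (a 0%N), 0%N. Qed.

Definition B_ L (U N : structure L) : set (stype nat [set: U]) :=
  [set p : stype nat [set: U] |
    exists (U' : structure L) (j : U -> U') (a : nat -> U'),
      [/\ elementary_embedding j,
          forall f, p f -> sat (asg a j) f &
          isomorphic (substructure (range_nonempty a)) N]].
Arguments B_ {L} U N.

(* Main.v *)
Require Import Defs.
From HB Require Import structures.
From Stdlib Require List.
From mathcomp Require Import all_boot all_order all_algebra.
From mathcomp Require Import finmap perm fingroup lra.
From mathcomp Require Import all_classical all_reals all_analysis.

Local Open Scope classical_set_scope.
Local Open Scope card_scope.
Local Open Scope ring_scope.

Set Implicit Arguments.
Unset Strict Implicit.
Unset Printing Implicit Defensive.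
Import Order.TTheory GRing.Theory Num.Theory.

(* Excellence makes the powers of [mu] exchangeable.  Hence, for distinct
   indices, the quantifier-free type of [(x_i)] almost surely has positive
   measure.  If [delta(x_1, .., x_n, y)] is positive, let [F] be the
   probability, given [x_1, .., x_n], that a new point does not satisfy [delta].
   The extension axiom says that [F < 1] almost surely on the base of [delta];
   if [s_m] is the measure of the event that the base holds and the next [m]
   points all fail [delta], then [s_(m+1)] is the integral of [F] over that
   event, which forces [s_m] to decrease to [0].  So almost surely
   every positive extension is realized, and two countable structures with
   these two properties are isomorphic by back and forth.  Conversely these
   properties pass to isomorphic structures, so they cut out exactly [B_N]. *)

(** * Small sets *)

(** [morley] is a value common to all small models containing the parameters, so every computation
    needs such a model and independence of its choice. The model is a Skolem hull, small because an
    infinite set is as large as the set of finite words over it. Independence compares regular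
    measures along maps between type spaces; over uncountable parameter sets clopen sets need not
    generate the Borel sets, so agreement on clopen sets is carried over by compactness and
    regularity.

    Commutativity gives directly only the exchange of two factors standing alone; associativity
    carries it into longer products. In the decay argument [F < 1] is not bounded away from 1, so no
    fixed rate is available: the base is cut at [F > 1 - eta], and [eta] tends to 0 at the end.

    Global types need not be realized in [U], hence the ultrapowers. Entries of a realization may
    coincide, so distinct indices must be told apart from distinct elements. *)

Lemma sval_injective (X : Type) (P : X -> Prop) (x y : {x | P x}) :
  sval x = sval y -> x = y.
Proof. by apply: eq_sig_hprop => ?; exact: Prop_irrelevance. Qed.

(** A maximal partial injection is total on one side: a point missed on each side could be added as
    a new pair. It decides below whether a complement fits into [D], and it makes a set without
    infinite sequences countable. *)
Lemma injective_trichotomy (X Y : Type) :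
  (exists f : X -> Y, injective f) \/ (exists f : Y -> X, injective f).
Proof.
pose P (G : set (X * Y)) := forall p q, G p -> G q -> p.1 = q.1 <-> p.2 = q.2.
have [F FP Ftot|G [PG maxG]] := @Zorn_bigcup _ P.
  move=> p q [G1 FG1 G1p] [G2 FG2 G2q].
  by have [s|s] := Ftot _ _ FG1 FG2; [apply: (FP _ FG2)|apply: (FP _ FG1)] => //;
     apply: s.
have [Xt|] := pselect (forall x, exists y, G (x, y)).
  left; have [f Gf] := choice Xt; exists f => x x' /esym e.
  by apply: (PG _ _ (Gf x) (Gf x')).2; rewrite /= e.
move=> /existsNP[x0 nx0].
have [Yt|] := pselect (forall y, exists x, G (x, y)).
  right; have [f Gf] := choice Yt; exists f => y y' /esym e.
  by apply: (PG _ _ (Gf y) (Gf y')).1; rewrite /= e.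
move=> /existsNP[y0 ny0]; exfalso.
apply: (maxG (G `|` [set (x0, y0)])).
  split; first by left.
  by move=> /(_ (x0, y0)) s; apply: nx0; exists y0; apply: s; right.
move=> [x y] [x' y'] [Gp|[-> ->]] [Gq|[-> ->]] //=.
- exact: (PG _ _ Gp Gq).
- split=> e; subst; first by case: nx0; exists y.
  by case: ny0; exists x.
- split=> e; subst; first by case: nx0; exists y'.
  by case: ny0; exists x'.
Qed.

(* Zorn's lemma for graphs of injections [D * D -> D], where [D] contains a fixed
   countable set.  If [D] is maximal, its complement embeds in [D]; otherwise
   [D] could be enlarged by a disjoint copy of itself. *)
Lemma square_injection (X : Type) (i0 : nat -> X) : injective i0 ->
  exists f : X * X -> X, injective f.
Proof.
move=> inj0.
pose dom (G : set (X * X * X)) x := exists z, G (x, x, z).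
pose good G := [/\ forall x y, dom G x -> dom G y -> exists2 z, dom G z & G (x, y, z),
  forall x y z, G (x, y, z) -> [/\ dom G x, dom G y & dom G z] &
  forall p q, G p -> G q -> p.1 = q.1 <-> p.2 = q.2].
pose G0 : set (X * X * X) :=
  [set t | exists m n, t = (i0 m, i0 n, i0 (choice.pickle (m, n)))].
have dom0 n : dom G0 (i0 n) by exists (i0 (choice.pickle (n, n))); exists n, n.
have domG0 x : dom G0 x -> exists n, x = i0 n.
  by move=> [z [m [n [-> _]]]]; exists m.
have goodG0 : good G0.
  split.
  - move=> x y /domG0[m ->] /domG0[n ->].
    by exists (i0 (choice.pickle (m, n))); [exact: dom0|exists m, n].
  - by move=> x y z [m [n [-> -> ->]]].
  - move=> p q [m [n ->]] [m' [n' ->]] /=; split.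
      by move=> [/inj0 -> /inj0 ->].
    by move=> /inj0 /(pcan_inj choice.pickleK)[-> ->].
(* Maximality is taken among unions with [G0], so that the final domain contains all [i0 n]; these
   are an infinite supply of distinct tags. *)
have [F FP Ftot|G [goodG maxG]] := @Zorn_bigcup _ (fun G => good (G0 `|` G)).
  have key p q : (G0 `|` \bigcup_(Z in F) Z) p -> (G0 `|` \bigcup_(Z in F) Z) q ->
      exists Z, [/\ good Z, Z `<=` G0 `|` \bigcup_(Z in F) Z, Z p & Z q].
    have sub G : F G -> G0 `|` G `<=` G0 `|` \bigcup_(Z in F) Z.
      by move=> FG t [?|?]; [left|right; exists G].
    move=> [p0|[G1 F1 Gp]] [q0|[G2 F2 Gq]].
    - by exists G0; split=> // t; left.
    - by exists (G0 `|` G2); split; [exact: FP|exact: sub|left|right].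
    - by exists (G0 `|` G1); split; [exact: FP|exact: sub|right|left].
    - have [s|s] := Ftot _ _ F1 F2.
        by exists (G0 `|` G2); split; [exact: FP|exact: sub|right; exact: s|right].
      by exists (G0 `|` G1); split; [exact: FP|exact: sub|right|right; exact: s].
  have domS (Z Z' : set (X * X * X)) x : Z `<=` Z' -> dom Z x -> dom Z' x.
    by move=> s [z Zz]; exists z; apply: s.
  split.
  - move=> x y [u xu] [v yv]; have [Z [[gZ _ _] sZ Zx Zy]] := key _ _ xu yv.
    have [z dz Gz] := gZ x y (ex_intro _ _ Zx) (ex_intro _ _ Zy).
    by exists z; [exact: domS dz|exact: sZ].
  - move=> x y z h; have [Z [[_ gZ _] sZ Zx _]] := key _ _ h h.
    by have [? ? ?] := gZ _ _ _ Zx; split; apply: domS sZ _.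
  - move=> p q hp hq; have [Z [[_ _ gZ] sZ Zp Zq]] := key _ _ hp hq.
    exact: gZ.
set H := G0 `|` G in goodG.
have [H1 H2 H3] := goodG.
pose D := {x | dom H x}.
have dH n : dom H (i0 n).
  by have [z ?] := dom0 n; exists z; left.
have [g Hg] : exists g : D -> D -> D, forall x y, H (sval x, sval y, sval (g x y)).
  have h (p : D * D) : exists z : D, H (sval p.1, sval p.2, sval z).
    by have [z dz Hz] := H1 _ _ (svalP p.1) (svalP p.2); exists (exist _ z dz).
  by have [g Hg] := choice h; exists (fun x y => g (x, y)) => x y; exact: (Hg (x, y)).
have ginj x y x' y' : g x y = g x' y' -> x = x' /\ y = y'.
  move=> e; have := (H3 _ _ (Hg x y) (Hg x' y')).2; rewrite /= e => /(_ erefl)[].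
  by move=> /sval_injective -> /sval_injective ->.
pose d n : D := exist _ (i0 n) (dH n).
have dinj : injective d by move=> m n [] /inj0.
have [[e einj]|[e einj]] := injective_trichotomy {x | ~ dom H x} D.
  (* The tags [d 0] and [d 1] separate the images of [D] and of its complement, so all of [X] embeds
     in [D], whose square is already coded by [g]. *)
  pose k x : D := match pselect (dom H x) with
    | left h => g (d 0%N) (exist _ x h)
    | right h => g (d 1%N) (e (exist _ x h)) end.
  have kinj : injective k.
    move=> x y; rewrite /k; case: pselect => hx; case: pselect => hy /ginj[].
    - by move=> _ [].
    - by move=> /dinj.
    - by move=> /dinj.
    - by move=> _ /einj [].
  exists (fun p => sval (g (k p.1) (k p.2))) => -[x y] [x' y'] /= h.
  have /ginj[/kinj -> /kinj ->//] : g (k x) (k y) = g (k x') (k y').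
  exact: sval_injective h.
exfalso.
pose e' x : X := sval (e x).
have e'inj : injective e'.
  move=> x y h; apply: einj; exact: sval_injective.
have e'N x : ~ dom H (e' x) := svalP (e x).
pose in1 (b : bool) (x : D) := if b then sval x else e' x.
have in1inj b b' x x' : in1 b x = in1 b' x' -> b = b' /\ x = x'.
  case: b b' => -[] /= h.
  - by split=> //; exact: sval_injective h.
  - by case: (e'N x'); rewrite -h; exact: (svalP x).
  - by case: (e'N x); rewrite h; exact: (svalP x').
  - by split=> //; exact: e'inj.
(* In the square of [D] together with its copy under [e'], three of the four blocks are still
   uncoded; [c] tags the block, and all three are coded inside the copy. *)
pose c (b b' : bool) := d (b + b'.*2)%N.
have cinj b1 b1' b2 b2' : c b1 b1' = c b2 b2' -> b1 = b2 /\ b1' = b2'.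
  by move=> /dinj; case: b1 b1' b2 b2' => -[] [] [].
pose new : set (X * X * X) := [set t | exists b b' x x',
  ~~ (b && b') /\ t = (in1 b x, in1 b' x', e' (g (c b b') (g x x')))].
have domN b x : dom (H `|` new) (in1 b x).
  case: b => /=; first by exists (sval (g x x)); left; exact: Hg.
  by exists (e' (g (c false false) (g x x))); right; exists false, false, x, x.
have domE x : dom (H `|` new) x -> exists b y, x = in1 b y.
  move=> [z [Hz|[b [b' [y [y' [_ [-> _ _]]]]]]]]; last by exists b, y.
  have [dx _ _] := H2 _ _ _ Hz.
  by exists true, (exist _ x dx).
have HnewE : G0 `|` (G `|` new) = H `|` new by rewrite setUA.
apply: (maxG (G `|` new)).
  split; first by left.
  move=> s; have : (G `|` new) (e' (d 0%N), e' (d 0%N),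
      e' (g (c false false) (g (d 0%N) (d 0%N)))).
    by right; exists false, false, (d 0%N), (d 0%N).
  by move=> /s Gn; apply: (e'N (d 0%N)); eexists; right; exact: Gn.
rewrite HnewE; split.
- move=> x y /domE[b [x' ->]] /domE[b' [y' ->]].
  have [/andP[-> ->]|nb] := boolP (b && b').
    exists (in1 true (g x' y')); first exact: domN.
    by left; exact: Hg.
  exists (in1 false (g (c b b') (g x' y'))); first exact: domN.
  by right; exists b, b', x', y'.
- move=> x y z [Hz|[b [b' [x' [y' [_ [-> -> ->]]]]]]].
    by have [[u ?] [v ?] [w ?]] := H2 _ _ _ Hz; split; [exists u|exists v|exists w]; left.
  by split; [exact: domN|exact: domN|exact: (domN false)].
- move=> p q [Hp|[b1 [b1' [x1 [y1 [nb1 ->]]]]]] [Hq|[b2 [b2' [x2 [y2 [nb2 ->]]]]]].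
  + exact: H3.
  + case: p Hp => -[x y] z /H2[dx dy dz] /=; split.
      move=> [hx hy]; exfalso.
      have [h _] := in1inj true b2 (exist _ x dx) x2 hx.
      have [h' _] := in1inj true b2' (exist _ y dy) y2 hy.
      by rewrite -h -h' in nb2.
    by move=> hz; case: (e'N (g (c b2 b2') (g x2 y2))); rewrite -hz.
  + case: q Hq => -[x y] z /H2[dx dy dz] /=; split.
      move=> [hx hy]; exfalso.
      have [h _] := in1inj b1 true x1 (exist _ x dx) hx.
      have [h' _] := in1inj b1' true y1 (exist _ y dy) hy.
      by rewrite h h' in nb1.
    by move=> hz; case: (e'N (g (c b1 b1') (g x1 y1))); rewrite hz.
  + split=> /=.
      by move=> [/in1inj[-> ->] /in1inj[-> ->]].
    by move=> /e'inj /ginj[/cinj[-> ->] /ginj[-> ->]].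
Qed.

(** Iterated pairing is injective only among lists of equal length, so the length is paired in
    through [i0]. *)
Lemma seq_injection (X : Type) (i0 : nat -> X) : injective i0 ->
  exists f : seq X -> X, injective f.
Proof.
move=> inj0; have [g ginj] := square_injection inj0.
pose fix f (s : seq X) := if s is x :: s' then g (x, f s') else i0 0%N.
have finj s : forall t, size s = size t -> f s = f t -> s = t.
  by elim: s => [|x s IH] [|y t] //= [/IH{}IH] /ginj[-> /IH ->].
exists (fun s => g (i0 (size s), f s)) => s t /ginj[/inj0]; exact: finj.
Qed.

Lemma small_sub K (X : Type) (A B : set X) : B `<=` A -> small K A -> small K B.
Proof.
by move=> BA; apply: contra => h; apply: card_le_trans h (subset_card_le BA).
Qed.

(** If [A] is infinite, the finite words over [nat] and [A] embed in [A], so [K] below [B] would put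
    [K] below [A]. If no sequence embeds in [A], then [A] and the set of words are countable,
    against the uncountability of [K]. *)
Lemma small_generated K (X : Type) (A B : set X)
    (f : seq (nat + {x | A x}) -> X) :
  ~ countable [set: K] -> small K A -> B `<=` range f -> small K B.
Proof.
move=> Kunc sA Bf; apply: contra sA => KB.
have [[i0 inj0]|nA] := pselect (exists i : nat -> {x | A x}, injective i).
  have [g ginj] := square_injection inj0.
  pose h (s : nat + {x | A x}) := match s with
    | inl n => g (i0 0%N, i0 n) | inr x => g (i0 1%N, x) end.
  have hinj : injective h.
    by move=> [m|x] [n|y] /ginj[] => [/inj0 ->|/inj0|/inj0|->].
  have [k kinj] := seq_injection inj0.
  apply: card_le_trans KB _.
  apply: card_le_trans (subset_card_le Bf) _.
  apply: card_le_trans (card_image_le _ _) _.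
  have : [set: seq (nat + {x | A x})] #<= range (fun s => sval (k (map h s))).
    have /inj_card_eq/card_esym : {in setT &, injective (fun s => sval (k (map h s)))}.
      move=> s t _ _ e; apply: (inj_map hinj); apply: kinj.
      exact: sval_injective e.
    by rewrite card_eq_le => /andP[].
  move=> /card_le_trans; apply; apply: subset_card_le => _ [s _ <-].
  exact: svalP.
exfalso; apply: Kunc; apply: sub_countable KB _.
apply: sub_countable (subset_card_le Bf) _.
apply: sub_countable (card_image_le _ _) _.
have [c cinj] : exists c : {x | A x} -> nat, injective c.
  by have [//|h] := injective_trichotomy {x | A x} nat.
pose h (s : nat + {x | A x}) := match s with
  | inl n => inl n | inr x => inr (c x) end : nat + nat.
have hinj : injective h.
  by move=> [m|x] [n|y] => //= -[]; [move=> ->|move=> /cinj ->].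
apply/countable_injP; exists (fun s => choice.pickle (map h s)) => s t _ _.
by move=> /(pcan_inj choice.pickleK); exact: inj_map.
Qed.

Lemma smallU_range K (X : Type) (A : set X) (d : nat -> X) :
  ~ countable [set: K] -> small K A -> small K (A `|` range d).
Proof.
move=> Kunc sA.
pose f (t : seq (nat + {x | A x})) := match t with
  | [:: inl n] => d n | [:: inr x] => sval x | _ => d 0%N end.
apply: (small_generated (f := f) Kunc sA) => x [Ax|[n _ <-]].
  by exists [:: inr (exist _ x Ax)].
by exists [:: inl n].
Qed.

(** * Formulas *)

Section Formulas.
Variable L : language.

Lemma frename_comp V W Z (s : V -> W) (t : W -> Z) (f : formula L V) :
  frename t (frename s f) = frename (t \o s) f.
Proof.
elim: f W Z s t => {V} //= [V g IH|V g IHg h IHh|V g IH] W Z s t.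
- by rewrite IH.
- by rewrite IHg IHh.
- by rewrite IH; congr (fEx (frename _ _)); apply/funext => -[].
Qed.

Lemma frename_ext V W (P : V -> Prop) (s t : V -> W) (f : formula L V) :
  free_in P f -> (forall x, P x -> s x = t x) -> frename s f = frename t f.
Proof.
elim: f W P s t => {V} //= [V x y|V r v|V g IH|V g IHg h IHh|V g IH] W P s t.
- by move=> [Px Py] st; rewrite !st.
- by move=> Pv st; congr fRel; apply/funext => k /=; apply: st.
- by move=> Pg st; rewrite (IH _ _ s t Pg st).
- by move=> [Pg Ph] st; rewrite (IHg _ _ s t Pg st) (IHh _ _ s t Ph st).
- by move=> Pg st; rewrite (IH _ _ _ (omap t) Pg) // => -[x /st /= ->|].
Qed.

Lemma free_in_sub V (P Q : V -> Prop) (f : formula L V) :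
  (forall x, P x -> Q x) -> free_in P f -> free_in Q f.
Proof.
elim: f P Q => {V} [V|V x y|V r v|V g IH|V g IHg h IHh|V g IH] P Q PQ /=.
- by [].
- by move=> [/PQ ? /PQ].
- by move=> Pv k; apply: PQ.
- exact: IH.
- by move=> [/(IHg _ _ PQ) ? /(IHh _ _ PQ)].
- by apply: IH => -[x /PQ|].
Qed.

Lemma free_inI V (P Q : V -> Prop) (f : formula L V) :
  free_in P f -> free_in Q f -> free_in (fun x => P x /\ Q x) f.
Proof.
elim: f P Q => {V} [V|V x y|V r v|V g IH|V g IHg h IHh|V g IH] P Q //=.
- by move=> [? ?] [].
- exact: IH.
- by move=> [Pg Ph] [Qg Qh]; split; [exact: IHg|exact: IHh].
- move=> Pg Qg; apply: free_in_sub (IH _ _ Pg Qg) => -[x|] //=.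
Qed.

Lemma free_in_frename V W (s : V -> W) (P : W -> Prop) (f : formula L V) :
  free_in P (frename s f) <-> free_in (P \o s) f.
Proof.
elim: f W s P => {V} //= [V g IHg h IHh|V g IH] W s P.
- by rewrite IHg IHh.
- by rewrite IH; split; apply: free_in_sub => -[].
Qed.

Lemma free_inT V (f : formula L V) : free_in (fun=> True) f.
Proof.
elim: f => {V} //= V g IH; apply: free_in_sub IH; by case.
Qed.

Lemma frename_id V (s : V -> V) (f : formula L V) :
  (forall x, s x = x) -> frename s f = f.
Proof.
elim: f s => {V} //= [V x y|V r v|V g IH|V g IHg h IHh|V g IH] s sE.
- by rewrite !sE.
- by congr fRel; apply/funext => k /=.
- by rewrite IH.
- by rewrite IHg // IHh.
- by rewrite IH // => -[x|] //=; rewrite sE.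
Qed.

(** Membership is [List.In] because types of variables carry no decidable equality. At a quantifier,
    [pmap id] drops the bound variable [None]. *)
Lemma finite_free V (P : V -> Prop) (f : formula L V) : free_in P f ->
  exists2 s : seq V, (forall x, List.In x s -> P x) & free_in (fun x => List.In x s) f.
Proof.
elim: f P => {V} [V|V x y|V r v|V g IH|V g IHg h IHh|V g IH] P /=.
- by exists [::].
- move=> [Px Py]; exists [:: x; y] => /=; last by split; auto.
  by move=> z [<-//|[<-|]].
- move=> Pv; exists [seq v k | k <- enum 'I_(arity r)].
    by move=> x /List.in_map_iff[k [<- _]]; exact: Pv.
  move=> k; apply: List.in_map.
  by elim: (enum _) (mem_enum 'I_(arity r) k) => //= i s IH;
    rewrite inE => /orP[/eqP ->|/IH]; [left|right].
- by move=> /IH.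
- move=> [/IHg[s sP sg] /IHh[t tP th]]; exists (s ++ t).
    by move=> x /List.in_app_iff[/sP|/tP].
  split; [apply: free_in_sub sg|apply: free_in_sub th] => x ?;
    by apply/List.in_app_iff; auto.
- move=> /IH[s sP sg].
  have sE x : List.In x (pmap id s) <-> List.In (Some x) s.
    elim: s {sP sg} => //= -[y|] s IHs /=.
      by split=> [[->|/IHs]|[[->]|/IHs]]; auto.
    by split=> [/IHs|[|/IHs]]; auto.
  exists (pmap id s); first by move=> x /sE /sP.
  by apply: free_in_sub sg => -[x /sE|].
Qed.

(** Invariance and Borel definability speak only of parameter-free formulas evaluated at finite
    tuples; this brings an arbitrary formula to that shape. *)
Lemma extract_parameters V W (w0 : W) (P : W -> Prop) (f : formula L (V + W)) :
  P w0 -> free_in (fun s => if s is inr w then P w else True) f ->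
  exists k (g : formula L (V + 'I_k)) (c : 'I_k -> W), (forall i, P (c i)) /\
    f = frename (fun s => match s with inl v => inl v | inr i => inr (c i) end) g.
Proof.
move=> Pw0 /finite_free[s sP sf].
pose t := pmap (fun x : V + W => if x is inr w then Some w else None) s.
have tE w : List.In (inr w) s -> List.In w t.
  rewrite /t; elim: s {sP sf t} => //= -[v|w'] s IHs /=; first by case.
  by case=> [[->]|/IHs]; [left|right].
have tP w : List.In w t -> P w.
  move=> wt; apply: (sP (inr w)); move: wt; rewrite /t.
  elim: s {sP sf t tE} => //= -[v|w'] s IHs /=; first by move=> /IHs; right.
  by case=> [->|/IHs]; [left|right].
(* One slot more than there are parameters: the last index runs off [t] and returns [w0], so the
   index type is inhabited even without parameters. *)
pose c (i : 'I_(size t).+1) := nth w0 t i.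
have cP i : P (c i).
  rewrite /c; case: i => i _ /=.
  elim: t tP i {tE c} => [|w t IH] tP [|i] //=; first by apply: tP; left.
  by apply: IH => w' ?; apply: tP; right.
have cS w : List.In w t -> exists i, c i = w.
  move=> wt; suff [n nt e] : exists2 n, (n < size t)%N & nth w0 t n = w.
    by exists (inord n); rewrite /c inordK // ltnS ltnW.
  elim: t wt {tE tP c cP} => //= w' t IH [->|/IH[n nt e]]; first by exists 0%N.
  by exists n.+1.
pose r w : 'I_(size t).+1 := if pselect (exists i, c i = w) is left h
                             then projT1 (cid h) else ord0.
have rK w : List.In w t -> c (r w) = w.
  by move=> /cS h; rewrite /r; case: pselect => // h'; case: cid.
exists (size t).+1,
  (frename (fun x => match x with inl v => inl v | inr w => inr (r w) end) f), c.
split=> //; rewrite frename_comp -[LHS](@frename_id _ id) //.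
by apply: frename_ext sf _ => -[//|w] /tE /rK /= ->.
Qed.

Lemma sat_frename (U : structure L) V W (s : V -> W) (e : W -> U) (f : formula L V) :
  sat e (frename s f) <-> sat (e \o s) f.
Proof.
elim: f W s e => {V} //= [V g IH|V g IHg h IHh|V g IH] W s e.
- by rewrite IH.
- by rewrite IHg IHh.
- by split=> -[a]; rewrite ?IH => h; exists a; rewrite ?IH; move: h;
    congr sat; apply/funext => -[].
Qed.

Lemma sat_ext (U : structure L) V (P : V -> Prop) (e e' : V -> U) (f : formula L V) :
  free_in P f -> (forall x, P x -> e x = e' x) -> sat e f <-> sat e' f.
Proof.
elim: f P e e' => {V} //= [V x y|V r v|V g IH|V g IHg h IHh|V g IH] P e e'.
- by move=> [Px Py] ee; rewrite !ee.
- by move=> Pv ee; suff -> : e \o v = e' \o v by []; apply/funext => k /=; exact: ee.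
- by move=> Pg ee; rewrite (IH _ _ _ Pg ee).
- by move=> [Pg Ph] ee; rewrite (IHg _ _ _ Pg ee) (IHh _ _ _ Ph ee).
- move=> Pg ee; split=> -[a h]; exists a; move: h;
    by apply: (IH _ _ _ Pg _).1 => -[x /ee|].
Qed.

Definition fAnds V (s : seq (formula L V)) := foldr fAnd fTrue s.
Definition fOrs V (s : seq (formula L V)) := foldr (@fOr L V) (fNot fTrue) s.

Lemma sat_fOr (U : structure L) V (e : V -> U) (f g : formula L V) :
  sat e (fOr f g) <-> sat e f \/ sat e g.
Proof.
rewrite /=; split=> [/not_andP[/contrapT|/contrapT]|[?|?] [? ?] //]; auto.
Qed.

Lemma sat_fAnds (U : structure L) V (e : V -> U) (s : seq (formula L V)) :
  sat e (fAnds s) <-> forall f, f \in s -> sat e f.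
Proof.
elim: s => [|f s IH] /=; first by split.
rewrite IH; split=> [[ef es] g|h]; first by rewrite inE => /orP[/eqP ->|/es].
by split=> [|g gs]; apply: h; rewrite inE ?eqxx ?gs ?orbT.
Qed.

Lemma sat_fOrs (U : structure L) V (e : V -> U) (s : seq (formula L V)) :
  sat e (fOrs s) <-> exists2 f, f \in s & sat e f.
Proof.
elim: s => [|f s IH]; first by split=> // -[].
rewrite [fOrs _]/= sat_fOr IH; split=> [[ef|[g gs eg]]|[g]].
- by exists f; rewrite ?mem_head.
- by exists g; rewrite // inE gs orbT.
- by rewrite inE => /orP[/eqP ->|gs eg]; [left|right; exists g].
Qed.

Lemma free_in_fAnds V (P : V -> Prop) (s : seq (formula L V)) :
  (forall f, f \in s -> free_in P f) -> free_in P (fAnds s).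
Proof.
elim: s => //= f s IH h; split; first by apply: h; rewrite mem_head.
by apply: IH => g gs; apply: h; rewrite inE gs orbT.
Qed.

Lemma free_in_fOrs V (P : V -> Prop) (s : seq (formula L V)) :
  (forall f, f \in s -> free_in P f) -> free_in P (fOrs s).
Proof.
elim: s => //= f s IH h; split; first by apply: h; rewrite mem_head.
by apply: IH => g gs; apply: h; rewrite inE gs orbT.
Qed.

(** In the manner of de Bruijn, under a quantifier the bound variable gets code 0 and all other
    codes move up by one. *)
Fixpoint fcode V (c : V -> nat) (f : formula L V) : GenTree.tree nat :=
  match f with
  | fTrue => GenTree.Node 0 [::]
  | fEq x y => GenTree.Node 1 [:: GenTree.Leaf (c x); GenTree.Leaf (c y)]
  | fRel r v => GenTree.Node 2
      (GenTree.Leaf (choice.pickle r) :: [seq GenTree.Leaf (c (v k)) | k <- enum 'I_(arity r)])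
  | fNot g => GenTree.Node 3 [:: fcode c g]
  | fAnd g h => GenTree.Node 4 [:: fcode c g; fcode c h]
  | fEx g => GenTree.Node 5 [:: fcode (fun o => if o is Some x then (c x).+1 else 0%N) g]
  end.

Lemma fcode_inj V (c : V -> nat) : injective c -> injective (fcode c).
Proof.
move=> cI f; elim: f c cI => {V} [V|V x y|V r v|V g IH|V g IHg h IHh|V g IH] c cI
  [|x' y'|r' v'|g'|g' h'|g'] //=.
- by move=> [/cI -> /cI ->].
- move=> [/(pcan_inj choice.pickleK) e]; case: r' / e v' => v' /eq_in_map e.
  congr fRel; apply/funext => k; apply: cI.
  by have [] := e k (mem_enum _ _).
- by move=> [/(IH c cI) ->].
- by move=> [/(IHg c cI) -> /(IHh c cI) ->].
- by move=> [/IH -> //]; move=> [x|] [y|] //= [/cI ->].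
Qed.

Lemma formula_decode V (c : V -> nat) : injective c ->
  exists d : nat -> formula L V, forall f, exists n, d n = f.
Proof.
move=> cI.
have /choice[d dP] : forall n, exists y : formula L V,
    (exists f, choice.pickle (fcode c f) = n) -> choice.pickle (fcode c y) = n.
  by move=> n; have [[f e]|h] := pselect (exists f : formula L V, choice.pickle (fcode c f) = n);
    [exists f|exists fTrue].
exists d => f; exists (choice.pickle (fcode c f)).
by apply: (fcode_inj cI); apply: (pcan_inj choice.pickleK); apply: dP; exists f.
Qed.

End Formulas.

(** * Types and compactness *)

Section Types.
Context (L : language) (U : structure L).
Implicit Types (A : set U).

Lemma satp_frename V W (s : W + U -> V + U) (v : V -> U) (f : formula L (W + U)) :
  (forall a, asg v id (s (inr a)) = a) ->
  satp v (frename s f) <-> satp (fun w => asg v id (s (inl w))) f.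
Proof.
move=> sa; rewrite /satp sat_frename.
suff -> : asg v id \o s = asg (fun w => asg v id (s (inl w))) id by [].
by apply/funext => -[w|a] //=; rewrite sa.
Qed.

Definition gsub V W (s : W -> V + U) (x : W + U) : V + U :=
  match x with inl w => s w | inr a => inr a end.

Definition subst V W (s : W -> V + U) (f : formula L (W + U)) : formula L (V + U) :=
  frename (gsub s) f.

Lemma satp_subst V W (s : W -> V + U) (v : V -> U) (f : formula L (W + U)) :
  satp v (subst s f) <-> satp (asg v id \o s) f.
Proof. by rewrite /subst satp_frename. Qed.

Definition okA A V (x : V + U) : Prop := if x is inr a then A a else True.

Lemma lang_over_subst A A' V W (s : W -> V + U) (f : formula L (W + U)) :
  A' `<=` A -> (forall w, okA A (s w)) -> lang_over A' f -> lang_over A (subst s f).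
Proof.
move=> A'A sA f'; apply/free_in_frename; apply: free_in_sub f' => -[w _|a /A'A] //.
by have := sA w; rewrite /okA /=; case: (s w).
Qed.

Lemma lang_over_sub A A' V (f : formula L (V + U)) : A' `<=` A ->
  lang_over A' f -> lang_over A f.
Proof. by move=> A'A; apply: free_in_sub => -[//|a /A'A]. Qed.

Lemma lang_overT V (f : formula L (V + U)) : lang_over [set: U] f.
Proof. by apply: free_in_sub (free_inT f) => -[]. Qed.

Lemma lang_over_lift A V (f : formula L V) : lang_over A (lift_params U f).
Proof. by apply/free_in_frename; apply: free_in_sub (free_inT f). Qed.

Lemma satp_lift V (v : V -> U) (f : formula L V) :
  satp v (lift_params U f) <-> sat v f.
Proof. by rewrite /satp sat_frename. Qed.

(** Otherwise [fNot g] would be in [p], and finite satisfiability would give a point satisfying [s]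
    but not [g]. The Boolean rules for types follow from this. *)
Lemma stype_imp A V (p : stype V A) (s : seq (formula L (V + U))) g :
  (forall f, f \in s -> p f) -> lang_over A g ->
  (forall v, (forall f, f \in s -> satp v f) -> satp v g) -> p g.
Proof.
move=> sp gA sg; have [//|ng] := stype_complete p gA.
have [|v h] := @stype_fsat _ _ _ _ p (fNot g :: s).
  by move=> f; rewrite inE => /orP[/eqP ->|/sp].
have /= := h _ (mem_head _ _); case; apply: sg => f fs; apply: h.
by rewrite inE fs orbT.
Qed.

Lemma stype_imp1 A V (p : stype V A) f g : p f -> lang_over A g ->
  (forall v, satp v f -> satp v g) -> p g.
Proof.
move=> pf gA fg; apply: (@stype_imp _ _ p [:: f]) => //.
  by move=> h; rewrite inE => /eqP ->.
by move=> v h; apply: fg; apply: h; rewrite mem_head.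
Qed.

Lemma stype_true A V (p : stype V A) : p fTrue.
Proof. by apply: (@stype_imp _ _ p [::]). Qed.

Lemma stype_not A V (p : stype V A) f : lang_over A f -> p (fNot f) <-> ~ p f.
Proof.
move=> fA; split=> [pnf pf|npf]; last by have [] := stype_complete p fA.
have [|v h] := @stype_fsat _ _ _ _ p [:: f; fNot f].
  by move=> g; rewrite !inE => /orP[] /eqP ->.
have /= := h (fNot f) _; rewrite !inE eqxx orbT => /(_ erefl); apply.
by apply: h; rewrite mem_head.
Qed.

Lemma stype_and A V (p : stype V A) f g : lang_over A f -> lang_over A g ->
  p (fAnd f g) <-> p f /\ p g.
Proof.
move=> fA gA; split=> [pfg|[pf pg]].
  by split; apply: (stype_imp1 pfg) => // v [].
apply: (@stype_imp _ _ p [:: f; g]) => //.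
  by move=> h; rewrite !inE => /orP[] /eqP ->.
by move=> v h; split; apply: h; rewrite !inE eqxx ?orbT.
Qed.

Lemma stype_or A V (p : stype V A) f g : lang_over A f -> lang_over A g ->
  p (fOr f g) <-> p f \/ p g.
Proof.
move=> fA gA; rewrite /fOr stype_not //= stype_and // !stype_not //.
by split=> [/not_andP[/contrapT|/contrapT]|[?|?] [? ?] //]; auto.
Qed.

Lemma stype_ands A V (p : stype V A) (s : seq (formula L (V + U))) :
  (forall f, f \in s -> lang_over A f) ->
  p (fAnds s) <-> forall f, f \in s -> p f.
Proof.
move=> sA; have asA : lang_over A (fAnds s) by exact: free_in_fAnds.
split=> [ps f fs|ps].
  by apply: (stype_imp1 ps); [exact: sA|move=> v /sat_fAnds; apply].
by apply: (stype_imp ps) => // v h; apply/sat_fAnds.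
Qed.

Lemma stype_ors A V (p : stype V A) (s : seq (formula L (V + U))) :
  (forall f, f \in s -> lang_over A f) ->
  p (fOrs s) <-> exists2 f, f \in s & p f.
Proof.
move=> sA; have asA : lang_over A (fOrs s) by exact: free_in_fOrs.
split=> [ps|[f fs pf]]; last first.
  by apply: (stype_imp1 pf) => // v vf; apply/sat_fOrs; exists f.
apply: contrapT => h; move: ps; apply/stype_not => //.
apply: (@stype_imp _ _ p (map fNot s)) => //.
  move=> _ /mapP[f fs ->]; apply/stype_not; first exact: sA.
  by move=> pf; apply: h; exists f.
move=> v vs /= /sat_fOrs[f fs vf].
exact: (vs (fNot f) (map_f _ fs)).
Qed.

Lemma stype_ext A V (p q : stype V A) :
  (forall f, lang_over A f -> p f -> q f) -> p = q.
Proof.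
move=> pq; have e : stype_set p = stype_set q.
  apply/funext => f; apply/propext; split=> [pf|qf].
    by apply: pq => //; exact: stype_over pf.
  have fA := stype_over qf.
  have [//|] := stype_complete p fA; move=> /(pq (fNot f) fA).
  by move=> /(stype_not _ fA).
case: p q e {pq} => [p p1 p2 p3] [q q1 q2 q3] /= e.
by subst q; congr SType; exact: Prop_irrelevance.
Qed.

(** The sets of assignments satisfying finite parts of [Ph] generate a proper filter on [V -> U];
    along an ultrafilter containing it, the formulas true on a large set form a complete type. The
    type need not be realized in [U]. *)
Lemma stype_compact A V (Ph : set (formula L (V + U))) :
  (forall f, Ph f -> lang_over A f) ->
  (forall s : seq (formula L (V + U)), (forall f, f \in s -> Ph f) ->
    exists v : V -> U, forall f, f \in s -> satp v f) ->
  exists p : stype V A, forall f, Ph f -> p f.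
Proof.
move=> PhA Phs.
pose F : set_system (V -> U) := [set E | exists2 s : seq (formula L (V + U)),
  (forall f, f \in s -> Ph f) & [set v | forall f, f \in s -> satp v f] `<=` E].
have FF : ProperFilter F.
  apply: Build_ProperFilter_ex.
    by move=> E [s /Phs[v vs] sE]; exists v; apply: sE.
  split.
  - by exists [::].
  - move=> E E' [s sP sE] [t tP tE]; exists (s ++ t).
      by move=> f; rewrite mem_cat => /orP[/sP|/tP].
    move=> v h; split; [apply: sE|apply: tE] => f ft; apply: h;
      by rewrite mem_cat ft ?orbT.
  - by move=> E E' EE' [s sP sE]; exists s => //; apply: subset_trans EE'.
have [G [GU FG]] := ultraFilterLemma FF.
pose p := [set f : formula L (V + U) | lang_over A f /\ G [set v | satp v f]].
have pO f : p f -> lang_over A f by case.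
have pS (s : seq (formula L (V + U))) : (forall f, f \in s -> p f) ->
    exists v : V -> U, forall f, f \in s -> satp v f.
  move=> sp; suff /filter_ex[v vs] : G [set v | forall f, f \in s -> satp v f].
    by exists v.
  elim: s sp => [|f s IH] sp; first by apply: filterS filterT.
  have [_ Gf] := sp f (mem_head _ _).
  have Gs : G [set v | forall f, f \in s -> satp v f].
    by apply: IH => g gs; apply: sp; rewrite inE gs orbT.
  apply: filterS (filterI Gf Gs) => v [vf vs] g.
  by rewrite inE => /orP[/eqP ->|/vs].
have pC f : lang_over A f -> p f \/ p (fNot f).
  move=> fA; have [h|h] := in_ultra_setVsetC [set v | satp v f] GU; first by left.
  by right.
exists (SType pO pS pC) => f Pf; split; first exact: PhA.
apply: FG; exists [:: f] => [g|v h]; first by rewrite inE => /eqP ->.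
by apply: h; rewrite mem_head.
Qed.

(* Compactness of the Stone space, with a closed set given by [Ph] and an open
   cover of it given by [Ps]. *)
Lemma stype_finite_cover A V (Ph Ps : set (formula L (V + U))) :
  (forall f, Ph f -> lang_over A f) -> (forall f, Ps f -> lang_over A f) ->
  (forall p : stype V A, (forall f, Ph f -> p f) -> exists2 g, Ps g & p g) ->
  exists s t : seq (formula L (V + U)), [/\ forall f, f \in s -> Ph f,
    forall f, f \in t -> Ps f &
    forall v, (forall f, f \in s -> satp v f) -> exists2 g, g \in t & satp v g].
Proof.
move=> PhA PsA cov; apply: contrapT => ncov.
have [||p hp] := @stype_compact A V (Ph `|` [set fNot g | g in Ps]).
- by move=> f [/PhA//|[g /PsA gA <-]].
- move=> s sP; apply: contrapT => ns; apply: ncov.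
  (* The unsatisfiable list [s] mixes formulas of [Ph] with negations of formulas of [Ps]; the
     second list strips these negations. *)
  exists [seq f <- s | `[< Ph f >]], [seq g : formula L (V + U) <- [seq (if f is fNot g then g else f) | f <- s] | `[< Ps g >]].
  split=> [f|f|v vs].
  + by rewrite mem_filter => /andP[/asboolP].
  + by rewrite mem_filter => /andP[/asboolP].
  + apply: contrapT => nt; apply: ns; exists v => f fs.
    have [Pf|[g Pg e]] := sP _ fs.
      by apply: vs; rewrite mem_filter fs andbT; apply/asboolP.
    rewrite -e => /= vg; apply: nt; exists g => //.
    rewrite mem_filter; apply/andP; split; first exact/asboolP.
    by apply/mapP; exists f => //; rewrite -e.
have [f Pf|g Pg pg] := cov p; first by apply: hp; left.
by have /(stype_not _ (PsA _ Pg)) : p (fNot g) by apply: hp; right; exists g.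
Qed.

Lemma clopen_open A V (f : formula L (V + U)) : lang_over A f ->
  open (clopen_of (V := V) A f).
Proof.
move=> fA; exists [set clopen_of A f]; last by rewrite bigcup_set1.
move=> _ ->; exists [fset f]%fset; first by move=> g /fset1P ->; apply/mem_set.
by rewrite set_fset1 bigcap_set1.
Qed.

Lemma open_basis A V (O : set (stype V A)) p : open O -> O p ->
  exists f, [/\ lang_over A f, p f & clopen_of A f `<=` O].
Proof.
move=> [D DA <-] [B DB Bp]; have [X XA XE] := DA _ DB.
exists (fAnds (enum_fset X)).
have XA' f : f \in enum_fset X -> lang_over A f by move=> /XA; rewrite inE.
split; first exact: free_in_fAnds.
  by apply/stype_ands => // f fX; move: Bp; rewrite -XE => /(_ f); exact.
move=> q /= /(stype_ands _ XA') qX; exists B => //; rewrite -XE => f fX.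
exact: qX.
Qed.

Lemma clopen_compl A V (f : formula L (V + U)) : lang_over A f ->
  ~` clopen_of (V := V) A f = clopen_of A (fNot f).
Proof. by move=> fA; apply/seteqP; split=> p; rewrite /clopen_of /= stype_not. Qed.

Lemma clopen_closed A V (f : formula L (V + U)) : lang_over A f ->
  closed (clopen_of (V := V) A f).
Proof. by move=> fA; rewrite -openC clopen_compl //; exact: clopen_open. Qed.

End Types.

(** * Maps between type spaces induced by substitution of variables *)

Section Pull.
Context (L : language) (U : structure L) (V W : Type) (A A' : set U).
Variables (s : W -> V + U) (A'A : A' `<=` A) (sA : forall w, okA A (s w)).

Section Def.
Variable p : stype V A.
Let q := [set f : formula L (W + U) | lang_over A' f /\ p (subst s f)].
Let q_over f : q f -> lang_over A' f. Proof. by case. Qed.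
Let q_fsat (t : seq (formula L (W + U))) : (forall f, f \in t -> q f) ->
  exists v : W -> U, forall f, f \in t -> satp v f.
Proof.
move=> tq; have [|v h] := @stype_fsat _ _ _ _ p (map (subst s) t).
  by move=> _ /mapP[f /tq[_ ?] ->].
by exists (asg v id \o s) => f ft; apply/satp_subst; apply: h; apply: map_f.
Qed.
Let q_complete f : lang_over A' f -> q f \/ q (fNot f).
Proof.
move=> fA'; have [|h|h] := @stype_complete _ _ _ _ p (subst s f).
- exact: lang_over_subst fA'.
- by left.
- by right.
Qed.
(** One map covers three uses: restriction to fewer parameters, projection to some of the variables,
    and passage from the type of [b] to the type over [A'] of a tuple mixing entries of [b] with
    parameters from [A]. *)
Definition tpull : stype W A' := SType q_over q_fsat q_complete.
End Def.

Lemma tpullE p f : lang_over A' f -> tpull p f <-> p (subst s f).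
Proof. by move=> fA; split=> [[]|]. Qed.

Lemma tpull_preimage (f : formula L (W + U)) : lang_over A' f ->
  tpull @^-1` clopen_of A' f = clopen_of A (subst s f).
Proof. by move=> fA; apply/seteqP; split=> p /(tpullE p fA). Qed.

Lemma tpull_realizes p b : realizes b p -> realizes (asg b id \o s) (tpull p).
Proof. by move=> bp f [fA /bp]; rewrite satp_subst. Qed.

Lemma tpull_open (O : set (stype W A')) : open O -> open (tpull @^-1` O).
Proof.
move=> oO; rewrite openE => p Op.
have [f [fA pf fO]] := open_basis oO Op.
have fA2 : lang_over A (subst s f) by exact: lang_over_subst fA.
apply: (@filterS _ _ _ (clopen_of A (subst s f))).
  by rewrite -tpull_preimage // => q; exact: fO.
by apply: open_nbhs_nbhs; split; [exact: clopen_open|exact/tpullE].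
Qed.

End Pull.

(** * Realizing types over small sets, and small elementary hulls *)

Section Realization.
Context (L : language) (U : structure L) (K : Type).
Hypotheses (Kunc : ~ countable [set: K]) (Usat : saturated K U).

Lemma sub_seq_image (T T' : eqType) (g : T -> T') (P : T -> Prop) (s : seq T') :
  (forall y, y \in s -> exists2 x, P x & g x = y) ->
  exists2 t, (forall x, x \in t -> P x) & s = map g t.
Proof.
elim: s => [|y s IH] h; first by exists [::].
have [x Px <-] := h y (mem_head _ _).
have [|t tP ->] := IH; first by move=> z zs; apply: h; rewrite inE zs orbT.
by exists (x :: t) => // z; rewrite inE => /orP[/eqP ->|/tP].
Qed.

(** Saturation is given for one variable. The first [n] coordinates are realized by induction, and
    the last one over [A] enlarged by them, which is still small. *)
Lemma realize_tuple n (A : set U) (q : stype 'I_n A) : small K A ->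
  exists b : 'I_n -> U, realizes b q.
Proof.
elim: n A q => [|n IH] A q sA.
  have [x0 _] := structure_ex U.
  exists (fun=> x0) => f qf; have [|v h] := @stype_fsat _ _ _ _ q [:: f].
    by move=> g; rewrite inE => /eqP ->.
  by have := h f (mem_head _ _); congr satp; apply/funext => -[].
pose w (i : 'I_n) : 'I_n.+1 + U := inl (lift ord_max i).
have wA i : okA A (w i) by [].
have [b bq] := IH A (tpull (@subset_refl _ A) wA q) sA.
have [x0 _] := structure_ex U.
pose d m := if insub m is Some i then b i else x0.
pose A' := A `|` range d.
have sA' : small K A' by exact: smallU_range.
have bA' j : A' (b j) by right; exists j => //; rewrite /d valK.
pose pl (i : 'I_n.+1) : unit + U :=
  if unlift ord_max i is Some j then inr (b j) else inl tt.
have plA i : okA A' (pl i) by rewrite /pl; case: unlift.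
have [|s sP|p hp] := @stype_compact _ _ A' unit [set subst pl f | f in q].
- move=> _ [f qf <-]; apply: lang_over_subst (stype_over qf) => //.
  by move=> a; left.
- have [t tq ->] := @sub_seq_image _ _ (subst pl) q s sP.
  have tA f : f \in t -> lang_over A f by move=> /tq /stype_over.
  (* The last variable becomes [None], the one bound by [fEx]: that some last coordinate satisfies
     all of [t] belongs to the restriction of [q], hence holds of [b]. *)
  pose r (x : 'I_n.+1 + U) : option ('I_n + U) := match x with
    | inl i => omap inl (unlift ord_max i) | inr a => Some (inr a) end.
  have qt : q (fAnds t) by apply/stype_ands.
  have exA : lang_over A (fEx (frename r (fAnds t))).
    apply/free_in_frename; apply: free_in_sub (stype_over qt).
    by case=> [i _|a] //=; case: unlift.
  have : satp b (fEx (frename r (fAnds t))).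
    apply: bq; split=> //; apply: (stype_imp1 qt).
      by apply: lang_over_subst exA.
    move=> v vt; apply/satp_subst => /=; exists (v ord_max).
    rewrite sat_frename; move: vt; congr sat; apply/funext => -[i|a] //=.
    by case: unliftP => [j ->|->].
  move=> [x /sat_frename h].
  exists (fun=> x) => _ /mapP[f ft ->]; apply/satp_subst.
  have /sat_fAnds/(_ f ft) : satp (asg (fun=> x) id \o pl) (fAnds t).
    move: h; congr sat; apply/funext => -[i|a] //=.
    by rewrite /pl; case: unlift.
  by [].
have [x xp] := Usat sA' p.
exists (asg x id \o pl) => f qf; apply/satp_subst; apply: xp; apply: hp.
by exists f.
Qed.

(* The elements of the hull are the values of Skolem terms, coded as trees. *)
Lemma small_elementary_extension (A : set U) (d : nat -> U) : small K A ->
  exists N, [/\ small_model K N, A `<=` N & range d `<=` N].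
Proof.
move=> sA; pose B := A `|` range d.
have sB : small K B by exact: smallU_range.
have [x0 _] := structure_ex U.
have cI : injective (@choice.pickle (option nat)) by exact: pcan_inj choice.pickleK.
(* Formulas in countably many variables are countable, so a node label [n] stands for the Skolem
   function of [dec n]: [None] is its value, the numbered variables are its arguments. *)
have [dec decS] := formula_decode L cI.
pose ev (e : nat -> U) (a : U) (o : option nat) := if o is Some x then e x else a.
have [wit witP] : exists wit : formula L (option nat) * (nat -> U) -> U,
    forall fe a, sat (ev fe.2 a) fe.1 -> sat (ev fe.2 (wit fe)) fe.1.
  have /choice[wit h] : forall fe : formula L (option nat) * (nat -> U),
      exists w, forall a, sat (ev fe.2 a) fe.1 -> sat (ev fe.2 w) fe.1.
    move=> fe; have [[a ha]|h] := pselect (exists a, sat (ev fe.2 a) fe.1).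
      by exists a.
    by exists x0 => a ha; case: h; exists a.
  by exists wit.
pose T := GenTree.tree {x | B x}.
pose fix val (t : T) : U := match t with
  | GenTree.Leaf x => sval x
  | GenTree.Node n ts => wit (dec n, fun i => nth x0 (map val ts) i) end.
pose N := range val.
have BN : B `<=` N by move=> x Bx; exists (GenTree.Leaf (exist _ x Bx)).
have sN : small K N.
  (* [GenTree.encode] turns a tree with leaves in [B] into a word over [nat] and [B], the shape that
     [small_generated] takes. *)
  apply: (small_generated (f := fun t => if GenTree.decode t is Some t then val t else x0) Kunc sB).
  by move=> _ [t _ <-]; exists (GenTree.encode t); rewrite // GenTree.codeK.
exists N; split; [split=> //|by move=> x Ax; apply: BN; left|by move=> x Ax; apply: BN; right].
have N0 : N !=set0 by exists (d 0%N); apply: BN; right; exists 0%N.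
exists N0 => V v f; elim: f v => {V} [V|V x y|V r v0|V g IH|V g IHg h IHh|V g IH] v /=.
- by [].
- by split=> [->//|]; exact: sval_injective.
- by [].
- by rewrite IH.
- by rewrite IHg IHh.
- split=> [[a /IH h]|[a h]].
    by exists (sval a); move: h; congr sat; apply/funext => -[].
  (* Tarski-Vaught test: only here is a witness inside [N] required. The free variables of [g] are
     renamed to positions in [vs], and the subtrees of the new node denote their values. *)
  have [s _ sg] := finite_free (free_inT g).
  pose vs := pmap id s.
  have vsP x : List.In (Some x) s -> exists i : nat, onth vs i = Some x.
    rewrite /vs; elim: s {sg vs} => //= -[y|] s IHs /=.
      by case=> [[<-]|/IHs[i]]; [exists 0%N|exists i.+1].
    by case=> // /IHs.
  have /choice[idx idxP] : forall x : V, exists i : nat, List.In (Some x) s -> onth vs i = Some x.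
    move=> x; have [/vsP[i h']|h'] := pselect (List.In (Some x) s); first by exists i.
    by exists 0%N.
  have /choice[tr trP] : forall x : {x | N x}, exists t : T, val t = sval x.
    by move=> x; have [t _ tx] := svalP x; exists t.
  pose g' := frename (omap idx) g.
  have [n nE] := decS g'.
  pose ts := [seq tr (v x) | x <- vs].
  pose a' := val (GenTree.Node n ts).
  have Na' : N a' by exists (GenTree.Node n ts).
  exists (exist _ a' Na'); apply/IH.
  pose e i := nth x0 (map val ts) i.
  have eE x : List.In (Some x) s -> e (idx x) = sval (v x).
    move=> /idxP; rewrite /e /ts -map_comp.
    elim: (vs) (idx x) => [|y l IHl] [|i] //=; first by move=> [->]; exact: trP.
    exact: IHl.
  have hE c : sat (ev e c) g' <->
      sat (fun o => if o is Some x then sval (v x) else c) g.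
    rewrite sat_frename; apply: (sat_ext sg) => -[x /= /eE //|//].
  have /hE h1 : sat (fun o => if o is Some x then sval (v x) else a) g by [].
  have := witP (g', e) a h1; rewrite /= -/ev => /hE; rewrite -nE.
  by congr sat; apply/funext => -[x|].
Qed.

Lemma finite_parameters V (f : formula L (V + U)) :
  exists d : nat -> U, lang_over (range d) f.
Proof.
have [s _ sf] := finite_free (free_inT f).
have [x0 _] := structure_ex U.
exists (fun i => nth x0 [seq (if x is inr a then a else x0) | x <- s] i).
apply: free_in_sub sf => -[//|a].
elim: s => //= y s IH [->|/IH[i _ <-]]; first by exists 0%N.
by exists i.+1.
Qed.

Lemma small_model_over V (A : set U) (f : formula L (V + U)) : small K A ->
  exists N, [/\ small_model K N, A `<=` N & lang_over N f].
Proof.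
have [d df] := finite_parameters f.
move=> /(small_elementary_extension d)[N [sN AN dN]].
by exists N; split=> //; exact: lang_over_sub df.
Qed.

End Realization.

(** * Regular Borel extensions of Keisler measures *)

Section KeislerLemmas.
Context (R : realType) (L : language) (U : structure L) (V : Type) (A : set U).
Context (nu : kfun R U V).
Hypothesis nuK : keisler A nu.

Lemma keisler_false : nu (fNot fTrue) = 0.
Proof.
have := @keisler_additive _ _ _ _ _ _ nuK fTrue (fNot fTrue) I I.
rewrite (keisler_equiv nuK (g := fTrue)) //; last by move=> v; rewrite /satp sat_fOr; split; [|left].
by move=> h; have {h} : nu fTrue = nu fTrue + nu (fNot fTrue) by [apply: h => v [_]; apply]; lra.
Qed.

Lemma keisler_le f g : lang_over A f -> lang_over A g ->
  (forall v, satp v f -> satp v g) -> nu f <= nu g.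
Proof.
move=> fA gA fg; have fgA : lang_over A (fAnd g (fNot f)) by [].
rewrite (keisler_equiv nuK gA (g := fOr f (fAnd g (fNot f)))) //; last first.
  move=> v; rewrite /satp sat_fOr /=; split; last by case=> [/fg|[]].
  by move=> vg; have [?|?] := pselect (sat (asg v id) f); [left|right].
rewrite (keisler_additive nuK) //; last by move=> v [? [_]]; apply.
by rewrite lerDl (keisler_ge0 nuK).
Qed.

Lemma keisler_le1 f : lang_over A f -> nu f <= 1.
Proof. by move=> fA; rewrite -(keisler_true nuK); apply: keisler_le. Qed.

Lemma keisler_or_le f g : lang_over A f -> lang_over A g ->
  nu (fOr f g) <= nu f + nu g.
Proof.
move=> fA gA; have gfA : lang_over A (fAnd g (fNot f)) by [].
rewrite (keisler_equiv nuK (g := fOr f (fAnd g (fNot f)))) //; last first.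
  move=> v; rewrite /satp !sat_fOr /=; split; last by case=> [?|[? _]]; [left|right].
  case=> [|vg]; first by left.
  by have [?|?] := pselect (sat (asg v id) f); [left|right].
rewrite (keisler_additive nuK) //; last by move=> v [? [_]]; apply.
by rewrite lerD2l; apply: keisler_le => // v [].
Qed.

Lemma keisler_ors_le (s : seq (formula L (V + U))) :
  (forall f, f \in s -> lang_over A f) ->
  nu (fOrs s) <= \sum_(f <- s) nu f.
Proof.
elim: s => [|f s IH] sA; first by rewrite big_nil keisler_false.
have sA' g : g \in s -> lang_over A g by move=> gs; apply: sA; rewrite inE gs orbT.
rewrite big_cons; apply: le_trans (keisler_or_le _ _) _.
- by apply: sA; rewrite mem_head.
- exact: free_in_fOrs.
- by rewrite lerD2l IH.
Qed.

End KeislerLemmas.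

(** * Construction of the regular extension from an outer measure *)

Section StoneMeasure.
Context (R : realType) (L : language) (U : structure L) (V : Type) (A : set U).
Context (nu : kfun R U V).
Local Open Scope ereal_scope.

Definition content_open (O : set (stype V A)) : \bar R :=
  ereal_sup [set (nu f)%:E | f in [set f | lang_over A f /\ clopen_of A f `<=` O]].

(* Covers by single open sets: [A] may be uncountable, so countable covers by
   clopen sets would only measure the Baire sets. *)
Definition stone_outer (nuK : keisler A nu) (X : set (stype V A)) : \bar R :=
  ereal_inf [set content_open O | O in [set O | open O /\ X `<=` O]].

Hypothesis nuK : keisler A nu.

Lemma clopen_le f g : lang_over A f -> lang_over A g ->
  clopen_of A f `<=` clopen_of A g -> (nu f <= nu g)%R.
Proof.
move=> fA gA fg; apply: (keisler_le nuK) => // v vf.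
by have [] := fg (tp A v) (conj fA vf).
Qed.

Lemma clopen_content f : lang_over A f -> content_open (clopen_of A f) = (nu f)%:E.
Proof.
move=> fA; apply/eqP; rewrite eq_le; apply/andP; split.
  by apply: ge_ereal_sup => _ [g [gA gf] <-]; rewrite lee_fin; exact: clopen_le.
by apply: ereal_sup_ubound; exists f => //; split.
Qed.

Lemma le_content O O' : O `<=` O' -> content_open O <= content_open O'.
Proof.
move=> OO'; apply: ereal_sup_le => _ [f [fA fO] <-]; exists f => //; split=> //.
exact: subset_trans OO'.
Qed.

Lemma content_ge0 O : 0 <= content_open O.
Proof.
apply: ereal_sup_ubound; exists (fNot fTrue); last by rewrite (keisler_false nuK).
by split=> // p; rewrite /clopen_of /= stype_not // => /(_ (stype_true p)).
Qed.

Lemma content_le1 O : content_open O <= 1.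
Proof.
by apply: ge_ereal_sup => _ [f [fA _] <-]; rewrite lee_fin (keisler_le1 nuK).
Qed.

(** A clopen set inside the union is compact, hence covered by finitely many clopen sets, each
    inside a single [O n]. Grouping them by [n] reduces the claim to finite subadditivity of
    [nu]. *)
Lemma content_bigcup (O : (set (stype V A))^nat) : (forall n, open (O n)) ->
  content_open (\bigcup_n O n) <= \sum_(n <oo) content_open (O n).
Proof.
move=> oO; apply: ge_ereal_sup => _ [f [fA fO] <-].
pose Ps := [set g | lang_over A g /\ exists n, clopen_of A g `<=` O n].
have [||p pf|s [t [sf tP cov]]] := @stype_finite_cover _ U A V [set f] Ps.
- by move=> _ ->.
- by move=> g [].
- have [n _ Onp] := fO p (pf f erefl).
  have [g [gA pg gO]] := open_basis (oO n) Onp.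
  by exists g => //; split=> //; exists n.
have [N NP] : exists N, forall g, g \in t -> exists2 n, (n < N)%N & clopen_of A g `<=` O n.
  elim: t tP {cov} => [|g t IH] tP; first by exists 0%N.
  have [_ [n gn]] := tP g (mem_head _ _).
  have [|N NP] := IH; first by move=> h ht; apply: tP; rewrite inE ht orbT.
  exists (maxn n.+1 N) => h; rewrite inE => /orP[/eqP ->|/NP[m mN hm]].
    by exists n; rewrite // leq_max leqnn.
  by exists m; rewrite // leq_max mN orbT.
pose h n := fOrs [seq g <- t | `[< clopen_of A g `<=` O n >]].
have tA n g : g \in [seq g <- t | `[< clopen_of A g `<=` O n >]] -> lang_over A g.
  by rewrite mem_filter => /andP[_ /tP[]].
have hA n : lang_over A (h n) by apply: free_in_fOrs => g /tA.
have hO n : clopen_of A (h n) `<=` O n.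
  move=> p /= /(stype_ors _ (@tA n))[g]; rewrite mem_filter => /andP[/asboolP gO _].
  exact: gO.
apply: (@le_trans _ _ (\sum_(0 <= n < N) content_open (O n))); last first.
  by apply: nneseries_lim_ge => n _ _; exact: content_ge0.
apply: (@le_trans _ _ (\sum_(0 <= n < N) (nu (h n))%:E)); last first.
  by apply: lee_sum => n _; apply: ereal_sup_ubound; exists (h n).
rewrite sumEFin lee_fin.
have mA g : g \in map h (index_iota 0 N) -> lang_over A g.
  by move=> /mapP[n _ ->].
have := keisler_ors_le nuK mA; rewrite big_map; apply: le_trans.
apply: (keisler_le nuK) => //; first exact: free_in_fOrs.
move=> v vf; apply/sat_fOrs.
have [|g gt vg] := cov v; first by move=> g /sf ->.
have [n nN gO] := NP g gt.
exists (h n); first by rewrite map_f // mem_index_iota.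
apply/sat_fOrs; exists g => //.
by rewrite mem_filter gt andbT; apply/asboolP.
Qed.

Lemma outer_open O : open O -> stone_outer nuK O = content_open O.
Proof.
move=> oO; apply/eqP; rewrite eq_le; apply/andP; split.
  by apply: ereal_inf_lbound; exists O => //; split.
by apply: le_ereal_inf_tmp => _ [G [_ OG] <-]; exact: le_content.
Qed.

Lemma outer_le_open X O : open O -> X `<=` O -> stone_outer nuK X <= content_open O.
Proof. by move=> oO XO; apply: ereal_inf_lbound; exists O. Qed.

Lemma outer_ge0 X : 0 <= stone_outer nuK X.
Proof. by apply: le_ereal_inf_tmp => _ [G _ <-]; exact: content_ge0. Qed.

Lemma le_outer : {homo stone_outer nuK : X Y / X `<=` Y >-> X <= Y}.
Proof.
move=> X Y XY; apply: ereal_inf_le_tmp => _ [G [oG YG] <-]; exists G => //.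
by split=> //; exact: subset_trans YG.
Qed.

Lemma outer_fin X : stone_outer nuK X \is a fin_num.
Proof.
rewrite ge0_fin_numE ?outer_ge0 //; apply: le_lt_trans (ltry 1).
by apply: le_trans (content_le1 setT); apply: outer_le_open => //; exact: openT.
Qed.

Lemma outer0 : stone_outer nuK set0 = 0.
Proof.
rewrite outer_open; last exact: open0.
apply/eqP; rewrite eq_le content_ge0 andbT.
apply: ge_ereal_sup => _ [f [fA f0] <-]; rewrite lee_fin -(keisler_false nuK).
by apply: clopen_le => //; apply: subset_trans f0 _.
Qed.

Lemma outer_adherent X (e : R) : (0 < e)%R ->
  exists O, [/\ open O, X `<=` O & content_open O <= stone_outer nuK X + e%:E].
Proof.
move=> e0; have [_ [G [oO XO] <-] /ltW h] := lb_ereal_inf_adherent e0 (outer_fin X).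
by exists G.
Qed.

Lemma outer_sigma_subadditive : measure_extension.sigma_subadditive (stone_outer nuK).
Proof.
move=> X; apply/lee_addgt0Pr => _/posnumP[e].
apply: le_trans (epsilon_trick _ _ _); [|by move=> n; exact: outer_ge0|by []].
have /choice[G GP] : forall n, exists O, [/\ open O, X n `<=` O &
    content_open O <= stone_outer nuK (X n) + (e%:num / (2 ^ n.+1)%:R)%:E].
  by move=> n; exact: outer_adherent.
apply: (@le_trans _ _ (content_open (\bigcup_n G n))).
  apply: outer_le_open; first by apply: bigcup_open => n _; have [] := GP n.
  by apply: subset_bigcup => n _; have [] := GP n.
apply: le_trans (content_bigcup _) _; first by move=> n; have [] := GP n.
by apply: lee_nneseries => [n _ _|n _]; [exact: content_ge0|have [] := GP n].
Qed.

End StoneMeasure.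

HB.instance Definition _ R L (U : structure L) V (A : set U) (nu : kfun R U V)
    (nuK : keisler A nu) :=
  isOuterMeasure.Build R (stype V A) (stone_outer nuK) (outer0 nuK)
    (outer_ge0 nuK) (@le_outer _ _ _ _ _ _ nuK) (outer_sigma_subadditive nuK).

Section StoneProbability.
Context (R : realType) (L : language) (U : structure L) (V : Type) (A : set U).
Context (nu : kfun R U V) (nuK : keisler A nu).
Local Open Scope ereal_scope.

(** For open [G] containing [X], take a clopen [f] inside [G] and [O], then a clopen [g] inside [G]
    minus [f]. They are disjoint parts of [G], so [nu f + nu g] is at most the content of [G];
    suprema over [g] and [f] give the inequality. *)
Lemma open_caratheodory (O : set (stype V A)) : open O ->
  caratheodory_measurable (stone_outer nuK) O.
Proof.
move=> oO; apply: le_caratheodory_measurable => X.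
apply: le_ereal_inf_tmp => _ [G [oG XG] <-].
have fX : stone_outer nuK (X `&` ~` O) \is a fin_num by exact: outer_fin.
rewrite -leeBrDr //.
apply: (@le_trans _ _ (content_open nu (G `&` O))).
  by apply: outer_le_open; [exact: openI|exact: setSI].
apply: ge_ereal_sup => _ [f [fA fGO] <-].
rewrite leeBrDr // -leeBrDl //.
apply: (@le_trans _ _ (content_open nu (G `&` ~` clopen_of A f))).
  apply: outer_le_open.
    apply: openI => //; rewrite openC; exact: clopen_closed.
  by move=> p [/XG Gp nOp]; split=> // /fGO[].
apply: ge_ereal_sup => _ [g [gA gG] <-].
rewrite leeBrDl // -EFinD -(keisler_additive nuK) //; last first.
  by move=> v [vf vg]; have [_] := gG (tp A v) (conj gA vg); apply.
apply: ereal_sup_ubound; exists (fOr f g) => //; split=> // p.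
by rewrite /clopen_of /= stype_or // => -[/fGO[]|/gG[]].
Qed.

Definition stone_measure (nuK : keisler A nu) : set (borel V A) -> \bar R :=
  stone_outer nuK.

Lemma borel_caratheodory (E : set (borel V A)) : measurable E ->
  caratheodory_measurable (stone_outer nuK) E.
Proof.
move=> mE; pose T := caratheodory_type (stone_outer nuK).
have : <<s (@open (stype V A)) >> `<=` @measurable _ T.
  apply: smallest_sub; first exact: sigma_algebra_measurable.
  by move=> O; exact: open_caratheodory.
by apply.
Qed.

Let stone_measure0 : stone_measure nuK set0 = 0.
Proof. exact: outer0. Qed.

Let stone_measure_ge0 E : 0 <= stone_measure nuK E.
Proof. exact: outer_ge0. Qed.

Let stone_measure_sigma_additive : semi_sigma_additive (stone_measure nuK).
Proof.
move=> F mF tF mUF.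
apply: (@caratheodory_measure_sigma_additive R (stype V A) (stone_outer nuK)) => //.
- by move=> n; exact: borel_caratheodory.
- exact: borel_caratheodory.
Qed.

HB.instance Definition _ := isMeasure.Build _ _ _ (stone_measure nuK)
  stone_measure0 stone_measure_ge0 stone_measure_sigma_additive.

Let stone_measureT : stone_measure nuK setT = 1.
Proof.
rewrite /stone_measure outer_open; last exact: openT.
suff -> : [set: stype V A] = clopen_of A fTrue.
  by rewrite clopen_content // (keisler_true nuK).
by apply/seteqP; split=> // p _; exact: stype_true.
Qed.

HB.instance Definition _ :=
  Measure_isProbability.Build _ _ _ (stone_measure nuK) stone_measureT.

Lemma open_measurable_borel (O : set (stype V A)) : open O ->
  measurable (O : set (borel V A)).
Proof. by move=> oO; exact: sub_sigma_algebra. Qed.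

Lemma closed_measurable_borel (C : set (stype V A)) : closed C ->
  measurable (C : set (borel V A)).
Proof.
by rewrite -openC => /open_measurable_borel/measurableC; rewrite setCK.
Qed.

Lemma clopen_measurable f : lang_over A f ->
  measurable (clopen_of A f : set (borel V A)).
Proof. by move=> fA; apply: open_measurable_borel; exact: clopen_open. Qed.

(** Inner approximation of a set is outer approximation of its complement, as the total mass is
    1. *)
Lemma outer_regular_inner (m : probability (borel V A) R) :
  (forall E : set (borel V A), measurable E -> forall e : R, (0 < e)%R ->
    exists O : set (stype V A), [/\ open O, E `<=` O & m O <= m E + e%:E]) ->
  regular m.
Proof.
move=> mO F mF; split; apply/eqP; rewrite eq_le; apply/andP; split.
- apply/lee_addgt0Pr => e e0.
  have [D [oO FO Oe]] := mO _ (measurableC mF) e e0.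
  have mOO := open_measurable_borel oO.
  apply: (@le_trans _ _ (m (~` D) + e%:E)); last first.
    rewrite leeD2r //; apply: ereal_sup_ubound; exists (~` D) => //.
    split; first by rewrite closedC.
    by rewrite -[X in _ `<=` X]setCK; exact: subsetC.
  rewrite probability_setC // addeAC; move: Oe; rewrite probability_setC //.
  rewrite -(fineK (fin_num_measure m _ mOO)) -(fineK (fin_num_measure m _ mF)).
  by rewrite -!EFinB -!EFinD !lee_fin; lra.
- apply: ge_ereal_sup => _ [C [cC CF] <-].
  by apply: le_measure => //; rewrite inE //; exact: closed_measurable_borel.
- apply: le_ereal_inf_tmp => _ [G [oO FO] <-].
  by apply: le_measure => //; rewrite inE //; exact: open_measurable_borel.
- apply/lee_addgt0Pr => e e0; have [D [oO FO Oe]] := mO _ mF e e0.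
  by apply: le_trans Oe; apply: ereal_inf_lbound; exists D.
Qed.

Lemma stone_measure_regular : regular (stone_measure nuK : probability _ R).
Proof.
apply: outer_regular_inner.
move=> E mE e e0; have [G [oO EO h]] := outer_adherent nuK E e0.
by exists G; split=> //; rewrite /= /stone_measure outer_open.
Qed.

Lemma stone_measureE f : lang_over A f ->
  stone_measure nuK (clopen_of A f) = (nu f)%:E.
Proof.
by move=> fA; rewrite /stone_measure outer_open ?clopen_content //; exact: clopen_open.
Qed.

Lemma borel_extP : regular (borel_ext A nu) /\
  forall f, lang_over A f -> borel_ext A nu (clopen_of A f) = (nu f)%:E.
Proof.
rewrite /borel_ext; apply: (@getPex _ [set m : probability (borel V A) R | regular m /\
  forall f, lang_over A f -> m (clopen_of A f) = (nu f)%:E]).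
exists (stone_measure nuK : probability _ R); split; first exact: stone_measure_regular.
exact: stone_measureE.
Qed.

Lemma borel_ext_regular : regular (borel_ext A nu).
Proof. by case: borel_extP. Qed.

Lemma borel_extE f : lang_over A f -> borel_ext A nu (clopen_of A f) = (nu f)%:E.
Proof. by move=> fA; case: borel_extP => _ ->. Qed.

End StoneProbability.

(** * Image measures under maps between type spaces *)

Section Push.
Context (R : realType) (L : language) (U : structure L) (V W : Type) (A A' : set U).
Variables (s : W -> V + U) (A'A : A' `<=` A) (sA : forall w, okA A (s w)).
Local Notation pi := (tpull A'A sA).
Local Open Scope ereal_scope.

Lemma tpull_measurable :
  measurable_fun [set: borel V A] (pi : borel V A -> borel W A').
Proof.
apply: (@measurability _ _ (borel V A) (borel W A') setT pi (@open (stype W A'))) => //.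
move=> _ [G oG <-]; rewrite setTI; apply: open_measurable_borel.
exact: tpull_open.
Qed.

(** The preimage of [C] is the intersection of the pulled-back clopen sets around [C]; by
    compactness finitely many of them already meet inside [G]. The separating formula is over [A'],
    although [G] is an arbitrary open set of types over [A]. *)
Lemma tpull_separation (C : set (stype W A')) (G : set (stype V A)) :
  closed C -> open G -> pi @^-1` C `<=` G ->
  exists f, [/\ lang_over A' f, C `<=` clopen_of A' f &
    pi @^-1` clopen_of A' f `<=` G].
Proof.
move=> cC oG CG.
pose Ph := [set subst s f | f in [set f | lang_over A' f /\ C `<=` clopen_of A' f]].
pose Ps := [set g | lang_over A g /\ clopen_of A g `<=` G].
have PhA f : Ph f -> lang_over A f.
  by move=> [g [gA _] <-]; exact: lang_over_subst gA.
have [||p hp|t [u [tP uP cov]]] := @stype_finite_cover _ U A V Ph Ps.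
- exact: PhA.
- by move=> f [].
- have Cp : C (pi p).
    apply: contrapT => nCp.
    have [f [fA pf fC]] := @open_basis _ _ _ _ (~` C) (pi p) (closed_openC cC) nCp.
    have nfA : lang_over A' (fNot f) by [].
    have : pi p (fNot f).
      apply/tpullE => //; apply: hp; exists (fNot f) => //; split=> // q Cq.
      by rewrite /clopen_of /=; apply/stype_not => // /fC.
    by move=> /(stype_not _ fA).
  have [g [gA pg gG]] := open_basis oG (CG p Cp).
  by exists g.
have [t' t'P tE] := @sub_seq_image _ _ (subst s) _ t tP.
exists (fAnds t').
have tA f : f \in t' -> lang_over A' f by move=> /t'P[].
split; first exact: free_in_fAnds.
  move=> q Cq; apply/stype_ands => // f ft.
  by have [_] := t'P f ft; apply.
move=> p /(stype_ands _ tA) ht.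
have uA f : f \in u -> lang_over A f by move=> /uP[].
have : p (fOrs u).
  apply: (@stype_imp _ _ _ _ p t).
  - by move=> f; rewrite tE => /mapP[g /ht[_ gt] ->].
  - exact: free_in_fOrs.
  - by move=> v /cov[g gu vg]; apply/sat_fOrs; exists g.
by move=> /(stype_ors _ uA)[g /uP[_ gG] /gG].
Qed.

End Push.

Section PushMeasure.
Context (R : realType) (L : language) (U : structure L).
Local Open Scope ereal_scope.

Lemma closed_open_separation V (A : set U) (C G : set (stype V A)) :
  closed C -> open G -> C `<=` G ->
  exists f, [/\ lang_over A f, C `<=` clopen_of A f & clopen_of A f `<=` G].
Proof.
move=> cC oG CG.
have sA (w : V) : okA A (inl w) by [].
have E (p : stype V A) : tpull (@subset_refl _ A) sA p = p.
  by apply: stype_ext => f fA /tpullE-/(_ fA); rewrite /subst frename_id // => -[].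
have [|f [fA Cf fG]] := @tpull_separation _ _ _ _ _ _ _ (@subset_refl _ A) sA C G cC oG.
  by move=> p; rewrite /preimage /= E => /CG.
by exists f; split=> // p; rewrite -{1}(E p) => /fG.
Qed.

Lemma regular_outer V (A : set U) (m : probability (borel V A) R)
    (E : set (borel V A)) (e : R) : regular m -> measurable E -> (0 < e)%R ->
  exists G : set (stype V A), [/\ open G, E `<=` G & m G <= m E + e%:E].
Proof.
move=> rm mE e0; have [_ Einf] := rm E mE.
have fE := fin_num_measure m E mE.
have [|_ [G [oG EG] <-] /ltW h] := lb_ereal_inf_adherent (S := [set m O | O in
  [set O : set (stype V A) | open O /\ E `<=` O]]) e0; first by rewrite -Einf.
by exists G; split=> //; rewrite Einf.
Qed.

Context (V W : Type) (A A' : set U).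
Variables (s : W -> V + U) (A'A : A' `<=` A) (sA : forall w, okA A (s w)).
Local Notation pi := (tpull A'A sA).

(** Agreement spreads in three stages: to closed sets, by a clopen set squeezed between a closed set
    and an open set of nearly equal measure; to open sets, by complements; to Borel sets, by
    uniqueness on a system closed under intersections. *)
Lemma regular_push (m : probability (borel V A) R) (m' : probability (borel W A') R) :
  regular m -> regular m' ->
  (forall f, lang_over A' f -> m (clopen_of A (subst s f)) = m' (clopen_of A' f)) ->
  forall E : set (borel W A'), measurable E -> m (pi @^-1` E) = m' E.
Proof.
move=> rm rm' mm'.
have mpi (E : set (borel W A')) : measurable E -> measurable (pi @^-1` E : set (borel V A)).
  by move=> mE; rewrite -[X in measurable X]setTI; exact: tpull_measurable.
have clopenE f : lang_over A' f -> m (pi @^-1` clopen_of A' f) = m' (clopen_of A' f).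
  by move=> fA; rewrite tpull_preimage // mm'.
have closedE (C : set (stype W A')) : closed C -> m (pi @^-1` C) = m' C.
  move=> cC; have mC := closed_measurable_borel cC.
  apply/eqP; rewrite eq_le; apply/andP; split; apply/lee_addgt0Pr => e e0.
    have [G [oG CG Ge]] := regular_outer rm' mC e0.
    have [f [fA Cf fG]] := closed_open_separation cC oG CG.
    have mf := clopen_measurable fA; have mG := open_measurable_borel oG.
    apply: le_trans Ge; apply: (@le_trans _ _ (m' (clopen_of A' f))).
      rewrite -clopenE //; apply: le_measure; rewrite ?inE; [exact: mpi|exact: mpi|].
      by move=> p; exact: Cf.
    by apply: le_measure; rewrite ?inE.
  have [G [oG CG Ge]] := regular_outer rm (mpi _ mC) e0.
  have [f [fA Cf fG]] := tpull_separation cC oG CG.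
  have mf := clopen_measurable fA; have mG := open_measurable_borel oG.
  apply: le_trans Ge; apply: (@le_trans _ _ (m' (clopen_of A' f))).
    by apply: le_measure; rewrite ?inE.
  by rewrite -clopenE //; apply: le_measure; rewrite ?inE //; exact: mpi.
have openE (G : set (stype W A')) : open G -> m (pi @^-1` G) = m' G.
  move=> oG; have mG := open_measurable_borel oG.
  have cG : closed (~` G) by rewrite closedC.
  have := closedE _ cG; rewrite preimage_setC !probability_setC //; last exact: mpi.
  rewrite -(fineK (fin_num_measure m _ (mpi _ mG))) -(fineK (fin_num_measure m' _ mG)).
  by rewrite -!EFinB => -[h]; congr EFin; lra.
pose m2 : {measure set (borel W A') -> \bar R} :=
  measure_function_pushforward__canonical__measure_function_Measure m (tpull_measurable A'A sA).
move=> E mE.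
apply: (@measure_unique _ _ (borel W A') (@open (stype W A')) (fun=> setT) _ _ _ _ m2 m' _ _ E mE) => //.
- by move=> G H; exact: openI.
- by move=> _; exact: openT.
- by apply/seteqP; split=> // x _; exists 0%N.
- by move=> _; apply: le_lt_trans (ltry 1); apply: probability_le1; exact: mpi.
Qed.

Context (nu : kfun R U V) (nu' : kfun R U W).
Hypotheses (nuK : keisler A nu) (nuK' : keisler A' nu').
Hypothesis nu'E : forall f, lang_over A' f -> nu' f = nu (subst s f).

Lemma borel_ext_push (E : set (borel W A')) : measurable E ->
  borel_ext A nu (pi @^-1` E) = borel_ext A' nu' E.
Proof.
apply: regular_push; [exact: borel_ext_regular|exact: borel_ext_regular|].
move=> f fA; rewrite !borel_extE ?nu'E //; exact: lang_over_subst fA.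
Qed.

Lemma integral_push (h : stype W A' -> R) :
  measurable_fun [set: borel W A'] (h : borel W A' -> R) -> (forall q, (0 <= h q)%R) ->
  (\int[borel_ext A nu]_p h (pi p) = \int[borel_ext A' nu']_q h q)%R.
Proof.
move=> mh h0; rewrite /Rintegral; congr fine.
pose m2 : {measure set (borel W A') -> \bar R} :=
  measure_function_pushforward__canonical__measure_function_Measure
    (borel_ext A nu) (tpull_measurable A'A sA).
transitivity (\int[m2]_q (h q)%:E).
  rewrite ge0_integral_pushforward //.
  - exact: tpull_measurable.
  - exact/measurable_realfun.measurable_EFinP.
  - by move=> q _; rewrite lee_fin.
by apply: eq_measure_integral => E mE _; exact: borel_ext_push.
Qed.

End PushMeasure.

(** * Morley products *)

Section Fiber.
Context (R : realType) (L : language) (U : structure L) (V : Type) (M : set U).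
Context (mu : kfun R U V).
Hypotheses (muK : keisler [set: U] mu) (muB : borel_definable M mu).

(** Normal form of a formula in [x], [y] and parameters: a parameter-free [g] whose slots receive
    through [c] either a [y]-variable or a parameter. The hypotheses on [mu] concern only [g]. *)
Definition instantiate Vy k (c : 'I_k -> Vy + U) (g : formula L (V + 'I_k)) :
    formula L ((V + Vy) + U) :=
  frename (fun s => match s with
    | inl v => inl (inl v)
    | inr i => match c i with inl y => inl (inr y) | inr a => inr a end end) g.

Lemma instantiate_extract Vy (P : set U) (f : formula L ((V + Vy) + U)) :
  P !=set0 -> lang_over P f ->
  exists k (g : formula L (V + 'I_k)) (c : 'I_k -> Vy + U),
    (forall i, okA P (c i)) /\ f = instantiate c g.
Proof.
move=> [a0 Pa0] fP.
pose ra (s : (V + Vy) + U) : V + (Vy + U) := match s with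
  | inl (inl v) => inl v | inl (inr y) => inr (inl y) | inr a => inr (inr a) end.
pose ar (s : V + (Vy + U)) : (V + Vy) + U := match s with
  | inl v => inl (inl v) | inr (inl y) => inl (inr y) | inr (inr a) => inr a end.
have [||k [g [c [cP e]]]] := @extract_parameters L V (Vy + U) (inr a0) (okA P (V := Vy)) (frename ra f).
- by [].
- by apply/free_in_frename; apply: free_in_sub fP => -[[]|].
exists k, g, c; split=> //.
rewrite -[LHS](@frename_id _ _ (ar \o ra)); last by move=> [[]|].
rewrite -frename_comp e frename_comp; congr frename.
by apply/funext => -[v|i] //=; case: (c i).
Qed.

Lemma plug_instantiate Vy k (c : 'I_k -> Vy + U) g (b : Vy -> U) :
  plug b (instantiate c g) = plug (asg b id \o c) (lift_params U g).
Proof.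
rewrite /plug /instantiate /lift_params !frename_comp; congr frename.
by apply/funext => -[v|i] //=; case: (c i).
Qed.

Lemma satp_plug Vy (b : Vy -> U) (f : formula L ((V + Vy) + U)) (v : V -> U) :
  satp v (plug b f) <-> satp (fun s => match s with inl x => v x | inr y => b y end) f.
Proof.
rewrite /satp sat_frename.
rewrite (_ : _ \o _ = asg (fun s : V + Vy => match s with inl x => v x | inr y => b y end) id) //.
by apply/funext => -[[]|].
Qed.

Section Base.
Context (Vy : Type) (A : set U).
Hypotheses (MA : M `<=` A) (M0 : M !=set0).

Lemma realizes_equiv k (c : 'I_k -> Vy + U) (q : stype Vy A) b b' :
  (forall i, okA A (c i)) -> realizes b q -> realizes b' q ->
  equiv_over M (asg b id \o c) (asg b' id \o c).
Proof.
move=> cA bq b'q f fM; rewrite -!satp_subst.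
have fA : lang_over A (subst c f) by exact: lang_over_subst fM.
have [qf|qnf] := stype_complete q fA.
  by have := bq _ qf; have := b'q _ qf.
by have /= := bq _ qnf; have /= := b'q _ qnf.
Qed.

(** [fiber] selects the value at some realization of [q]. Two realizations give, together with the
    parameters in [A], tuples equivalent over [M], and invariance makes the values equal. *)
Lemma fiberE (f : formula L ((V + Vy) + U)) (q : stype Vy A) b :
  lang_over A f -> realizes b q -> fiber mu f q = mu (plug b f).
Proof.
move=> fA bq; rewrite /fiber.
have [b' b'q <-] : [set mu (plug b f) | b in [set b | realizes b q]]
    (xget 0 [set mu (plug b f) | b in [set b | realizes b q]]).
  by apply: xgetPex; exists (mu (plug b f)); exists b.
have A0 : A !=set0 by have [a /MA] := M0; exists a.
have [k [g [c [cA ->]]]] := instantiate_extract A0 fA.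
by rewrite !plug_instantiate; apply: muB.1; exact: realizes_equiv b'q bq.
Qed.

(** A fiber over [A] factors through a continuous map to types over [M], followed by a
    parameter-free fiber. Measurability over [A] and the comparison of different models both rest on
    this. *)
Lemma fiber_instantiate k (c : 'I_k -> Vy + U) (cA : forall i, okA A (c i)) g q b :
  realizes b q ->
  fiber mu (instantiate c g) q = fiber mu (lift_params U g) (tpull MA cA q).
Proof.
move=> bq; rewrite (fiberE _ bq); last first.
  apply/free_in_frename; apply: free_in_sub (free_inT g) => -[//|i _] /=.
  by have := cA i; rewrite /okA; case: (c i).
rewrite plug_instantiate /fiber.
have [b' b'q <-] : [set mu (plug b (lift_params U g)) | b in
    [set b | realizes b (tpull MA cA q)]] (xget 0 [set mu (plug b (lift_params U g)) | b in
    [set b | realizes b (tpull MA cA q)]]).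
  apply: xgetPex; exists (mu (plug (asg b id \o c) (lift_params U g))).
  by exists (asg b id \o c) => //; exact: tpull_realizes.
apply: muB.1 => f fM.
have [pf|pnf] := stype_complete (tpull MA cA q) fM.
  by have := tpull_realizes bq pf; have := b'q _ pf.
by have /= := tpull_realizes bq pnf; have /= := b'q _ pnf.
Qed.

Hypothesis real : forall q : stype Vy A, exists b, realizes b q.

Lemma fiber_bounds (f : formula L ((V + Vy) + U)) (q : stype Vy A) : lang_over A f -> 0 <= fiber mu f q <= 1.
Proof.
move=> fA; have [b bq] := real q; rewrite (fiberE fA bq).
by rewrite (keisler_ge0 muK) ?(keisler_le1 muK) //; exact: lang_overT.
Qed.

Lemma fiber_measurable (f : formula L ((V + Vy) + U)) : lang_over A f ->
  measurable_fun [set: borel Vy A] (fiber mu f : borel Vy A -> R).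
Proof.
move=> fA; have A0 : A !=set0 by have [a /MA] := M0; exists a.
have [k [g [c [cA ->]]]] := instantiate_extract A0 fA.
rewrite (_ : fiber mu _ = (fiber mu (A := M) (lift_params U g)) \o tpull MA cA).
  apply: (@measurableT_comp _ _ _ (borel Vy A) (borel 'I_k M) R
    (fiber mu (A := M) (lift_params U g)) setT (tpull MA cA)).
    exact: muB.2.
  exact: tpull_measurable.
by apply/funext => q; have [b bq] := real q; exact: (fiber_instantiate cA _ bq).
Qed.

Lemma fiber_integrable (m : probability (borel Vy A) R) (f : formula L ((V + Vy) + U)) : lang_over A f ->
  m.-integrable setT (EFin \o (fiber mu f : borel Vy A -> R)).
Proof.
move=> fA; apply: measurable_bounded_integrable => //.
- by apply: le_lt_trans (ltry 1); exact: probability_le1.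
- exact: fiber_measurable.
- exists 1; split=> // x x1 q _ /=; have /andP[f0 f1] := fiber_bounds q fA.
  by rewrite ger0_norm // (le_trans f1) // ltW.
Qed.

End Base.

End Fiber.

Section KeislerTransfer.
Context (R : realType) (L : language) (U : structure L).

Lemma keisler_restrict (W : Type) (la : kfun R U W) A :
  keisler [set: U] la -> keisler A la.
Proof.
move=> [k0 k1 ke ka]; split=> //.
- by move=> f fA; apply: k0; exact: lang_overT.
- by move=> f g fA gA; apply: ke; exact: lang_overT.
- by move=> f g fA gA; apply: ka; exact: lang_overT.
Qed.

Lemma keisler_subst (W W' : Type) (la : kfun R U W) (s : W' -> W + U) :
  keisler [set: U] la -> keisler [set: U] (fun f => la (subst s f)).
Proof.
move=> laK; split=> [f _|||f g _ _ fg].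
- by apply: (keisler_ge0 laK); exact: lang_overT.
- exact: keisler_true laK.
- move=> f g _ _ fg; apply: (keisler_equiv laK); [exact: lang_overT|exact: lang_overT|].
  by move=> v; rewrite !satp_subst.
- rewrite -(keisler_additive laK) //; [exact: lang_overT|exact: lang_overT|].
  by move=> v; rewrite !satp_subst.
Qed.

End KeislerTransfer.

Section Morley.
Context (R : realType) (L : language) (U : structure L) (K : Type) (M : set U).
Hypothesis monU : monster K U.
Hypothesis smallM : small_model K M.
Let Kunc := monster_uncountable monU.
Let Usat := monster_saturated monU.

Lemma small_model_nonempty : M !=set0.
Proof. by case: smallM => _ []. Qed.
Let M0 := small_model_nonempty.

Context (V : Type) (mu : kfun R U V).
Hypotheses (muK : keisler [set: U] mu) (muB : borel_definable M mu).
Context (Y : Type) (nu : kfun R U Y).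
Hypothesis real : forall (A : set U) (q : stype Y A), small K A ->
  exists b, realizes b q.
Hypothesis nuK : keisler [set: U] nu.

(** The integral over any admissible model is pushed forward to one and the same integral over types
    over [M], which does not mention the model; so the common value required by the definition
    exists. *)
Lemma morleyE (A : set U) (f : formula L ((V + Y) + U)) : small_model K A -> M `<=` A -> lang_over A f ->
  morley K M mu nu f = \int[borel_ext A nu]_q fiber mu f q.
Proof.
move=> sA MA fA; rewrite /morley.
set S := (X in xget _ X).
suff h : S (\int[borel_ext A nu]_q fiber mu f q).
  have /(_ A sA MA fA) := xgetPex 0 (ex_intro _ _ h); exact.
move=> B sB MB fB.
(* Parameters are taken in both models at once, so that the same [g] and [c] serve for [A] and for
   [B]. *)
pose P := A `&` B.
have P0 : P !=set0 by have [a Ma] := M0; exists a; split; [exact: MA|exact: MB].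
have fP : lang_over P f.
  apply: (free_in_sub _ (free_inI fA fB)) => -[//|a]; exact.
have [k [g [c [cP fE]]]] := instantiate_extract P0 fP.
have key C (sC : small_model K C) (MC : M `<=` C) (cC : forall i, okA C (c i)) :
    \int[borel_ext C nu]_q fiber mu f q =
    \int[borel_ext M (fun h => nu (subst c h))]_q fiber mu (lift_params U g) q.
  transitivity (\int[borel_ext C nu]_q fiber mu (lift_params U g) (tpull MC cC q)).
    congr (Rintegral _ _ _); apply/funext => q.
    have [b bq] := real q sC.1.
    by rewrite fE (fiber_instantiate muB MC M0 cC _ bq).
  apply: integral_push => //.
  - exact: keisler_restrict.
  - by apply: keisler_restrict; exact: keisler_subst.
  - exact: muB.2.
  - move=> q.
    have [b bq] := realize_tuple Kunc Usat q smallM.1.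
    rewrite (fiberE muB (@subset_refl _ M) M0 _ bq) ?(keisler_ge0 muK) //.
      exact: lang_overT.
    exact: lang_over_lift.
rewrite (key A) // => [|i]; last first.
  by have := cP i; rewrite /okA; case: (c i) => // a [].
by rewrite (key B) // => i; have := cP i; rewrite /okA; case: (c i) => // a [].
Qed.

Lemma morley_model W (f : formula L (W + U)) :
  exists A, [/\ small_model K A, M `<=` A & lang_over A f].
Proof. exact: small_model_over smallM.1. Qed.

Lemma morley_keisler : keisler [set: U] (morley K M mu nu).
Proof.
have realA A (sA : small_model K A) (q : stype Y A) := real q sA.1.
have b0 A (MA : M `<=` A) f q (sA : small_model K A) (fA : lang_over A f) :=
  fiber_bounds muK muB MA M0 (realA A sA) q fA.
split.
- move=> f _; have [A [sA MA fA]] := morley_model f.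
  rewrite (morleyE sA MA fA); apply: Rintegral_ge0 => q _.
  by have /andP[] := b0 A MA f q sA fA.
- have [A [sA MA fA]] := morley_model (@fTrue L (void + U)).
  rewrite (morleyE sA MA (I : lang_over A fTrue)).
  transitivity (\int[borel_ext A nu]_q (cst 1 q)).
    congr (Rintegral _ _ _); apply/funext => q; have [b bq] := realA A sA q.
    by rewrite (fiberE muB MA M0 _ bq) //; exact: keisler_true muK.
  rewrite Rintegral_cst // mul1r -[RHS]/(fine 1%E); congr fine.
  exact: probability_setT.
- move=> f g _ _ fg; have [A [sA MA [fA gA]]] := morley_model (fAnd f g).
  rewrite (morleyE sA MA fA) (morleyE sA MA gA).
  congr (Rintegral _ _ _); apply/funext => q; have [b bq] := realA A sA q.
  rewrite !(fiberE muB MA M0 _ bq) //; apply: (keisler_equiv muK).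
  + exact: lang_overT.
  + exact: lang_overT.
  + by move=> v; rewrite !satp_plug.
- move=> f g _ _ fg; have [A [sA MA [fA gA]]] := morley_model (fAnd f g).
  have fgA : lang_over A (fOr f g) by [].
  rewrite (morleyE sA MA fA) (morleyE sA MA gA) (morleyE sA MA fgA).
  rewrite -RintegralD //; [|exact: (fiber_integrable muK muB MA M0 (realA A sA) _ fA)|
    exact: (fiber_integrable muK muB MA M0 (realA A sA) _ gA)].
  congr (Rintegral _ _ _); apply/funext => q; have [b bq] := realA A sA q.
  rewrite !(fiberE muB MA M0 _ bq) //.
  rewrite -(keisler_additive muK) //; [exact: lang_overT|exact: lang_overT|].
  by move=> v; rewrite !satp_plug.
Qed.

End Morley.

(** * Exchangeability of the powers *)

Section MorleyTransfer.
Context (R : realType) (L : language) (U : structure L) (K : Type) (M : set U).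

Definition map2 X X' Y Y' (s : X -> X') (t : Y -> Y') (z : X + Y) : X' + Y' :=
  match z with inl x => inl (s x) | inr y => inr (t y) end.

Lemma vrename_comp X Y Z (s : X -> Y) (t : Y -> Z) (f : formula L (X + U)) :
  vrename t (vrename s f) = vrename (t \o s) f.
Proof. by rewrite /vrename frename_comp; congr frename; apply/funext => -[]. Qed.

Lemma vrename_id X (s : X -> X) (f : formula L (X + U)) : s =1 id -> vrename s f = f.
Proof. by move=> sE; apply: frename_id => -[x|] //; rewrite sE. Qed.

Lemma eq_vrename X Y (s t : X -> Y) (f : formula L (X + U)) : s =1 t ->
  vrename s f = vrename t f.
Proof. by move=> /funext ->. Qed.

Lemma satp_vrename X Y (s : X -> Y) (v : Y -> U) (f : formula L (X + U)) :
  satp v (vrename s f) <-> satp (v \o s) f.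
Proof. exact: satp_subst. Qed.

Lemma lang_over_vrename X Y (s : X -> Y) (A : set U) (f : formula L (X + U)) :
  lang_over A (vrename s f) <-> lang_over A f.
Proof.
rewrite /lang_over free_in_frename.
by split; apply: free_in_sub => -[].
Qed.

Lemma morley_left X X' Y (s : X -> X') (la : kfun R U X) (la' : kfun R U X')
    (nu : kfun R U Y) : (forall g, la g = la' (vrename s g)) ->
  forall f, morley K M la nu f = morley K M la' nu (vrename (map2 s id) f).
Proof.
move=> lala' f; rewrite /morley; congr xget; apply/funext => r.
apply/propext; split=> h N sN MN fN.
- rewrite (h N sN MN) //; last by move/lang_over_vrename: fN.
  congr (Rintegral _ _ _); apply/funext => q; rewrite /fiber; congr xget.
  have e b : la (plug b f) = la' (plug b (vrename (map2 s id) f)).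
    rewrite lala'; congr la'; rewrite /plug /vrename !frename_comp.
    by congr frename; apply/funext => -[[]|].
  by apply/seteqP; split=> x [b bq <-]; exists b => //; rewrite e.
- rewrite (h N sN MN) //; last by apply/lang_over_vrename.
  congr (Rintegral _ _ _); apply/funext => q; rewrite /fiber; congr xget.
  have e b : la (plug b f) = la' (plug b (vrename (map2 s id) f)).
    rewrite lala'; congr la'; rewrite /plug /vrename !frename_comp.
    by congr frename; apply/funext => -[[]|].
  by apply/seteqP; split=> x [b bq <-]; exists b => //; rewrite e.
Qed.

Hypothesis monU : monster K U.
Hypothesis smallM : small_model K M.
Let M0 := small_model_nonempty smallM.
Context (V : Type) (mu : kfun R U V).
Hypotheses (muK : keisler [set: U] mu) (muB : borel_definable M mu).

(** Renaming in the right factor changes the space of integration, so unlike renaming on the left it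
    rests on the image-measure formula. *)
Lemma morley_push X Y (nu : kfun R U X) (nu' : kfun R U Y) (s : Y -> X) :
  (forall (A : set U) (q : stype X A), small K A -> exists b, realizes b q) ->
  (forall (A : set U) (q : stype Y A), small K A -> exists b, realizes b q) ->
  keisler [set: U] nu -> (forall g, nu' g = nu (vrename s g)) ->
  forall f, morley K M mu nu' f = morley K M mu nu (vrename (map2 id s) f).
Proof.
move=> realX realY nuK nu'E f.
have nu'K : keisler [set: U] nu'.
  by rewrite (_ : nu' = fun g => nu (subst (inl \o s) g)); [exact: keisler_subst|apply/funext].
have [A [sA MA fA]] := morley_model monU smallM f.
have fA' : lang_over A (vrename (map2 id s) f) by apply/lang_over_vrename.
rewrite (morleyE monU smallM muK muB realX nuK sA MA fA').
rewrite (morleyE monU smallM muK muB realY nu'K sA MA fA).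
have sO (w : Y) : okA A (inl (s w) : X + U) by [].
rewrite -(integral_push (@subset_refl _ A) sO (keisler_restrict _ nuK) (keisler_restrict _ nu'K)).
- congr (Rintegral _ _ _); apply/funext => q.
  have [b bq] := realX A q sA.1.
  have bq' := @tpull_realizes _ _ _ _ _ _ _ (@subset_refl _ A) sO _ _ bq.
  rewrite (fiberE muB MA M0 fA bq') (fiberE muB MA M0 fA' bq).
  by congr mu; rewrite /plug /vrename frename_comp; congr frename; apply/funext => -[[]|].
- by move=> g _; exact: nu'E.
- exact: (fiber_measurable muB MA M0 (fun q => realY A q sA.1)).
- by move=> q; have /andP[] := fiber_bounds muK muB MA M0 (fun q => realY A q sA.1) q fA.
Qed.

Lemma Rintegral_clopen X (A : set U) (nu : kfun R U X) (g : formula L (X + U)) :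
  keisler A nu -> lang_over A g ->
  \int[borel_ext A nu]_q \1_(clopen_of A g : set (borel X A)) q = nu g.
Proof.
move=> nuK gA; rewrite /Rintegral integral_indic //; last exact: clopen_measurable.
by rewrite setIT -[RHS]/(fine (nu g)%:E); congr fine; exact: borel_extE.
Qed.

(** As [g] does not involve the variable of [mu], its fiber is the indicator of its clopen set. This
    makes the powers consistent when the last variable is dropped. *)
Lemma morley_inr X (nu : kfun R U X) (g : formula L (X + U)) :
  (forall (A : set U) (q : stype X A), small K A -> exists b, realizes b q) ->
  keisler [set: U] nu -> morley K M mu nu (vrename inr g) = nu g.
Proof.
move=> real nuK; have [A [sA MA gA]] := morley_model monU smallM g.
have gA' : lang_over A (vrename (@inr V X) g) by apply/lang_over_vrename.
rewrite (morleyE monU smallM muK muB real nuK sA MA gA').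
rewrite -[RHS](Rintegral_clopen (keisler_restrict _ nuK) gA).
congr (Rintegral _ _ _); apply/funext => q; have [b bq] := real A q sA.1.
rewrite (fiberE muB MA M0 gA' bq) indicE.
have E v : satp v (plug b (vrename (@inr V X) g)) <-> satp b g.
  by rewrite satp_plug satp_vrename.
have lT W (h : formula L (W + U)) := lang_overT h.
have [qg|qng] := stype_complete q gA.
  rewrite mem_set // -(keisler_true muK); apply: (keisler_equiv muK) => // v.
  by split=> // _; apply/E; exact: bq.
rewrite memNset; last by apply/stype_not.
transitivity (mu (fNot fTrue)); last exact: (keisler_false muK).
apply: (keisler_equiv muK) => // v.
split=> [/E|] => h; last by case: h.
by have := bq _ qng.
Qed.

End MorleyTransfer.

Section Powers.
Context (R : realType) (L : language) (U : structure L) (K : Type) (M : set U).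
Hypothesis monU : monster K U.
Hypothesis smallM : small_model K M.
Context (mu : kfun R U unit).
Hypotheses (muK : keisler [set: U] mu) (muE : excellent K M mu).
Let muB : borel_definable M mu. Proof. by case: muE => -[]. Qed.
Local Notation mpow := (@mpow R L U K M mu).
Local Notation pp := (@paren_product R L U K M mu).

Lemma real_ord n (A : set U) (q : stype 'I_n A) : small K A -> exists b, realizes b q.
Proof.
exact: (realize_tuple (monster_uncountable monU) (monster_saturated monU)).
Qed.

Lemma real_unit (A : set U) (q : stype unit A) : small K A -> exists b, realizes b q.
Proof. by move=> sA; apply: monster_saturated monU _ sA _. Qed.

Lemma keisler_vrename X Y (s : X -> Y) (la : kfun R U Y) :
  keisler [set: U] la -> keisler [set: U] (fun f => la (vrename s f)).
Proof. exact: (@keisler_subst _ _ _ _ _ la (inl \o s)). Qed.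

Lemma mpow_keisler n : keisler [set: U] (@mpow n).
Proof.
elim: n => [|n IH]; first exact: keisler_vrename.
apply: (@keisler_vrename _ _ _ (morley K M mu (@mpow n))).
exact: (morley_keisler monU smallM muK muB (@real_ord _) IH).
Qed.

Lemma split_last_lift n (j : 'I_n.+1) : split_last (lift ord_max j) = inr j.
Proof. by rewrite /split_last liftK. Qed.

Lemma split_last_max n : split_last (@ord_max n.+1) = inl tt.
Proof. by rewrite /split_last unlift_none. Qed.

Lemma mpow_lift n (f : formula L ('I_n.+1 + U)) :
  @mpow n.+1 (vrename (lift ord_max) f) = @mpow n f.
Proof.
rewrite /= vrename_comp (eq_vrename (t := inr)); last exact: split_last_lift.
exact: (morley_inr monU smallM muK muB _ (@real_ord _) (mpow_keisler n)).
Qed.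

Fixpoint comb n := if n is n'.+1 then Node Leaf (comb n') else Leaf.

Definition leaf : kfun R U 'I_1 := fun f => mu (vrename (fun=> tt) f).

Lemma leaf_keisler : keisler [set: U] leaf.
Proof. exact: keisler_vrename. Qed.

Lemma morley_leaf Y (nu : kfun R U Y) f :
  morley K M leaf nu f = morley K M mu nu (vrename (map2 (fun=> tt) id) f).
Proof. exact: morley_left. Qed.

Lemma comb_keisler n : keisler [set: U] (@pp (comb n)).
Proof.
elim: n => [|n IH]; first exact: leaf_keisler.
rewrite (_ : @pp (comb n.+1) = fun f : formula L ('I_(1 + psize (comb n)) + U) => morley K M mu (@pp (comb n))
    (vrename (map2 (fun=> tt) id \o @fintype.split 1 (psize (comb n))) f)); last first.
  by apply/funext => f; rewrite /= morley_leaf vrename_comp.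
apply: keisler_vrename.
exact: (morley_keisler monU smallM muK muB (@real_ord _) IH).
Qed.

(** The order is reversed: [mpow] gives its newest, leftmost factor the last variable, while a
    parenthesized product numbers from the left. *)
Fixpoint comb_index n : 'I_n.+1 -> 'I_(psize (comb n)) :=
  match n return 'I_n.+1 -> 'I_(psize (comb n)) with
  | 0 => id
  | n'.+1 => fun i => match split_last i with
     | inl _ => lshift (psize (comb n')) (ord0 : 'I_1)
     | inr j => rshift 1 (@comb_index n' j) end
  end.

Lemma split_lshift m n (i : 'I_m) : fintype.split (lshift n i) = inl i.
Proof. exact: (unsplitK (inl i)). Qed.

Lemma split_rshift m n (i : 'I_n) : fintype.split (rshift m i) = inr i.
Proof. exact: (unsplitK (inr i)). Qed.

Lemma mpow_comb n (f : formula L ('I_n.+1 + U)) :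
  @mpow n f = @pp (comb n) (vrename (@comb_index n) f).
Proof.
elim: n f => [|n IH] f; first by rewrite /= vrename_comp.
rewrite [LHS]/= (morley_push monU smallM muK muB (@real_ord _) (@real_ord _) (comb_keisler n) IH).
rewrite [RHS]/= morley_leaf !vrename_comp; congr morley; apply: eq_vrename => i /=.
by case: (split_last i) => [[]|j]; rewrite ?split_lshift ?split_rshift.
Qed.

Definition swap01 : 'I_2 -> 'I_2 := tperm (@lshift 1 1 ord0) (@rshift 1 1 ord0).

Lemma pair_swap (f : formula L ('I_2 + U)) :
  @pp (Node Leaf Leaf) (vrename swap01 f) =
  @pp (Node Leaf Leaf) f.
Proof.
have key h : @pp (Node Leaf Leaf) h =
    morley K M mu mu (vrename (map2 (fun=> tt) (fun=> tt) \o @fintype.split 1 1) h).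
  rewrite /= morley_leaf.
  rewrite (morley_push monU smallM muK muB real_unit (@real_ord _) muK (nu' := leaf) (s := fun=> tt)) //.
  by rewrite !vrename_comp; congr morley; apply: eq_vrename => i /=; case: fintype.split.
rewrite !key muE.2 !vrename_comp; congr morley; apply: eq_vrename => i /=.
rewrite /swap01; have [->|->] : i = @lshift 1 1 ord0 \/ i = @rshift 1 1 ord0.
- by case: i => -[|[|//]] lt; [left|right]; exact: val_inj.
- by rewrite tpermL split_lshift split_rshift.
- by rewrite tpermR split_lshift split_rshift.
Qed.

Definition swap_head c (i : 'I_(1 + (1 + c))) : 'I_(1 + (1 + c)) :=
  match @fintype.split 2 c i with
  | inl i => @lshift 2 c (swap01 i)
  | inr j => @rshift 2 c j end.

(* Reassociation exposes [mu * mu], which is symmetric, as a left factor. *)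
Lemma node_swap (t : paren) (f : formula L ('I_(psize (Node Leaf (Node Leaf t))) + U)) :
  @pp (Node Leaf (Node Leaf t)) (vrename (@swap_head (psize t)) f) =
  @pp (Node Leaf (Node Leaf t)) f.
Proof.
have [[_ _ pI] _] := muE.
have key h := pI (Node Leaf (Node Leaf t)) (Node (Node Leaf Leaf) t) erefl h.
rewrite !key.
have cid' (h : formula L ('I_(psize (Node Leaf (Node Leaf t))) + U)) :
    vrename (cast_ord (erefl : psize (Node Leaf (Node Leaf t)) = psize (Node (Node Leaf Leaf) t))) h = h.
  by apply: vrename_id => i; exact: val_inj.
rewrite !cid'.
have E h : @pp (Node (Node Leaf Leaf) t) h =
  morley K M (@pp (Node Leaf Leaf)) (@pp t)
    (vrename (@fintype.split 2 (psize t)) h) by [].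
rewrite !E [RHS](@morley_left _ _ _ _ _ _ _ _ swap01 _ (@pp (Node Leaf Leaf))); last first.
  by move=> g; rewrite pair_swap.
rewrite !vrename_comp; congr morley; apply: eq_vrename => i /=.
rewrite /swap_head; case: (@fintype.split 2 (psize t) i) => j /=.
  by rewrite split_lshift.
by rewrite split_rshift.
Qed.

Definition mpow_invariant n (s : 'I_n.+1 -> 'I_n.+1) :=
  forall f, @mpow n (vrename s f) = @mpow n f.

(** The last two variables of [mpow] are the first two of the comb, where [node_swap] acts. With
    only two factors there is no tail [t], and [pair_swap] takes over. *)
Lemma mpow_swap n : mpow_invariant (tperm (@ord_max n.+1) (lift ord_max ord_max)).
Proof.
move=> f; rewrite !mpow_comb vrename_comp; case: n f => [|n] f.
  rewrite -[RHS]pair_swap vrename_comp; congr paren_product; apply: eq_vrename => i.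
  case: (unliftP ord_max i) => [j|] -> /=.
    have -> : j = ord_max by rewrite (ord1 j); exact: val_inj.
    rewrite tpermR split_last_max split_last_lift /swap01.
    by rewrite (_ : rshift 1 ord_max = @rshift 1 1 ord0) ?tpermR //; exact: val_inj.
  by rewrite tpermL split_last_max split_last_lift /swap01 tpermL; exact: val_inj.
rewrite -[RHS]node_swap vrename_comp; congr paren_product; apply: eq_vrename => i /=.
set c := psize (comb n).
have e0 : @lshift 1 (1 + c) ord0 = @lshift 2 c (@lshift 1 1 ord0) :> 'I_(1 + (1 + c)) by exact: val_inj.
have e1 : @rshift 1 (1 + c) (@lshift 1 c ord0) = @lshift 2 c (@rshift 1 1 ord0) :> 'I_(1 + (1 + c)) by exact: val_inj.
have e2 j : @rshift 1 (1 + c) (@rshift 1 c j) = @rshift 2 c j :> 'I_(1 + (1 + c)) by exact: val_inj.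
rewrite /swap_head /swap01.
case: (unliftP ord_max i) => [j|] ->; last first.
  by rewrite tpermL split_last_lift !split_last_max e0 split_lshift tpermL -e1.
case: (unliftP ord_max j) => [k|] ->; last first.
  by rewrite tpermR split_last_lift !split_last_max e1 split_lshift tpermR -e0.
rewrite tpermD; first by rewrite !split_last_lift e2 split_rshift.
- by rewrite neq_lift.
- by rewrite (inj_eq lift_inj) neq_lift.
Qed.

Lemma mpow_invariant_comp n (s t : 'I_n.+1 -> 'I_n.+1) :
  mpow_invariant s -> mpow_invariant t -> mpow_invariant (s \o t).
Proof. by move=> hs ht f; rewrite -vrename_comp hs ht. Qed.

Lemma eq_mpow_invariant n (s t : 'I_n.+1 -> 'I_n.+1) : s =1 t ->
  mpow_invariant s -> mpow_invariant t.
Proof. by move=> /funext ->. Qed.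

(** Permutations fixing the last index act on the right factor and are handled by induction.
    Conjugating the swap of the last two indices by these yields every transposition with the last
    index, and such a transposition reduces any [s] to the fixed case. *)
Lemma mpow_invariant_endo n (s : 'I_n.+1 -> 'I_n.+1) : injective s -> mpow_invariant s.
Proof.
elim: n s => [|n IH] s sI.
  by move=> f; rewrite vrename_id // => i; rewrite (ord1 i) (ord1 (s ord0)).
have fixmax (t : 'I_n.+2 -> 'I_n.+2) : injective t -> t ord_max = ord_max -> mpow_invariant t.
  move=> tI tmax; pose t' j := odflt j (unlift ord_max (t (lift ord_max j))).
  have t'E j : lift ord_max (t' j) = t (lift ord_max j).
    rewrite /t'; case: unliftP => [k ->//|e].
    by have /tI/eqP := etrans e (esym tmax); rewrite eq_sym (negbTE (neq_lift _ _)).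
  have t'I : injective t'.
    move=> j k e; apply: (@lift_inj _ ord_max); apply: tI.
    by rewrite -!t'E e.
  move=> f; rewrite /= [RHS](morley_push monU smallM muK muB (@real_ord _) (@real_ord _)
    (mpow_keisler n) (s := t')); last by move=> g; rewrite IH.
  rewrite !vrename_comp; congr morley; apply: eq_vrename => i /=.
  case: (unliftP ord_max i) => [j|] ->; last by rewrite tmax split_last_max.
  by rewrite -t'E !split_last_lift.
have trans (j : 'I_n.+1) : mpow_invariant (tperm (lift ord_max j) (@ord_max n.+1)).
  have [->|jm] := eqVneq j ord_max; first by rewrite tpermC; exact: mpow_swap.
  pose p := lift ord_max (@ord_max n).
  pose z : {perm 'I_n.+2} := tperm (lift ord_max j) p.
  have pj : p != lift ord_max j by rewrite (inj_eq lift_inj) eq_sym.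
  have zI : mpow_invariant z.
    apply: fixmax; first exact: perm_inj.
    by rewrite tpermD // eq_sym neq_lift.
  (* [z] exchanges [p], the second-to-last index, with [lift ord_max j] and fixes the last one. *)
  apply: (@eq_mpow_invariant _ (z \o (tperm ord_max p \o z))).
    move=> i; rewrite /= -!permM /z.
    have -> : (tperm (lift ord_max j) p * (tperm ord_max p * tperm (lift ord_max j) p) =
      tperm ord_max p ^ tperm (lift ord_max j) p)%g by rewrite conjgE tpermV.
    rewrite tpermJ tpermR tpermD 1?tpermC //; by rewrite eq_sym neq_lift.
  by apply: mpow_invariant_comp => //; apply: mpow_invariant_comp => //; exact: mpow_swap.
case: (unliftP ord_max (s ord_max)) => [j sE|sE]; last exact: fixmax.
pose t := tperm (lift ord_max j) (@ord_max n.+1).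
apply: (@eq_mpow_invariant _ (t \o (t \o s))); first by move=> i; rewrite /= tpermK.
apply: mpow_invariant_comp; first exact: trans.
apply: fixmax; first by apply: inj_comp => //; exact: perm_inj.
by rewrite /= sE tpermL.
Qed.

(** An index missed by [s] is moved to the end by a permutation and dropped with [mpow_lift]; when
    the numbers of variables agree, [s] is a permutation. *)
Lemma mpow_injective n m (s : 'I_n.+1 -> 'I_m.+1) (f : formula L ('I_n.+1 + U)) :
  injective s -> @mpow m (vrename s f) = @mpow n f.
Proof.
move=> sI; have nm : (n <= m)%N by have := leq_card s sI; rewrite !card_ord.
elim: m nm s sI => [|m IH] nm s sI.
  by move: nm s sI f; rewrite leqn0 => /eqP -> s sI f; exact: mpow_invariant_endo.
move: nm; rewrite leq_eqVlt => /predU1P[e|nm].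
  by move: s sI; rewrite -e => s sI; exact: mpow_invariant_endo.
have [k kN] : exists k, forall i, s i != k.
  have : (#|codom s| < #|'I_m.+2|)%N.
    by rewrite (card_codom sI) !card_ord ltnS.
  move=> lt; have [k _ kN] : exists2 k, k \in 'I_m.+2 & k \notin codom s.
    by apply/subsetPn; apply/negP => /subset_leq_card; rewrite leqNgt lt.
  by exists k => i; apply: contra kN => /eqP <-; exact: codom_f.
pose t := tperm k (@ord_max m.+1).
have tN i : t (s i) != ord_max.
  by rewrite -[ord_max](tpermL k) (inj_eq perm_inj).
pose s' i := odflt ord0 (unlift ord_max (t (s i))).
have s'E i : lift ord_max (s' i) = t (s i).
  by rewrite /s'; case: unliftP (tN i) => [j ->//|->]; rewrite eqxx.
have s'I : injective s'.
  by move=> i j e; apply: sI; apply: (@perm_inj _ t); rewrite -!s'E e.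
rewrite -[LHS](mpow_invariant_endo (@perm_inj _ t)) -[RHS](IH _ s' s'I) // -[RHS]mpow_lift.
by rewrite !vrename_comp; congr mpow; apply: eq_vrename => i /=; rewrite s'E.
Qed.

(** The bound is inclusive, since [mpow n] has the variables with indices 0 to [n]. *)
Definition below n (g : formula L (nat + U)) :=
  free_in (fun x => if x is inl i then (i <= n)%N else True) g.

Lemma below_ex (g : formula L (nat + U)) : exists n, below n g.
Proof.
have [s _ sg] := finite_free (free_inT g).
exists (\max_(x <- s) if x is inl i then i else 0%N).
apply: free_in_sub sg => -[i|//].
elim: s => //= x s IH; rewrite big_cons => -[->|/IH h]; first exact: leq_maxl.
exact: leq_trans h (leq_maxr _ _).
Qed.

(* The measure on countably many variables determined by the [mpow n]. *)
Definition kappa (g : formula L (nat + U)) : R :=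
  let n := projT1 (cid (below_ex g)) in @mpow n (vrename inord g).

Lemma mpow_below m n g : below m g -> (m <= n)%N ->
  @mpow n (vrename inord g) = @mpow m (vrename inord g).
Proof.
move=> gm mn; have mn' : (m.+1 <= n.+1)%N by [].
have wI : injective (widen_ord mn') by move=> i j /(congr1 val) /= /val_inj.
rewrite -(mpow_injective _ wI) vrename_comp; congr mpow.
apply: frename_ext gm _ => -[i im|//] /=.
by congr inl; apply: val_inj; rewrite /= !inordK // ltnS // (leq_trans im).
Qed.

Lemma kappaE n g : below n g -> kappa g = @mpow n (vrename inord g).
Proof.
move=> gn; rewrite /kappa; case: cid => m gm /=.
by have [/(mpow_below gn)//|/ltnW/(mpow_below gm)->] := leqP n m.
Qed.

Lemma kappa_injective n (s : 'I_n.+1 -> nat) f : injective s ->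
  kappa (vrename s f) = @mpow n f.
Proof.
move=> sI; pose m := \max_i s i.
have sm i : (s i <= m)%N by exact: leq_bigmax.
rewrite (@kappaE m); last first.
  by apply/free_in_frename; apply: free_in_sub (free_inT f) => -[i _|] //=.
rewrite vrename_comp mpow_injective // => i j /(congr1 val).
by rewrite /= !inordK ?ltnS // => /sI.
Qed.

Lemma kappa_keisler : keisler [set: U] kappa.
Proof.
have lT W (h : formula L (W + U)) := lang_overT h.
split.
- move=> f _; have [n fn] := below_ex f; rewrite (kappaE fn).
  exact: keisler_ge0 (mpow_keisler n) _ (lT _ _).
- by rewrite (@kappaE 0%N) //; exact: (keisler_true (mpow_keisler 0)).
- move=> f g _ _ fg; have [n [fn gn]] := below_ex (fAnd f g).
  rewrite (kappaE fn) (kappaE gn).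
  apply: (keisler_equiv (mpow_keisler n)) => // v.
  by rewrite !satp_vrename.
- move=> f g _ _ fg; have [n [fn gn]] := below_ex (fAnd f g).
  have fgn : below n (fOr f g) by [].
  rewrite (kappaE fn) (kappaE gn) (kappaE fgn) -(keisler_additive (mpow_keisler n)) //.
  by move=> v; rewrite !satp_vrename.
Qed.

Lemma Pmu_spec : is_Pmu K M mu (Pmu K M mu).
Proof.
apply: (@getPex _ [set P | is_Pmu K M mu P]).
exists (borel_ext [set: U] kappa); split; first exact: borel_ext_regular kappa_keisler.
move=> n f; rewrite (borel_extE kappa_keisler); last exact: lang_overT.
by rewrite kappa_injective //; exact: val_inj.
Qed.

Lemma PmuE g : Pmu K M mu (clopen_of setT g) = (kappa g)%:E.
Proof.
have [n gn] := below_ex g.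
rewrite (kappaE gn) -(Pmu_spec.2 n); congr (Pmu _ _ _ (clopen_of _ _)).
rewrite vrename_comp -[LHS](@vrename_id _ _ _ id) //.
by apply: frename_ext gn _ => -[i im|//] /=; rewrite inordK.
Qed.

End Powers.

(** * The extension property holds almost surely *)

Section Diagrams.
Context (L : language).

(** The tuples may live in different structures: those of an induced structure are compared with
    tuples of [U] that name their quantifier-free type. *)
Definition qfeq (S T : structure L) n (x : 'I_n -> S) (y : 'I_n -> T) :=
  (forall i j, x i = x j <-> y i = y j) /\
  forall r (v : 'I_(arity r) -> 'I_n), interp (x \o v) <-> interp (y \o v).

Lemma sat_bigAnd (S : structure L) V (e : V -> S) (I : finType) (F : I -> formula L V) :
  sat e (\big[fAnd/fTrue]_(i : I) F i) <-> forall i, sat e (F i).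
Proof.
split=> [h i|h].
  have := mem_index_enum i; elim: (index_enum I) h => //= j s IH.
  by rewrite big_cons inE => -[Fj /IH{}IH] /predU1P[->|/IH].
by elim: (index_enum I) => [|j s IH]; rewrite ?big_nil ?big_cons.
Qed.

Lemma sat_literal (S T : structure L) n (x : 'I_n -> S) (y : 'I_n -> T) f :
  sat x (literal y f) <-> (sat x f <-> sat y f).
Proof. by rewrite /literal; case: asboolP => h /=; split=> // -[]; auto. Qed.

Lemma sat_diag (S T : structure L) n (x : 'I_n -> S) (y : 'I_n -> T) :
  sat x (diag y) <-> qfeq x y.
Proof.
rewrite /diag /= !sat_bigAnd; split=> -[h1 h2]; split.
- by move=> i j; have /sat_bigAnd/(_ j)/sat_literal := h1 i.
- move=> r v; have /sat_bigAnd/(_ (finfun v))/sat_literal /= := h2 r.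
  have -> : (finfun v : {ffun _ -> _}) = v :> (_ -> _) by apply/funext => k; rewrite ffunE.
  exact.
- by move=> i; apply/sat_bigAnd => j; apply/sat_literal; exact: h1.
- by move=> r; apply/sat_bigAnd => v; apply/sat_literal; exact: h2.
Qed.

Lemma qfeq_refl (S : structure L) n (x : 'I_n -> S) : qfeq x x.
Proof. by []. Qed.

Lemma qfeq_sym (S T : structure L) n (x : 'I_n -> S) (y : 'I_n -> T) :
  qfeq x y -> qfeq y x.
Proof. by move=> [h1 h2]; split=> *; symmetry. Qed.

Lemma qfeq_trans (S T W : structure L) n (x : 'I_n -> S) (y : 'I_n -> T) (z : 'I_n -> W) :
  qfeq x y -> qfeq y z -> qfeq x z.
Proof. by move=> [h1 h2] [h3 h4]; split=> *; rewrite (h1, h2) (h3, h4). Qed.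

Lemma qfeq_comp (S T : structure L) n m (x : 'I_n -> S) (y : 'I_n -> T) (t : 'I_m -> 'I_n) :
  qfeq x y -> qfeq (x \o t) (y \o t).
Proof. by move=> [h1 h2]; split=> [i j|r v]; [exact: h1|exact: (h2 r (t \o v))]. Qed.

Lemma qfeq_inj (S T : structure L) n (x : 'I_n -> S) (y : 'I_n -> T) :
  qfeq x y -> injective x -> injective y.
Proof. by move=> [h _] xI i j /h /xI. Qed.

End Diagrams.

Definition snoc X n (x : 'I_n.+1 -> X) (c : X) (i : 'I_n.+2) : X :=
  if unlift ord_max i is Some j then x j else c.

Lemma snoc_lift X n (x : 'I_n.+1 -> X) c : snoc x c \o lift ord_max = x.
Proof. by apply/funext => j; rewrite /snoc /= liftK. Qed.

Section ExtensionProperty.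
Context (R : realType) (L : language) (U : structure L) (K : Type) (M : set U).
Hypothesis monU : monster K U.
Hypothesis smallM : small_model K M.
Context (mu : kfun R U unit).
Hypotheses (muK : keisler [set: U] mu) (muE : excellent K M mu).
Let muB : borel_definable M mu. Proof. by case: muE => -[]. Qed.
Local Notation mpow := (@mpow R L U K M mu).
Let kap := kappa K M mu.
Let M0 := small_model_nonempty smallM.

Lemma realized_over_M n (q : stype 'I_n M) : exists b, realizes b q.
Proof. exact: (real_ord monU q smallM.1). Qed.

Variables (n : nat) (a : 'I_n.+2 -> U).
Let base : formula L ('I_n.+1 + U) := lift_params U (diag (a \o lift ord_max)).
Let next : formula L ('I_n.+2 + U) := lift_params U (diag a).

(* The first [n + 1] points satisfy the base diagram, and none of the next [m]
   points extends it. *)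
Definition escape m : formula L (nat + U) :=
  fAnd (vrename (@nat_of_ord n.+1) base)
    (fAnds [seq fNot (vrename (snoc (@nat_of_ord n.+1) j) next) | j <- iota n.+1 m]).

Lemma satp_escape m (v : nat -> U) : satp v (escape m) <->
  satp (v \o @nat_of_ord n.+1) base /\
  forall j, (n < j < n.+1 + m)%N -> ~ satp (v \o snoc (@nat_of_ord n.+1) j) next.
Proof.
rewrite {1}/satp /= -/(satp v _) -satp_vrename; split=> -[h1 h2]; split=> //.
  move=> j jm; rewrite -satp_vrename; move/sat_fAnds: h2.
  by move=> /(_ (fNot (vrename (snoc (@nat_of_ord n.+1) j) next))); apply;
    apply/mapP; exists j; rewrite // mem_iota.
apply/sat_fAnds => _ /mapP[j jm ->].
suff : ~ satp v (vrename (snoc (@nat_of_ord n.+1) j) next) by [].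
by rewrite satp_vrename; apply: h2; rewrite -mem_iota.
Qed.

Lemma escape_over A m : lang_over A (escape m).
Proof.
have lb X Y (s : X -> Y) f : lang_over A (vrename s (lift_params U f)).
  by apply/lang_over_vrename; exact: lang_over_lift.
have h1 : lang_over A (vrename (@nat_of_ord n.+1) base) by exact: lb.
split; first exact: h1.
apply: free_in_fAnds => _ /mapP[j _ ->].
have h2 : lang_over A (vrename (snoc (@nat_of_ord n.+1) j) next) by exact: lb.
exact: h2.
Qed.

Lemma escape_below m : below (n + m) (escape m).
Proof.
split.
  apply/free_in_frename; apply: free_in_sub (free_inT base) => -[i _|] //=.
  by apply: leq_trans (leq_addr _ _); rewrite -ltnS.
apply: free_in_fAnds => _ /mapP[j + ->]; rewrite mem_iota => /andP[_ jm].
suff : below (n + m) (vrename (snoc (@nat_of_ord n.+1) j) next) by [].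
apply/free_in_frename; apply: free_in_sub (free_inT next) => -[i _|] //=.
rewrite /snoc; case: unlift => [k|]; last by rewrite -ltnS.
by apply: leq_trans (leq_addr _ _); rewrite -ltnS.
Qed.

Let G : stype 'I_n.+1 M -> R := fiber mu (fNot (diag_last a)).

Section Step.
Variable m : nat.
Let le_nm : (n.+1 <= (n + m).+1)%N. Proof. by rewrite ltnS leq_addr. Qed.
Let wid : 'I_n.+1 -> 'I_(n + m).+1 + U := fun i => inl (widen_ord le_nm i).
Let widO w : okA M (wid w). Proof. by []. Qed.
Let pi := tpull (@subset_refl _ M) widO.
Let W : set (borel 'I_(n + m).+1 M) := clopen_of M (vrename inord (escape m)).

(** The new clause of [escape m.+1] involves only the first [n + 1] points and the new one, so with
    the earlier points fixed its probability is [G] of their projection. The indicator records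
    whether the earlier clauses hold. *)
Lemma escape_fiber (q : stype 'I_(n + m).+1 M) :
  fiber mu (vrename (@split_last (n + m)) (vrename inord (escape m.+1))) q =
  \1_W q * G (pi q).
Proof.
have [b bq] := realized_over_M q.
have eA : lang_over M (vrename (@split_last (n + m)) (vrename inord (escape m.+1))).
  by do 2 apply/lang_over_vrename; exact: escape_over.
have dA0 : lang_over M (diag_last a).
  by rewrite /diag_last; apply/lang_over_vrename; exact: lang_over_lift.
have dA : lang_over M (fNot (diag_last a)) by [].
have wA : lang_over M (vrename inord (escape m) : formula L ('I_(n + m).+1 + U)).
  by apply/lang_over_vrename; exact: escape_over.
have bpq := @tpull_realizes _ _ _ _ _ _ _ (@subset_refl _ M) widO _ _ bq.
rewrite (fiberE muB (@subset_refl _ M) M0 eA bq) /G.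
rewrite (fiberE muB (@subset_refl _ M) M0 dA bpq) indicE.
have lT X (h : formula L (X + U)) := lang_overT h.
pose bv (v : unit -> U) (s : unit + 'I_(n + m).+1) : U :=
  match s with inl x => v x | inr y => b y end.
have E v : satp v (plug b (vrename (@split_last (n + m)) (vrename inord (escape m.+1)))) <->
    satp b (vrename inord (escape m)) /\
    satp v (plug (asg b id \o wid) (fNot (diag_last a))).
  rewrite satp_plug !satp_vrename -/(bv v) !satp_escape.
  (* Indices up to [n + m] name the earlier points, read off [b]; index [n + m + 1] is the variable
     of [mu], read off [v]. *)
  have bvj j : (j <= n + m)%N -> bv v (split_last (inord j : 'I_(n + m).+2)) = b (inord j).
    move=> jm; have -> : inord j = lift ord_max (inord j : 'I_(n + m).+1).
      by apply: val_inj; rewrite /= /bump !inordK ?ltnS ?(leqW jm) // leqNgt ltnS jm.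
    by rewrite split_last_lift.
  have bvm : bv v (split_last (inord (n + m).+1 : 'I_(n + m).+2)) = v tt.
    have -> : inord (n + m).+1 = ord_max :> 'I_(n + m).+2 by apply: val_inj; rewrite /= inordK.
    by rewrite split_last_max.
  have e1 : (bv v \o @split_last (n + m) \o inord) \o @nat_of_ord n.+1 =
      (b \o inord) \o @nat_of_ord n.+1.
    apply/funext => i /=; apply: bvj; apply: leq_trans (leq_addr _ _).
    by rewrite -ltnS.
  have e2 j : (j <= n + m)%N -> (bv v \o @split_last (n + m) \o inord) \o snoc (@nat_of_ord n.+1) j =
      (b \o inord) \o snoc (@nat_of_ord n.+1) j.
    move=> jm; apply/funext => i /=; apply: bvj; rewrite /snoc; case: unlift => // k.
    by apply: leq_trans (leq_addr _ _); rewrite -ltnS.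
  have e3 : (bv v \o @split_last (n + m) \o inord) \o snoc (@nat_of_ord n.+1) (n + m).+1 =
      (fun s => match s with inl x => v x | inr y => (asg b id \o wid) y end) \o @split_last n.
    apply/funext => i /=; rewrite /snoc; case: (unliftP ord_max i) => [k|] ->.
      rewrite split_last_lift /=; have kn : (k <= n + m)%N.
        by apply: leq_trans (leq_addr _ _); rewrite -ltnS.
      by rewrite bvj //; congr b; apply: val_inj; rewrite /= inordK.
    by rewrite split_last_max.
  have -> : satp v (plug (asg b id \o wid) (fNot (diag_last a))) <->
      ~ satp ((bv v \o @split_last (n + m) \o inord) \o snoc (@nat_of_ord n.+1) (n + m).+1) next.
    by rewrite e3 satp_plug -satp_vrename.
  rewrite e1; split.
    move=> [h1 h2]; split; [split=> // j jm|].
      rewrite -e2; last by case/andP: jm.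
      by apply: h2; case/andP: jm => -> jm; rewrite addnS ltnW // ltnS.
    by apply: h2; rewrite addnS ltnS leq_addr /= addSn.
  move=> [[h1 h2] h3]; split=> // j /andP[nj]; rewrite addnS ltnS addSn leq_eqVlt.
  case/predU1P=> [->//|jm]; rewrite e2 //; apply: h2.
  by rewrite nj.
have [qw|qnw] := stype_complete q wA.
  rewrite mem_set // mul1r; apply: (keisler_equiv muK) => // v.
  rewrite E; split=> [[]//|h]; split=> //; exact: bq.
rewrite memNset ?mul0r; last by move=> qw; move/(stype_not _ wA): qnw.
transitivity (mu (fNot fTrue)); last exact: (keisler_false muK).
apply: (keisler_equiv muK) => // v; rewrite E; split=> [[qw _]|h]; last by case: h.
by have /= := bq _ qnw.
Qed.

End Step.

Let Pn : probability (borel 'I_n.+1 M) R := borel_ext M (@mpow n).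

(* The part of the base on which the conditional probability of not extending
   exceeds [1 - eta]. *)
Let tail (eta : R) : set (borel 'I_n.+1 M) :=
  clopen_of M base `&` [set r | 1 - eta < G r].

Let G_measurable : measurable_fun [set: borel 'I_n.+1 M] (G : borel 'I_n.+1 M -> R).
Proof.
apply: (fiber_measurable muB (@subset_refl _ M) M0 (@realized_over_M _)).
suff : lang_over M (diag_last a) by [].
by rewrite /diag_last; apply/lang_over_vrename; exact: lang_over_lift.
Qed.

Let G_bounds r : 0 <= G r <= 1.
Proof.
apply: (fiber_bounds muK muB (@subset_refl _ M) M0 (@realized_over_M _)).
suff : lang_over M (diag_last a) by [].
by rewrite /diag_last; apply/lang_over_vrename; exact: lang_over_lift.
Qed.

Let tail_measurable eta : measurable (tail eta).
Proof.
apply: measurableI; first by apply: clopen_measurable; exact: lang_over_lift.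
rewrite (_ : [set r | _] = G @^-1` `]1 - eta, +oo[%classic); last first.
  by apply/seteqP; split=> r /=; rewrite in_itv /= andbT.
by rewrite -[X in measurable X]setTI; apply: G_measurable.
Qed.

(** A pointwise bound is integrated: off the tail [G] is at most [1 - eta], and on the tail it is at
    most 1, which the extra [eta] pays for. *)
Lemma escape_decay m (eta : R) : 0 < eta <= 1 ->
  kap (escape m.+1) <= (1 - eta) * kap (escape m) + eta * fine (Pn (tail eta)).
Proof.
move=> /andP[eta0 eta1].
have le_nm : (n.+1 <= (n + m).+1)%N by rewrite ltnS leq_addr.
pose wid : 'I_n.+1 -> 'I_(n + m).+1 + U := fun i => inl (widen_ord le_nm i).
have widO w : okA M (wid w) by [].
pose pi := tpull (@subset_refl _ M) widO.
pose W : set (borel 'I_(n + m).+1 M) := clopen_of M (vrename inord (escape m)).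
pose Z : set (borel 'I_(n + m).+1 M) := pi @^-1` tail eta.
pose P : probability (borel 'I_(n + m).+1 M) R := borel_ext M (@mpow (n + m)).
have kM k : keisler M (@mpow k).
  by apply: keisler_restrict; exact: (mpow_keisler monU smallM muK muE).
have wA : lang_over M (vrename inord (escape m) : formula L ('I_(n + m).+1 + U)).
  by apply/lang_over_vrename; exact: escape_over.
have mW : measurable W by exact: clopen_measurable.
have mZ : measurable Z.
  by rewrite -[X in measurable X]setTI; apply: (tpull_measurable (@subset_refl _ M) widO).
have PW : kap (escape m) = fine (P W).
  rewrite /kap (kappaE monU smallM muK muE (escape_below m)) -[LHS]/(fine _%:E).
  by congr fine; rewrite /P (borel_extE (kM _)).
(* [Z] depends on the first [n + 1] coordinates only, whose marginal is [mpow n]. *)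
have PZ : P Z = Pn (tail eta).
  apply: (borel_ext_push (@subset_refl _ M) widO (kM _) (kM _)) => // f fM.
  rewrite -(mpow_injective monU smallM muK muE (s := widen_ord le_nm)) //.
  by move=> i j /(congr1 val) /= /val_inj.
have b1 : below (n + m).+1 (escape m.+1) by rewrite -addnS; exact: escape_below.
have eA : lang_over M (vrename (@split_last (n + m)) (vrename inord (escape m.+1))).
  by do 2 apply/lang_over_vrename; exact: escape_over.
have intI (E : set (borel 'I_(n + m).+1 M)) : measurable E ->
    P.-integrable setT (EFin \o (\1_E : borel 'I_(n + m).+1 M -> R)).
  move=> mE; apply: measurable_bounded_integrable => //.
    by apply: le_lt_trans (ltry 1); exact: probability_le1.
  exists 1; split=> // x x1 q _ /=; apply: le_trans (ltW x1).
  by rewrite indicE; case: (_ \in _); rewrite /= ?normr1 ?normr0.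
have intZ (c : R) (E : set (borel 'I_(n + m).+1 M)) : measurable E ->
    P.-integrable setT (EFin \o (fun q => c * \1_E q : R)).
  move=> mE; rewrite (_ : _ \o _ = (fun q => c%:E * (EFin \o \1_E) q)%E) //.
  by apply: integrableZl => //; exact: intI.
have intE (c : R) (E : set (borel 'I_(n + m).+1 M)) : measurable E ->
    \int[P]_q (c * \1_E q) = c * fine (P E).
  move=> mE; rewrite RintegralZl //; last exact: intI.
  by rewrite /Rintegral integral_indic // setIT.
rewrite /kap (kappaE monU smallM muK muE b1) -/(kap _) PW.
rewrite [X in X <= _](morleyE monU smallM muK muB (@real_ord _ _ _ monU _)
  (mpow_keisler monU smallM muK muE (n + m)) smallM (@subset_refl _ M) eA).
rewrite -PZ -!intE // -RintegralD //; [|exact: intZ|exact: intZ].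
apply: le_Rintegral => //.
- exact: (fiber_integrable muK muB (@subset_refl _ M) M0 (@realized_over_M _) _ eA).
- pose h c (E : set (borel 'I_(n + m).+1 M)) (q : borel 'I_(n + m).+1 M) : R := c * \1_E q.
  pose c : R := 1 - eta.
  rewrite (_ : _ \o _ = ((EFin \o h c W) \+ (EFin \o h eta Z))%E) //.
  by apply: integrableD => //; exact: intZ.
- move=> q _; rewrite escape_fiber -/W.
  (* The two projections differ only in the proof that [n + 1] is at most [n + m + 1]. *)
  rewrite (_ : tpull _ _ q = pi q); last first.
    by apply: stype_ext => f fM [_ pf]; split=> //; move: pf; congr (stype_set q (subst _ f));
      apply/funext => i; congr inl; exact: val_inj.
  have /andP[G0 G1] := G_bounds (pi q); rewrite !indicE.
  have [qW|_] := boolP (q \in W); last first.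
    by rewrite mul0r mulr0 add0r mulr_ge0 ?ler0n // ltW.
  have [qZ|qZ] := boolP (q \in Z) => /=; first by rewrite !mulr1 mul1r subrK.
  rewrite mulr1 mulr0 addr0 mul1r; move: qZ; rewrite notin_setE => qZ.
  rewrite leNgt; apply/negP => lt; apply: qZ; split=> //.
  split; first exact: lang_over_lift.
  move: qW; rewrite inE => qW.
  apply: (stype_imp1 qW).
    by apply: (@lang_over_subst _ _ M M) => //; exact: lang_over_lift.
  move=> v /satp_vrename /satp_escape[h _]; apply/satp_subst.
  move: h; congr satp; apply/funext => i /=; congr v.
  by apply: val_inj; rewrite /= inordK // (leq_trans (ltn_ord i)).
Qed.

Hypothesis ext : Pn (clopen_of M base `&` [set q | G q = 1]) = 0%E.

(** With [e'] the infimum and [z] the measure of a tail, decay gives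
    [e' <= (1 - eta) * e' + eta * z], hence [e' <= z]. As [eta] tends to 0 the tails shrink to the
    part of the base where [G] equals 1, which is null by [ext]. *)
Lemma escape_null (e : R) : (forall m, e <= kap (escape m)) -> e <= 0.
Proof.
move=> es; pose s m := kap (escape m); pose e' := inf (range s).
have s0 m : 0 <= s m.
  apply: (keisler_ge0 (kappa_keisler monU smallM muK muE)); exact: lang_overT.
have e's m : e' <= s m.
  by apply: ge_inf; [exists 0 => _ [k _ <-]|exists m].
have ee' : e <= e'.
  by apply: lb_le_inf; [exists (s 0%N), 0%N|move=> _ [m _ <-]; exact: es].
(* Starting at 1/2 keeps [1 - eta k] positive for the division below. *)
pose eta k : R := k.+2%:R^-1.
have eta01 k : 0 < eta k <= 1 by rewrite invr_gt0 ltr0n /= invf_le1 ?ler1n ?ltr0n.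
have eta1 k : eta k < 1 by rewrite invf_lt1 ?ltr1n ?ltr0n.
have e'z k : e' <= fine (Pn (tail (eta k))).
  set z := fine _; have /andP[h0 _] := eta01 k; have h1 := eta1 k.
  have : (e' - eta k * z) / (1 - eta k) <= e'.
    apply: lb_le_inf; first by exists (s 0%N), 0%N.
    move=> _ [m _ <-]; rewrite ler_pdivrMr ?subr_gt0 // lerBlDr.
    apply: le_trans (e's m.+1) _; rewrite [s m * _]mulrC.
    exact: escape_decay.
  rewrite ler_pdivrMr ?subr_gt0 // lerBlDr mulrBr mulr1 -addrA lerDl addrC subr_ge0.
  by rewrite [e' * _]mulrC ler_pM2l.
have cvg0 : Pn (tail (eta k)) @[k --> \oo] --> Pn (\bigcap_k tail (eta k)).
  apply: nonincreasing_cvg_mu => //.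
  - by apply: le_lt_trans (ltry 1); exact: probability_le1.
  - by apply: bigcapT_measurable => k; exact: tail_measurable.
  - move=> k l kl; apply/subsetPset => r [rb /= rG]; split=> //=.
    by apply: le_lt_trans rG; rewrite lerB // lef_pV2 ?posrE ?ltr0n // ler_nat !ltnS.
have z0 : Pn (\bigcap_k tail (eta k)) = 0%E.
  apply/eqP; rewrite eq_le measure_ge0 andbT -ext; apply: le_measure; rewrite ?inE.
  - by apply: bigcapT_measurable => k; exact: tail_measurable.
  - apply: measurableI; first by apply: clopen_measurable; exact: lang_over_lift.
    rewrite (_ : [set q | _] = G @^-1` [set 1]) //.
    by rewrite -[X in measurable X]setTI; apply: G_measurable.
  - move=> r h; split; first by have [] := h 0%N I.
    apply/eqP; rewrite /= eq_le; have /andP[_ -> /=] := G_bounds r.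
    apply/ler_addgt0Pr => d d0;
    pose N := Num.truncn d^-1; have [_ /= rG] := h N I.
    apply: le_trans (_ : 1 <= G r + eta N) _; first by rewrite -lerBlDr ltW.
    rewrite lerD2l; rewrite -[leRHS]invrK lef_pV2 ?posrE ?invr_gt0 ?ltr0n //.
    by apply: le_trans (ltW (truncnS_gt _)) _; rewrite ler_nat.
have : (e%:E <= limn (fun k => Pn (tail (eta k))))%E.
  apply: lime_ge; first by apply/cvg_ex; eexists; exact: cvg0.
  apply: nearW => k; rewrite -(fineK (fin_num_measure Pn _ (tail_measurable _))) lee_fin.
  exact: le_trans ee' (e'z k).
by rewrite (cvg_lim _ cvg0) // z0 lee_fin.
Qed.

End ExtensionProperty.

(** * Ultrapowers *)

Section Ultrapower.
Context (L : language) (U : structure L) (I : Type) (G : set_system I).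
Hypothesis GU : UltraFilter G.

Definition upower_class (x : I -> U) : set (I -> U) := [set y | G [set i | x i = y i]].

Definition upower_carrier := {X : set (I -> U) | exists x, X = upower_class x}.

Definition to_upower (x : I -> U) : upower_carrier :=
  exist _ (upower_class x) (ex_intro _ x erefl).

Definition of_upower (X : upower_carrier) : I -> U := projT1 (cid (svalP X)).

Lemma of_upowerK X : to_upower (of_upower X) = X.
Proof. by apply: sval_injective; rewrite /of_upower; case: cid. Qed.

Lemma to_upower_eq x y : to_upower x = to_upower y <-> G [set i | x i = y i].
Proof.
split=> [/(congr1 sval) /= e|h].
  have : upower_class y y by apply: filterS filterT.
  by rewrite -e.
apply: sval_injective => /=; apply/seteqP; split=> z hz.
  by apply: filterS (filterI h hz) => i [/= <-].
by apply: filterS (filterI h hz) => i [/= ->].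
Qed.

Lemma upower_inhabited : inhabited upower_carrier.
Proof. by have [x _] := structure_ex U; exact: inhabits (to_upower (fun=> x)). Qed.

Definition upower : structure L := @Structure L upower_carrier upower_inhabited
  (fun r w => G [set i | interp (fun k => of_upower (w k) i)]).

Lemma filter_ord n (A : 'I_n -> set I) : (forall k, G (A k)) -> G [set i | forall k, A k i].
Proof.
move=> GA; suff h (s : seq 'I_n) : G [set i | forall k, k \in s -> A k i].
  by apply: filterS (h (enum 'I_n)) => i h' k; apply: h'; rewrite mem_enum.
elim: s => [|k s IH]; first by apply: filterS filterT.
by apply: filterS (filterI (GA k) IH) => i [Ak As] l; rewrite inE => /predU1P[->|/As].
Qed.

Lemma ultra_not (A : set I) : G (~` A) <-> ~ G A.
Proof.
split=> [GnA GA|nGA]; last by have [] := in_ultra_setVsetC A GU.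
by have /filter_ex[i []] : G (A `&` ~` A) by exact: filterI.
Qed.

Lemma los V (f : formula L V) (e : V -> I -> U) :
  sat (to_upower \o e : V -> upower) f <-> G [set i | sat (e^~ i) f].
Proof.
elim: f e => {V} [V|V x y|V r v|V g IH|V g IHg h IHh|V g IH] e /=.
- by split=> // _; apply: filterS filterT.
- exact: to_upower_eq.
- have h : G [set i | forall k, of_upower (to_upower (e (v k))) i = e (v k) i].
    apply: filter_ord => k; apply/to_upower_eq; exact: of_upowerK.
  split=> h'; apply: filterS (filterI h h') => i [hi]; congr interp;
    by apply/funext => k /=; rewrite -[RHS]hi || rewrite -[LHS]hi.
- by rewrite IH -ultra_not.
- rewrite IHg IHh; split=> [[Gg Gh]|Ggh]; first exact: filterI.
  by split; apply: filterS Ggh => i [].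
- pose e' (w : I -> U) (o : option V) := if o is Some x then e x else w.
  have E (w : I -> U) : @sat L upower _ (fun o : option V => if o is Some x then to_upower (e x) else to_upower w) g <->
      G [set i | exists a, a = w i /\ sat (fun o => if o is Some x then e x i else a) g].
    have := IH (e' w).
    rewrite (_ : to_upower \o e' w = (fun o => if o is Some x then to_upower (e x) else to_upower w)); last first.
      by apply/funext => -[].
    move=> ->; split; apply: filterS => i /=.
      by move=> h; exists (w i); split=> //; move: h; congr sat; apply/funext => -[].
    by move=> [_ [->]]; congr sat; apply/funext => -[].
  split=> [[X]|h].
    by rewrite -(of_upowerK X) => /E; apply: filterS => i [a [_ ?]]; exists a.
  have /choice[w wP] : forall i, exists w : U,
      (exists a, sat (fun o => if o is Some x then e x i else a) g) ->
      sat (fun o => if o is Some x then e x i else w) g.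
    move=> i; have [[a ha]|na] := pselect (exists a, sat (fun o => if o is Some x then e x i else a) g).
      by exists a.
    by have [x0 _] := structure_ex U; exists x0.
  by exists (to_upower w); apply/E; apply: filterS h => i /wP hw; exists (w i).
Qed.

End Ultrapower.

(** Saturation covers only types over small sets, while [p] is over all of [U]. Each finite part of
    [p] has an assignment in [U] satisfying it; in an ultrapower indexed by finite parts these
    assignments form a realization, with [U] embedded diagonally. *)
Lemma stype_realized L (U : structure L) V (p : stype V [set: U]) :
  exists (U' : structure L) (j : U -> U') (a : V -> U'),
    elementary_embedding j /\ forall f, p f -> sat (asg a j) f.
Proof.
pose I := {s : seq (formula L (V + U)) | forall f, f \in s -> p f}.
pose F : set_system I := [set E | exists s0 : I, forall s : I,
  {subset sval s0 <= sval s} -> E s].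
have FF : ProperFilter F.
  apply: Build_ProperFilter_ex; first by move=> E [s0 s0E]; exists s0; exact: s0E.
  have nilP f : f \in ([::] : seq (formula L (V + U))) -> p f by [].
  split.
  - by exists (exist _ [::] nilP).
  - move=> E E' [s sE] [t tE].
    have stP f : f \in sval s ++ sval t -> p f.
      by rewrite mem_cat => /orP[/(svalP s)|/(svalP t)].
    exists (exist _ _ stP) => u /= stu; split; [apply: sE|apply: tE] => f fs;
      by apply: stu; rewrite mem_cat fs ?orbT.
  - by move=> E E' EE' [s sE]; exists s => t /sE /EE'.
have [G [GU FG]] := ultraFilterLemma FF.
have /choice[v vP] : forall s : I, exists v : V -> U, forall f, f \in sval s -> satp v f.
  by move=> s; exact: stype_fsat (svalP s).
exists (upower U G), (fun u => to_upower G (fun=> u)), (fun x => to_upower G (v^~ x)).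
split=> [W w f|f pf].
  rewrite -[_ \o w]/(to_upower G \o (fun x (_ : I) => w x)) los.
  split=> [h|/filter_ex[i]//]; exact: filterS filterT.
rewrite (_ : asg _ _ = to_upower G \o (fun x (i : I) => asg (v i) id x)); last first.
  by apply/funext => -[].
apply/los; apply: FG.
have fP g : g \in [:: f] -> p g by rewrite inE => /eqP ->.
exists (exist _ _ fP) => s /= fs.
suff -> : (fun x => asg (v s) id x) = asg (v s) id by apply: vP; apply: fs; rewrite mem_head.
by [].
Qed.

(** * Back and forth *)

Section BackAndForth.
Context (L : language) (U : structure L) (Pos : forall n, ('I_n.+1 -> U) -> Prop).

(** [Pos] speaks of tuples of [U], so a quantifier-free type of [S] is always named by a matching
    tuple of [U]. In [hom_extends], [c] may repeat an entry of [x], since the last entry of [b] may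
    repeat an earlier one. *)
Record homogeneous (S : structure L) : Prop := Homogeneous {
  hom_embeds : forall n (x : 'I_n.+1 -> S), exists b : 'I_n.+1 -> U, qfeq x b;
  hom_pos : forall n (x : 'I_n.+1 -> S) (b : 'I_n.+1 -> U),
    injective x -> qfeq x b -> Pos b;
  hom_extends : forall n (x : 'I_n.+1 -> S) (b : 'I_n.+2 -> U),
    injective x -> Pos b -> qfeq x (b \o lift ord_max) ->
    exists c, qfeq (snoc x c) b }.

Lemma homogeneous_isomorphic (S T : structure L) :
  isomorphic S T -> homogeneous S -> homogeneous T.
Proof.
move=> [h [g hK gK] hi] [S0 S1 S2].
have hq n (x : 'I_n -> T) : qfeq x (g \o x).
  split=> [i j|r v]; first by split=> [e|/(can_inj gK)//]; rewrite /= e.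
  by rewrite [X in _ <-> X]hi (_ : h \o _ = x \o v) //; apply/funext => k /=.
have gI n (x : 'I_n -> T) : injective x -> injective (g \o x).
  by move=> xI i j /(can_inj gK) /xI.
split.
- by move=> n x; have [b gb] := S0 n (g \o x); exists b; exact: qfeq_trans (hq _ x) gb.
- move=> n x b xI xb; apply: (S1 n (g \o x)); first exact: gI.
  exact: qfeq_trans (qfeq_sym (hq _ x)) xb.
- move=> n x b xI Pb xb; have [||c cb] := S2 n (g \o x) b _ Pb; first exact: gI.
    exact: qfeq_trans (qfeq_sym (hq _ x)) xb.
  exists (h c); apply: qfeq_trans (hq _ _) _; move: cb; congr qfeq.
  by apply/funext => i /=; rewrite /snoc; case: unlift => //=; rewrite hK.
Qed.

Lemma snoc_inj (X : Type) n (x : 'I_n.+1 -> X) c : injective x ->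
  (forall i, x i <> c) -> injective (snoc x c).
Proof.
move=> xI xc i j; rewrite /snoc.
case: (unliftP ord_max i) => [i'|] ->; case: (unliftP ord_max j) => [j'|] -> //.
- by move=> /xI ->.
- by move=> /xc.
- by move=> /esym /xc.
Qed.

(** The type of [x] with [c] is positive because it occurs in [S] on distinct points, and its base
    is the type of [y]; so [T] realizes it over [y]. *)
Lemma homogeneous_forth (S T : structure L) n (x : 'I_n.+1 -> S) (y : 'I_n.+1 -> T) c :
  homogeneous S -> homogeneous T -> injective x -> qfeq x y ->
  (forall i, x i <> c) -> exists d, qfeq (snoc x c) (snoc y d).
Proof.
move=> hS hT xI xy xc.
have [b xcb] := hom_embeds hS (snoc x c).
have Pb := hom_pos hS (snoc_inj xI xc) xcb.
have xb : qfeq x (b \o lift ord_max).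
  by rewrite -{1}(snoc_lift x c); exact: qfeq_comp.
have [d ydb] := hom_extends hT (qfeq_inj xy xI) Pb (qfeq_trans (qfeq_sym xy) xb).
by exists d; exact: qfeq_trans xcb (qfeq_sym ydb).
Qed.

(** A set of pairs instead of two tuples: inclusion, reversal and unions of stages then need no
    bookkeeping of enumerations. It is never empty. *)
Definition finite_iso (S T : structure L) (Z : set (S * T)) :=
  exists n (x : 'I_n.+1 -> S) (y : 'I_n.+1 -> T),
    [/\ injective x, qfeq x y & Z = range (fun i => (x i, y i))].

Lemma finite_iso_forth (S T : structure L) (Z : set (S * T)) c :
  homogeneous S -> homogeneous T -> finite_iso Z ->
  exists Z', [/\ finite_iso Z', Z `<=` Z' & exists d, Z' (c, d)].
Proof.
move=> hS hT [n [x [y [xI xy ->]]]].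
have [[i <-]|nc] := pselect (exists i, x i = c).
  by exists (range (fun i => (x i, y i))); split=> //; [exists n, x, y|exists (y i), i].
have xc i : x i <> c by move=> e; apply: nc; exists i.
have [d xcyd] := homogeneous_forth hS hT xI xy xc.
exists (range (fun i => (snoc x c i, snoc y d i))); split.
- by exists n.+1, (snoc x c), (snoc y d); split=> //; exact: snoc_inj.
- by move=> _ [i _ <-]; exists (lift ord_max i); rewrite // /snoc liftK.
- by exists d, ord_max; rewrite // /snoc unlift_none.
Qed.

Lemma finite_iso_sym (S T : structure L) (Z : set (S * T)) :
  finite_iso Z -> finite_iso [set p : T * S | Z (p.2, p.1)].
Proof.
move=> [n [x [y [xI xy ->]]]]; exists n, y, x; split.
- exact: qfeq_inj xy xI.
- exact: qfeq_sym.
- apply/seteqP; split=> -[u v] /=; first by move=> [i _ [<- <-]]; exists i.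
  by move=> [i _ [<- <-]]; exists i.
Qed.

Hypothesis Pos_pair : forall b c : 'I_1 -> U, Pos b -> Pos c ->
  exists e : 'I_2 -> U, [/\ Pos e, qfeq (e \o lift ord_max) b &
    qfeq (e \o (fun _ : 'I_1 => ord_max)) c].

(** Extension applies to nonempty tuples only, so the first pair is found otherwise: a positive type
    of pairs joins the type of [s0] to that of [t0], and extending [s0] by it gives a point of [S]
    that looks like [t0]. *)
Lemma finite_iso_start (S T : structure L) : homogeneous S -> homogeneous T ->
  exists Z : set (S * T), finite_iso Z.
Proof.
move=> hS hT; have [s0 _] := structure_ex S; have [t0 _] := structure_ex T.
have inj1 X (x : 'I_1 -> X) : injective x by move=> i j _; rewrite (ord1 i) (ord1 j).
pose x (_ : 'I_1) := s0; pose y (_ : 'I_1) := t0.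
have [b xb] := hom_embeds hS x; have [c yc] := hom_embeds hT y.
have Pb := hom_pos hS (inj1 _ _) xb; have Pc := hom_pos hT (inj1 _ _) yc.
have [e [Pe eb ec]] := Pos_pair Pb Pc.
have [s xse] := hom_extends hS (inj1 _ x) Pe (qfeq_trans xb (qfeq_sym eb)).
exists (range (fun i => (snoc x s (ord_max : 'I_2), y i))).
exists 0%N, (snoc x s \o (fun _ : 'I_1 => ord_max)), y; split=> //.
apply: qfeq_trans (qfeq_sym yc); apply: qfeq_trans ec.
exact: qfeq_comp xse.
Qed.

Theorem homogeneous_unique (S T : structure L) (es : nat -> S) (et : nat -> T) :
  (forall s, exists n, es n = s) -> (forall t, exists n, et n = t) ->
  homogeneous S -> homogeneous T -> isomorphic S T.
Proof.
move=> esS etT hS hT.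
pose St := {Z : set (S * T) | finite_iso Z}.
(* One stage goes forth for [es k] and then back for [et k], which is forth for the reversed finite
   isomorphism. *)
have /choice[next nextP] : forall kZ : nat * St, exists Z' : St,
    [/\ sval kZ.2 `<=` sval Z', exists d, sval Z' (es kZ.1, d) &
        exists c, sval Z' (c, et kZ.1)].
  move=> [k [Z hZ]] /=.
  have [Z1 [h1 ZZ1 [d Z1d]]] := finite_iso_forth (es k) hS hT hZ.
  have [Z2 [h2 Z12 [c Z2c]]] := finite_iso_forth (et k) hT hS (finite_iso_sym h1).
  exists (exist _ _ (finite_iso_sym h2)) => /=; split.
  - by move=> [u v] /ZZ1 h; exact: (Z12 (v, u)).
  - by exists d; exact: (Z12 (d, es k)).
  - by exists c.
have [Z0 hZ0] := finite_iso_start hS hT.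
pose fix st k : St := if k is k'.+1 then next (k', st k') else exist _ Z0 hZ0.
have stS k : sval (st k) `<=` sval (st k.+1) by case: (nextP (k, st k)).
have stM k l : (k <= l)%N -> sval (st k) `<=` sval (st l).
  elim: l => [|l IH]; first by rewrite leqn0 => /eqP ->.
  rewrite leq_eqVlt => /predU1P[->//|/IH h]; exact: subset_trans h (stS l).
pose H u v := exists k, sval (st k) (u, v).
have Hl u : exists v, H u v.
  by have [k <-] := esS u; have [_ [d h] _] := nextP (k, st k); exists d, k.+1.
have Hr v : exists u, H u v.
  by have [k <-] := etT v; have [_ _ [c h]] := nextP (k, st k); exists c, k.+1.
have H2 u v u' v' : H u v -> H u' v' -> u = u' <-> v = v'.
  move=> [k h] [k' h'].
  have {}h := stM _ _ (leq_maxl k k') _ h; have {}h' := stM _ _ (leq_maxr k k') _ h'.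
  have [n [x [y [xI [xy _] e]]]] := svalP (st (maxn k k')).
  by move: h h'; rewrite e => -[i _ [<- <-]] [j _ [<- <-]]; exact: xy.
have [h hP] := choice Hl; have [g gP] := choice Hr.
exists h.
  exists g => [u|v]; first by apply/(H2 _ _ _ _ (gP (h u)) (hP u)).
  by apply/(H2 _ _ _ _ (hP (g v)) (gP v)).
move=> r v.
have /choice[kk kkP] : forall i, exists k, sval (st k) (v i, h (v i)) by move=> i; exact: hP.
(* Arities are finite, so a single stage contains all entries of [v]. *)
pose k := \max_i kk i.
have kP i : sval (st k) (v i, h (v i)).
  by apply: (stM _ _ _ _ (kkP i)); exact: leq_bigmax.
have [n [x [y [xI [_ xy] e]]]] := svalP (st k).
have /choice[t tP] : forall i, exists l, (x l, y l) = (v i, h (v i)).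
  by move=> i; have := kP i; rewrite e => -[l _ <-]; exists l.
have -> : v = x \o t by apply/funext => i /=; case: (tP i).
have -> : h \o (x \o t) = y \o t.
  by apply/funext => i /=; case: (tP i) => -> ->.
exact: xy.
Qed.

End BackAndForth.

(** * The induced structure *)

Section Final.
Context (R : realType) (L : language) (U : structure L) (K : Type) (M : set U).
Hypothesis monU : monster K U.
Hypothesis smallM : small_model K M.
Context (mu : kfun R U unit).
Hypotheses (muK : keisler [set: U] mu) (muX : excellent_extension K M mu).
Let muE : excellent K M mu := muX.2.
Let muB : borel_definable M mu. Proof. by case: muE => -[]. Qed.
Let M0 := small_model_nonempty smallM.
Local Notation mpow := (@mpow R L U K M mu).
Local Notation kap := (kappa K M mu).
Local Notation P := (Pmu K M mu).

Definition positive_diag n (b : 'I_n.+1 -> U) : Prop :=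
  0 < @mpow n (lift_params U (diag b)).

Lemma satp_diag n (v b : 'I_n -> U) : satp v (lift_params U (diag b)) <-> qfeq v b.
Proof. by rewrite satp_lift sat_diag. Qed.

Lemma satp_and X (v : X -> U) (f g : formula L (X + U)) :
  satp v (fAnd f g) <-> satp v f /\ satp v g.
Proof. by []. Qed.

Lemma positive_diag_qfeq n (b b' : 'I_n.+1 -> U) :
  qfeq b b' -> positive_diag b -> positive_diag b'.
Proof.
move=> bb'; rewrite /positive_diag; suff -> : @mpow n (lift_params U (diag b)) =
    @mpow n (lift_params U (diag b')) by [].
apply: (keisler_equiv (mpow_keisler monU smallM muK muE n));
  [exact: lang_overT|exact: lang_overT|move=> v].
rewrite !satp_diag; split=> h; apply: qfeq_trans h _ => //; exact: qfeq_sym.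
Qed.

(** The conjuncts share no variable, so the fiber is the indicator of [f] times the constant measure
    of [g]. *)
Lemma mpow_and (f g : formula L ('I_1 + U)) : lang_over M f -> lang_over M g ->
  @mpow 1 (fAnd (vrename (lift ord_max) f) (vrename (fun _ : 'I_1 => ord_max) g)) =
  @mpow 0 g * @mpow 0 f.
Proof.
move=> fM gM; set h := fAnd _ _.
have kM : keisler M (@mpow 0).
  by apply: keisler_restrict; exact: (mpow_keisler monU smallM muK muE).
have hM : lang_over M (vrename (@split_last 0) h).
  apply/lang_over_vrename; have h1 : lang_over M (vrename (lift (@ord_max 1)) f).
    by apply/lang_over_vrename.
  have h2 : lang_over M (vrename (fun _ : 'I_1 => @ord_max 1) g).
    by apply/lang_over_vrename.
  by split; [exact: h1|exact: h2].
have lT X (k : formula L (X + U)) := lang_overT k.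
rewrite [LHS](morleyE monU smallM muK muB (@real_ord _ _ _ monU _)
  (mpow_keisler monU smallM muK muE 0) smallM (@subset_refl _ M) hM).
have mf := clopen_measurable fM.
rewrite -(Rintegral_clopen kM fM) -RintegralZl //; last first.
  apply: measurable_bounded_integrable => //.
  - by apply: le_lt_trans (ltry 1); exact: probability_le1.
  - exists 1; split=> // x x1 q _ /=; apply: le_trans (ltW x1).
    by rewrite indicE; case: (_ \in _); rewrite /= ?normr1 ?normr0.
congr (Rintegral _ _ _); apply/funext => q.
have [b bq] := real_ord monU q smallM.1.
rewrite (fiberE muB (@subset_refl _ M) M0 hM bq) indicE.
have E v : satp v (plug b (vrename (@split_last 0) h)) <->
    satp b f /\ satp v (vrename (fun=> tt) g).
  rewrite satp_plug satp_vrename /h satp_and !satp_vrename.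
  set bv := fun _ => _.
  have -> : (bv \o @split_last 0) \o lift ord_max = b.
    by apply/funext => i; rewrite /comp split_last_lift.
  have -> : (bv \o @split_last 0) \o (fun _ : 'I_1 => ord_max) = v \o (fun=> tt) :> ('I_1 -> U).
    by apply/funext => i; rewrite /comp split_last_max.
  by [].
have [qf|qnf] := stype_complete q fM.
  rewrite mem_set // mulr1; apply: (keisler_equiv muK) => // v.
  by rewrite E; split=> [[]//|?]; split=> //; exact: bq.
rewrite memNset ?mulr0; last by move=> qf; move/(stype_not _ fM): qnf.
transitivity (mu (fNot fTrue)); last exact: (keisler_false muK).
apply: (keisler_equiv muK) => // v; rewrite E; split=> [[bf _]|k]; last by case: k.
by have /= := bq _ qnf.
Qed.

(** The two one-point diagrams, put on separate variables, have positive product measure. By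
    compactness finitely many two-point diagrams cover this event, so one of them has positive
    measure. *)
Lemma positive_diag_pair (b c : 'I_1 -> U) : positive_diag b -> positive_diag c ->
  exists e : 'I_2 -> U, [/\ positive_diag e, qfeq (e \o lift ord_max) b &
    qfeq (e \o (fun _ : 'I_1 => ord_max)) c].
Proof.
move=> Pb Pc.
pose f : formula L ('I_2 + U) := fAnd (vrename (lift ord_max) (lift_params U (diag b)))
  (vrename (fun _ : 'I_1 => ord_max) (lift_params U (diag c))).
have f0 : 0 < @mpow 1 f by rewrite mpow_and ?mulr_gt0 //; exact: lang_over_lift.
have fE v : satp v f <-> qfeq (v \o lift ord_max) b /\
    qfeq (v \o (fun _ : 'I_1 => ord_max)) c.
  by rewrite /f satp_and !satp_vrename !satp_diag.
have fA : lang_over set0 f.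
  have h1 : lang_over (set0 : set U) (vrename (lift (@ord_max 1)) (lift_params U (diag b))).
    by apply/lang_over_vrename; exact: lang_over_lift.
  have h2 : lang_over (set0 : set U) (vrename (fun _ : 'I_1 => @ord_max 1) (lift_params U (diag c))).
    by apply/lang_over_vrename; exact: lang_over_lift.
  by split; [exact: h1|exact: h2].
(* Types over the empty set are realized in [U], so diagrams of pairs from [U] suffice to cover the
   clopen set of [f]. *)
pose Ps := [set lift_params U (diag e) | e in [set e : 'I_2 -> U | satp e f]].
have [||p pf|s [t [sf tP cov]]] := @stype_finite_cover _ U set0 'I_2 [set f] Ps.
- by move=> _ ->.
- by move=> _ [e _ <-]; exact: lang_over_lift.
- have s0 : small K (set0 : set U) by apply: small_sub smallM.1.
  have [e ep] := real_ord monU p s0.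
  exists (lift_params U (diag e)); first by exists e => //; apply: ep; exact: pf.
  have [//|/ep /= h] := stype_complete p (lang_over_lift set0 (diag e)).
  by exfalso; apply: h; apply/satp_diag; exact: qfeq_refl.
apply: contrapT => ne.
have k1 := mpow_keisler monU smallM muK muE 1.
have : @mpow 1 f <= \sum_(g <- t) @mpow 1 g.
  apply: le_trans (keisler_ors_le k1 _); last by move=> g _; exact: lang_overT.
  apply: (keisler_le k1); [exact: lang_overT|exact: lang_overT|move=> v vf].
  by apply/sat_fOrs; apply: cov => g /sf ->.
apply/negP; rewrite -ltNge; apply: le_lt_trans f0.
rewrite big_seq; apply: sumr_le0 => g /tP[e /fE[eb ec] <-].
by rewrite leNgt; apply/negP => Pe; apply: ne; exists e.
Qed.

Lemma qf_representatives n : exists rep : nat -> 'I_n -> U,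
  forall b : 'I_n -> U, exists k, qfeq b (rep k).
Proof.
have cI : injective (@nat_of_ord n) by exact: val_inj.
have [dec decS] := formula_decode L cI.
have [x0 _] := structure_ex U.
have /choice[rep repP] : forall k, exists e : 'I_n -> U,
    (exists b : 'I_n -> U, diag b = dec k) -> diag e = dec k.
  by move=> k; have [[b h]|h] := pselect (exists b : 'I_n -> U, diag b = dec k);
    [exists b|exists (fun=> x0)].
exists rep => b; have [k kb] := decS (diag b); exists k.
apply/sat_diag; rewrite repP; first by rewrite kb; apply/sat_diag; exact: qfeq_refl.
by exists b.
Qed.

Definition rep n : nat -> 'I_n -> U := projT1 (cid (qf_representatives n)).

Lemma repP n (b : 'I_n -> U) : exists k, qfeq b (@rep n k).
Proof. by rewrite /rep; case: cid. Qed.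

Definition atoms n (s : 'I_n -> nat) (b : 'I_n -> U) : set (borel nat [set: U]) :=
  clopen_of setT (vrename s (lift_params U (diag b))).

Lemma atoms_measurable n (s : 'I_n -> nat) b : measurable (atoms s b).
Proof. by apply: clopen_measurable; exact: lang_overT. Qed.

(* The [rep k] represent all quantifier-free types, so that only countably many
   null sets are removed.  The injectivity conditions on them are what makes
   [generic] equal to some [B_N]: a type may repeat an element without changing
   its induced structure. *)
Definition bad_index := ({n : nat & {ffun 'I_n.+1 -> nat}} * nat)%type.

Definition bad_diag (t : bad_index) : set (borel nat [set: U]) :=
  let: (existT n s, k) := t in
  if pselect [/\ injective s, injective (@rep n.+1 k) & ~ positive_diag (@rep n.+1 k)]
  is left _ then atoms s (@rep n.+1 k) else set0.

Definition bad_extension (t : bad_index) : set (borel nat [set: U]) :=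
  let: (existT n s, k) := t in
  if pselect [/\ injective s, injective (@rep n.+2 k \o lift ord_max) &
    positive_diag (@rep n.+2 k)]
  is left _ then atoms s (@rep n.+2 k \o lift ord_max) `&`
    \bigcap_l ~` atoms (snoc s l) (@rep n.+2 k) else set0.

Definition generic : set (borel nat [set: U]) :=
  ~` (\bigcup_t bad_diag t `|` \bigcup_t bad_extension t).

Lemma countable_null_union d (T : measurableType d) (m : {measure set T -> \bar R})
    (I : countType) (F : I -> set T) :
  (forall i, measurable (F i)) -> (forall i, m (F i) = 0%E) ->
  measurable (\bigcup_i F i) /\ m (\bigcup_i F i) = 0%E.
Proof.
move=> mF F0; pose H k := if choice.unpickle k is Some i then F i else set0.
have mH k : measurable (H k) by rewrite /H; case: choice.unpickle.
have H0 k : m (H k) = 0%E by rewrite /H; case: choice.unpickle => [i|]; rewrite ?F0 ?measure0.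
have -> : \bigcup_i F i = \bigcup_k H k.
  apply/seteqP; split=> x; first by move=> [i _ Fi]; exists (choice.pickle i); rewrite // /H choice.pickleK.
  by move=> [k _]; rewrite /H; case: choice.unpickle => // i Fi; exists i.
split; first exact: bigcupT_measurable.
apply/eqP; rewrite eq_le measure_ge0 andbT.
apply: le_trans (measure_sigma_subadditive m mH _ (@subset_refl _ _)) _.
  exact: bigcupT_measurable.
by rewrite eseries0 // => k _ _; exact: H0.
Qed.

Lemma kappa_vrename (s : nat -> nat) g : injective s -> kap (vrename s g) = kap g.
Proof.
move=> sI; have [n gn] := below_ex g.
have -> : vrename s g = vrename (s \o @nat_of_ord n.+1) (vrename inord g).
  by rewrite vrename_comp; apply: frename_ext gn _ => -[i im|//] /=; rewrite inordK.
rewrite (kappa_injective monU smallM muK muE); last by move=> i j /sI /val_inj.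
by rewrite (kappaE monU smallM muK muE gn).
Qed.

Lemma atomsE n (s : 'I_n.+1 -> nat) b : injective s ->
  P (atoms s b) = (@mpow n (lift_params U (diag b)))%:E.
Proof.
move=> sI; rewrite /atoms (PmuE monU smallM muK muE).
by rewrite (kappa_injective monU smallM muK muE).
Qed.

Lemma bad_diag_null t : measurable (bad_diag t) /\ P (bad_diag t) = 0%E.
Proof.
case: t => -[n s] k /=; case: pselect => [[sI _ nP]|_]; last first.
  by split; [exact: measurable0|exact: measure0].
split; first exact: atoms_measurable.
rewrite atomsE //; congr EFin; apply/eqP; rewrite eq_le.
rewrite (keisler_ge0 (mpow_keisler monU smallM muK muE n) (lang_overT _)) andbT.
by rewrite leNgt; apply/negP.
Qed.

(** A tuple that no index [l] extends is in particular not extended along a sequence of fresh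
    indices. By exchangeability that larger event has the measure of [escape m], for every [m]. *)
Lemma bad_extension_null t : measurable (bad_extension t) /\ P (bad_extension t) = 0%E.
Proof.
case: t => -[n s] k /=; case: pselect => [[sI _ pb]|_]; last first.
  by split; [exact: measurable0|exact: measure0].
set b := @rep n.+2 k in pb *; set E := (X in measurable X).
have mE : measurable E.
  apply: measurableI; first exact: atoms_measurable.
  by apply: bigcapT_measurable => l; apply: measurableC; exact: atoms_measurable.
split=> //; apply/eqP; rewrite eq_le measure_ge0 andbT.
rewrite -(fineK (fin_num_measure P _ mE)) lee_fin.
(* By definition of [mpow n.+1], positivity of the diagram is the premise of the extension axiom. *)
have ext := muX.1.2 n b pb.
apply: (escape_null monU smallM muK muE ext) => m.
(* [B] exceeds all entries of [s], so [s'] continues [s] injectively with indices beyond it. *)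
pose B := (\max_i s i).+1.
pose s' j := if (j < n.+1)%N then s (inord j) else (B + j)%N.
have sB i : (s i < B)%N by rewrite ltnS; exact: leq_bigmax.
have s's (i : 'I_n.+1) : s' i = s i by rewrite /s' ltn_ord inord_val.
have s'I : injective s'.
  move=> i j; rewrite /s'; case: ifP => hi; case: ifP => hj.
  - by move=> /sI /(congr1 val) /=; rewrite !inordK.
  - by move=> e; have := sB (inord i); rewrite e ltnNge leq_addr.
  - by move=> e; have := sB (inord j); rewrite -e ltnNge leq_addr.
  - exact: addnI.
rewrite -(kappa_vrename (escape b m) s'I) -lee_fin -(PmuE monU smallM muK muE).
rewrite (fineK (fin_num_measure P _ mE)); apply: le_measure; rewrite ?inE //.
  by apply: clopen_measurable; exact: lang_overT.
move=> p [pb0 pbl]; rewrite /clopen_of /=.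
pose l := vrename s (lift_params U (diag (b \o lift ord_max))) ::
  [seq fNot (vrename (snoc s (s' j)) (lift_params U (diag b))) | j <- iota n.+1 m].
apply: (@stype_imp _ _ _ _ p l); [|exact: lang_overT|].
  move=> f; rewrite inE => /predU1P[->//|/mapP[j _ ->]].
  by apply/stype_not; [exact: lang_overT|exact: pbl].
move=> v vl; apply/satp_vrename/satp_escape; split.
  have /satp_vrename := vl _ (mem_head _ _); congr satp.
  by apply/funext => i /=; rewrite s's.
move=> j jm; have jl : fNot (vrename (snoc s (s' j)) (lift_params U (diag b))) \in l.
  rewrite inE; apply/orP; right; apply/mapP; exists j => //.
  by rewrite mem_iota.
have h : ~ satp v (vrename (snoc s (s' j)) (lift_params U (diag b))) := vl _ jl.
move: h; rewrite satp_vrename; congr (~ (satp _ _)).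
by apply/funext => i /=; rewrite /snoc; case: unlift => [i'|] //; rewrite s's.
Qed.

Lemma generic_measurable : measurable generic.
Proof.
have [m1 _] := countable_null_union (fun t => (bad_diag_null t).1) (fun t => (bad_diag_null t).2).
have [m2 _] := countable_null_union (fun t => (bad_extension_null t).1) (fun t => (bad_extension_null t).2).
by apply: measurableC; exact: measurableU.
Qed.

Lemma generic_full : P generic = 1%E.
Proof.
have [m1 z1] := countable_null_union (fun t => (bad_diag_null t).1) (fun t => (bad_diag_null t).2).
have [m2 z2] := countable_null_union (fun t => (bad_extension_null t).1) (fun t => (bad_extension_null t).2).
rewrite /generic probability_setC; last exact: measurableU.
by rewrite measureU0 // z1 sube0.
Qed.

Section Induced.
Variables (p : stype nat [set: U]) (U' : structure L) (j : U -> U') (a : nat -> U').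
Hypotheses (jE : elementary_embedding j) (pa : forall f, p f -> sat (asg a j) f).
Let S := substructure (range_nonempty a).

Definition element (i : nat) : S := exist _ (a i) (ex_intro2 _ _ i I erefl).

Lemma element_surj (s : S) : exists i, element i = s.
Proof. by have [i _ e] := svalP s; exists i; exact: sval_injective. Qed.

Lemma qfeq_element (T : structure L) n (s : 'I_n -> nat) (b : 'I_n -> T) :
  qfeq (element \o s) b <-> qfeq (a \o s) b.
Proof.
have E i k : element i = element k <-> a i = a k.
  by split=> [/(congr1 sval)//|e]; exact: sval_injective.
by split=> -[h1 h2]; split=> // i k; rewrite -h1 E.
Qed.

Lemma mem_lift n (s : 'I_n -> nat) (g : formula L 'I_n) :
  p (vrename s (lift_params U g)) <-> sat (a \o s) g.
Proof.
have E : sat (asg a j) (vrename s (lift_params U g)) <-> sat (a \o s) g.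
  by rewrite !sat_frename.
rewrite -E; split=> [/pa//|h].
have [//|/pa /=] := stype_complete p (lang_overT (vrename s (lift_params U g))).
by move=> /(_ h).
Qed.

Lemma mem_atoms n (s : 'I_n -> nat) (b : 'I_n -> U) :
  atoms s b p <-> qfeq (element \o s) b.
Proof. by rewrite qfeq_element -sat_diag; exact: mem_lift. Qed.

(** Membership of [p] in an atom is a statement about the induced structure alone, whichever
    realization [a] is used. Hence [generic] depends only on its isomorphism type. *)
Lemma generic_homogeneous : generic p <-> homogeneous positive_diag S.
Proof.
split=> [gp|hS].
  have ex n (x : 'I_n -> S) : exists s : {ffun 'I_n -> nat}, x = element \o s.
    have /choice[s sE] : forall i, exists k, element k = x i by move=> i; exact: element_surj.
    by exists (finfun s); apply/funext => i /=; rewrite ffunE sE.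
  (* Only this direction holds: different indices may name the same element. *)
  have sI n (s : {ffun 'I_n -> nat}) : injective (element \o s) -> injective s.
    by move=> xI i k e; apply: xI; rewrite /= e.
  split.
  - move=> n x; have [s ->] := ex _ x.
    (* Finite satisfiability of [p] brings the diagram of finitely many [a i] back into [U]. *)
    have : p (vrename s (lift_params U (diag (a \o s)))).
      by apply/mem_lift; apply/sat_diag; exact: qfeq_refl.
    move=> pd; have [|v vd] := @stype_fsat _ _ _ _ p [:: vrename s (lift_params U (diag (a \o s)))].
      by move=> f; rewrite inE => /eqP ->.
    exists (v \o s); apply/qfeq_element; apply: qfeq_sym; apply/sat_diag/satp_lift.
    by apply/satp_vrename; apply: vd; rewrite mem_head.
  - move=> n x b; have [s ->] := ex _ x => xI xb.
    have [k bk] := repP b; apply: contrapT => nb; apply: gp; left.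
    exists (existT _ n s, k) => //=; case: pselect => [_|[]]; last split.
    + by apply/mem_atoms; exact: qfeq_trans xb bk.
    + exact: sI.
    + exact: qfeq_inj (qfeq_trans xb bk) xI.
    + by move=> /(positive_diag_qfeq (qfeq_sym bk)).
  - move=> n x b; have [s ->] := ex _ x => xI Pb xb.
    have [k bk] := repP b.
    have xr : qfeq (element \o s) (@rep n.+2 k \o lift ord_max).
      by apply: qfeq_trans xb _; exact: qfeq_comp.
    apply: contrapT => nc; apply: gp; right.
    exists (existT _ n s, k) => //=; case: pselect => [_|[]]; last split.
    + split; first exact/mem_atoms.
      move=> l _ /mem_atoms h; apply: nc; exists (element l).
      apply: qfeq_trans (qfeq_sym bk); move: h; congr qfeq.
      by apply/funext => i /=; rewrite /snoc; case: unlift.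
    + exact: sI.
    + exact: qfeq_inj xr xI.
    + exact: positive_diag_qfeq Pb.
case=> -[[[n s] k] _] /=; case: pselect => // -[sI rI rP].
  move=> /mem_atoms xr; apply: rP; apply: (hom_pos hS _ xr).
  exact: qfeq_inj (qfeq_sym xr) rI.
move=> [/mem_atoms xr nl].
have [c cr] := hom_extends hS (qfeq_inj (qfeq_sym xr) rI) rP xr.
have [l lc] := element_surj c; apply: (nl l I); apply/mem_atoms.
move: cr; rewrite -lc; congr qfeq.
by apply/funext => i /=; rewrite /snoc; case: unlift.
Qed.

End Induced.

End Final.

Theorem theorem4p14 (R : realType) (L : language) (T : set (sentence L))
    (U : structure L) (K : Type) (M : set U) (mu : kfun R U unit) :
  complete_theory T ->
  models U T -> monster K U ->
  small_model K M ->
  keisler [set: U] mu -> invariant_over M mu ->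
  excellent_extension K M mu ->
  exists N : structure L,
    [/\ countable [set: N],
        measurable (B_ U N : set (borel nat [set: U])) &
        Pmu K M mu (B_ U N) = 1%E].
Proof.
move=> _ _ monU smallM muK _ muX.
(* Any point of the full set supplies [N]; one exists because the measure is not 0. *)
have [p gp] : exists p, generic K M mu p.
  apply: contrapT => np; have := generic_full monU smallM muK muX.
  have -> : generic K M mu = set0.
    by apply/seteqP; split=> q // gq; apply: np; exists q.
  by rewrite measure0 => /eqP; rewrite eq_sym onee_eq0.
have [U' [j [a [jE pa]]]] := stype_realized p.
pose N := substructure (range_nonempty a).
have hN : homogeneous (positive_diag K M mu) N by apply/(generic_homogeneous monU smallM muK muX pa).
(* This equality also yields the measurability of [B_ U N], as [generic] is the complement of a
   countable union of measurable sets. *)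
have BE : B_ U N = generic K M mu.
  apply/seteqP; split=> q.
    move=> [U1 [j1 [a1 [j1E qa1 iso]]]].
    apply/(generic_homogeneous monU smallM muK muX qa1).
    have [h [g hK gK] hi] := iso.
    apply: homogeneous_isomorphic hN; exists g.
      by exists h.
    move=> r v; rewrite [X in _ <-> X]hi.
    by rewrite (_ : h \o (g \o v) = v) //; apply/funext => k /=.
  move=> gq; have [U1 [j1 [a1 [j1E qa1]]]] := stype_realized q.
  exists U1, j1, a1; split=> //.
  have h1 : homogeneous (positive_diag K M mu) (substructure (range_nonempty a1)).
    by apply/(generic_homogeneous monU smallM muK muX qa1).
  apply: (homogeneous_unique (positive_diag_pair monU smallM muK muX)
    (@element_surj _ _ _) (@element_surj _ _ _) h1 hN).
exists N; rewrite BE; split.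
- apply: sub_countable (_ : countable (range (element a))); last exact: sub_countable (card_image_le _ _) _.
  by apply: subset_card_le => s _; have [i <-] := element_surj s; exists i.
- exact: (generic_measurable monU smallM muK muX).
- exact: (generic_full monU smallM muK muX).
Qed.
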